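(* If $V$ is continuously embedded in $C_0^2(\mathbb{R}^n,\mathbb{R}^n)$, $W$ is continuously embedded in $C_0^1(\mathbb{R}^n\times\widetilde{G}^n_d)$, and $\mathrm{supp}(\mu_0)\subset K$ for some compact subset $K$ of $\mathbb{R}^n\times\widetilde{G}^n_d$, then there exists a global minimizer over $v\in L^2([0,1],V)$ of the functional $$E(v)=\frac12\int_0^1\|v_t\|_V^2\,dt+\lambda\,\|(\varphi_1^v)_{\#}\mu_0-\mu_{tar}\|_{W^*}^2 .$$
   Context: Let $0\le d\le n$. $\widetilde{G}^n_d$ is the (compact) manifold of oriented $d$-dimensional linear subspaces of $\mathbb{R}^n$, identified with a subset of the unit sphere of $\Lambda^d(\mathbb{R}^n)$ by $T\mapsto \frac{u_1\wedge\cdots\wedge u_d}{|u_1\wedge\cdots\wedge u_d|}$ for any basis $(u_i)$ of $T$ consistent with its orientation (inner product $\langle \xi_1\wedge\cdots\wedge\xi_d,\eta_1\wedge\cdots\wedge\eta_d\rangle=\det(\xi_i\cdot\eta_j)_{i,j}$). An invertible linear map $A$ of $\mathbb{R}^n$ acts by $A\cdot T=\frac{Au_1\wedge\cdots\wedge Au_d}{|Au_1\wedge\cdots\wedge Au_d|}$. $\mathcal{V}_d$ is the set of oriented $d$-varifolds, i.e. nonnegative finite Radon measures on $\mathbb{R}^n\times\widetilde{G}^n_d$; $(\mu|\omega)=\int\omega\,d\mu$. Here $\mu_0,\mu_{tar}\in\mathcal{V}_d$ and $\lambda>0$ are fixed. Pushforward: for a diffeomorphism $\phi$ of $\mathbb{R}^n$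 and $\mu\in\mathcal{V}_d$, $(\phi_\#\mu|\omega)=\int\omega(\phi(x),d_x\phi\cdot T)\,J_T\phi(x)\,d\mu(x,T)$, where $J_T\phi(x)=\sqrt{\det\big((d_x\phi(e_i)\cdot d_x\phi(e_j))_{i,j=1,\dots,d}\big)}$ for an orthonormal basis $(e_1,\dots,e_d)$ of $T$ is the change of $d$-volume along $T$. $V$ is a reproducing kernel Hilbert space (RKHS) of vector fields on $\mathbb{R}^n$; $L^2([0,1],V)$ is the space of square-integrable time-dependent fields $v$ with $v_t\in V$; the flow $\varphi_t^v$ is defined by $\varphi_0^v=\mathrm{id}$, $\dot\varphi_t^v=v_t\circ\varphi_t^v$. $W$ is the RKHS of the kernel $k((x,T),(x',T'))=k^{pos}(x,x')k^G(T,T')$ on $\mathbb{R}^n\times\widetilde{G}^n_d$, where $k^{pos}$, $k^G$ are continuous positive definite kernels on $\mathbb{R}^n$, $\widetilde{G}^n_d$ with $k^{pos}(x,\cdot)\in C_0(\mathbb{R}^n)$ for all $x$. $\|\mu\|_{W^*}=\sup_{\omega\in W,\|\omega\|_W\le1}|(\mu|\omega)|$. $C_0^p$ denotes the Banach space of $C^p$ functions vanishing at infinity together with their derivatives up to order $p$, with the sum of sup-norms of derivatives up to order $p$. *)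

(* Defs.v *)
From HB Require Import structures.
From mathcomp Require Import all_boot all_order all_algebra.
From mathcomp Require Import all_classical all_reals all_analysis.
Set Implicit Arguments.
Unset Strict Implicit.
Unset Printing Implicit Defensive.
Import Order.TTheory GRing.Theory Num.Theory.
Import numFieldNormedType.Exports.
Local Open Scope classical_set_scope.
Local Open Scope ring_scope.

(* R^n is 'rV[R]_n, with the max norm of the library: only the equivalence
   class of the norms of the C_0^p spaces matters for continuous embeddings.
   A d-frame (u_1, ..., u_d) is the matrix U : 'M[R]_(d, n) with rows u_i. *)

(* index set of the canonical basis e_{i_1} /\ ... /\ e_{i_d},
   i_1 < ... < i_d, of the exterior power *)
Definition ext_index (n d : nat) :=
  {t : d.-tuple 'I_n | sorted ltn (map val t)}.

Definition ext_power (R : realType) (n d : nat) : normedModType R :=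
  'rV[R]_#|{: ext_index n d}|.

(* u_1 /\ ... /\ u_d, by its Pluecker coordinates *)
Definition wedge (R : realType) (n d : nat) (U : 'M[R]_(d, n)) :
    ext_power R n d :=
  \row_(k < #|{: ext_index n d}|) \det (colsub (tnth (val (enum_val k))) U).

(* the norm |u_1 /\ ... /\ u_d| for the inner product det(xi_i . eta_j) *)
Definition wedge_norm (R : realType) (n d : nat) (U : 'M[R]_(d, n)) : R :=
  Num.sqrt (\det (U *m U^T)).

Definition unit_wedge (R : realType) (n d : nat) (U : 'M[R]_(d, n)) :
    ext_power R n d :=
  (wedge_norm U)^-1 *: wedge U.

Definition grassmannian (R : realType) (n d : nat) : set (ext_power R n d) :=
  [set unit_wedge U | U in [set U : 'M[R]_(d, n) | row_free U]].
Arguments grassmannian : clear implicits.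

(* The bound d <= n makes the type nonempty, as measurable types must be. *)
Definition grass (R : realType) (n d : nat) (le_dn : (d <= n)%N) : Type :=
  set_type (grassmannian R n d).

Section grass_instances.
Variables (R : realType) (n d : nat) (le_dn : (d <= n)%N).

Lemma grass_point_subproof :
  unit_wedge (pid_mx d : 'M[R]_(d, n)) \in grassmannian R n d.
Proof.
apply/mem_set; exists (pid_mx d) => //=.
by rewrite /row_free rank_pid_mx.
Qed.

HB.instance Definition _ := SubType.on (grass R le_dn).
HB.instance Definition _ := Choice.on (grass R le_dn).
HB.instance Definition _ := PseudoMetric.on (grass R le_dn).
HB.instance Definition _ := isPointed.Build (grass R le_dn)
  (SigSub grass_point_subproof).

End grass_instances.

Notation position R n le_dn := ('rV[R]_n * grass R le_dn)%type (only parsing).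

Section varifolds.
Variables (R : realType) (n d : nat) (le_dn : (d <= n)%N).
Implicit Types (T : grass R le_dn) (A : 'M[R]_n).

Definition oriented_basis T : 'M[R]_(d, n) :=
  xget 0 [set U | row_free U /\ unit_wedge U = val T].

Definition oriented_onb T : 'M[R]_(d, n) :=
  xget 0 [set U | U *m U^T = 1%:M /\ unit_wedge U = val T].

(* Vectors are rows, so that the linear map A sends u to u *m A. The default
   value T is only reached when A is not injective on T. *)
Definition grass_act A T : grass R le_dn :=
  insubd T (unit_wedge (oriented_basis T *m A)).

(* change of d-volume along T *)
Definition grass_jac A T : R := wedge_norm (oriented_onb T *m A).

End varifolds.

Notation borel X := (g_sigma_algebraType (@open X)).

Record varifold (R : realType) (n d : nat) (le_dn : (d <= n)%N) := Varifold {
  varifold_measure :>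
    {finite_measure set (borel (position R n le_dn)) -> \bar R};
  varifold_radon : forall B : set (borel (position R n le_dn)), measurable B ->
    varifold_measure B = ereal_sup [set varifold_measure K |
      K in [set K : set (position R n le_dn) | compact K /\ K `<=` B]] }.

Definition varifold_supp (R : realType) (n d : nat) (le_dn : (d <= n)%N)
    (mu : varifold R le_dn) : set (position R n le_dn) :=
  [set p | forall O : set (position R n le_dn), open O -> O p ->
    (0 < mu O)%E].

(* (mu | omega) *)
Definition varifold_pair (R : realType) (n d : nat) (le_dn : (d <= n)%N)
    (mu : varifold R le_dn) (omega : position R n le_dn -> R) : R :=
  \int[mu]_p omega p.

(* (phi_# mu | omega) *)
Definition pushforward_pair (R : realType) (n d : nat) (le_dn : (d <= n)%N)
    (phi : 'rV[R]_n -> 'rV[R]_n) (mu : varifold R le_dn)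
    (omega : position R n le_dn -> R) : R :=
  \int[mu]_p (omega (phi p.1, grass_act (jacobian phi p.1) p.2) *
              grass_jac (jacobian phi p.1) p.2).

(* A Hilbert space of functions X -> F on which the point evaluations are
   continuous; rk_inj identifies its elements with functions. *)
Record rkhs (R : realType) (X : Type) (F : normedModType R) := RKHS {
  rk_space :> completeNormedModType R;
  rk_dot : {dot rk_space for idfun};
  rk_norm : forall u : rk_space, `|u| ^+ 2 = rk_dot u u;
  rk_eval : X -> {linear rk_space -> F};
  rk_eval_continuous : forall x, continuous (rk_eval x);
  rk_inj : forall u w : rk_space,
    (forall x, rk_eval x u = rk_eval x w) -> u = w }.

Definition rk_fun (R : realType) (X : Type) (F : normedModType R)
  (H : rkhs X F) (u : H) : X -> F := fun x => rk_eval H x u.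

Definition pos_def_kernel (R : realType) (X : Type) (k : X -> X -> R) : Prop :=
  (forall x y, k x y = k y x) /\
  (forall (N : nat) (x : 'I_N -> X) (a : 'I_N -> R),
     0 <= \sum_(i < N) \sum_(j < N) a i * a j * k (x i) (x j)).

Definition is_rkhs_of (R : realType) (X : Type) (k : X -> X -> R)
    (H : rkhs X R) : Prop :=
  forall x, exists kx : H,
    rk_fun kx = k x /\ forall u : H, rk_dot H kx u = rk_fun u x.

Definition rk_dual_norm (R : realType) (X : Type) (F : normedModType R)
    (H : rkhs X F) (L : (X -> F) -> R) : \bar R :=
  ereal_sup [set `|L (rk_fun u)|%:E | u in [set u : H | `|u| <= 1]].

Definition vanishes_at_infinity (R : realType) (X : topologicalType)
    (h : X -> \bar R) : Prop :=
  forall e : R, 0 < e ->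
    exists2 K : set X, compact K & forall x, ~ K x -> (h x <= e%:E)%E.

Section C0p.
Variables (R : realType) (n : nat) (F : normedModType R).
Implicit Types f : 'rV[R]_n -> F.

Definition iter_derive (ws : seq 'rV[R]_n) f : 'rV[R]_n -> F :=
  foldr (fun w g => 'D_w g) f ws.

(* operator norm of the k-th derivative at x, which is the k-linear map
   (w_1, ..., w_k) |-> D_{w_1} ... D_{w_k} f (x) *)
Definition deriv_norm (k : nat) f (x : 'rV[R]_n) : \bar R :=
  ereal_sup [set `|iter_derive ws f x|%:E |
    ws in [set ws | size ws = k /\ forall w, w \in ws -> `|w| <= 1]].

Definition is_Cp (p : nat) f : Prop :=
  forall ws, (size ws <= p)%N -> continuous (iter_derive ws f) /\
    ((size ws < p)%N -> forall w x, derivable (iter_derive ws f) x w).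

Definition is_C0p (p : nat) f : Prop :=
  is_Cp p f /\ forall k, (k <= p)%N -> vanishes_at_infinity (deriv_norm k f).

Definition C0p_norm (p : nat) f : \bar R :=
  (\sum_(k < p.+1) ereal_sup (range (deriv_norm k f)))%E.

Definition embedded_in_C0p (p : nat) (H : rkhs 'rV[R]_n F) : Prop :=
  (forall u : H, is_C0p p (rk_fun u)) /\
  exists C : R, forall u : H, (C0p_norm p (rk_fun u) <= (C * `|u|)%:E)%E.

End C0p.

Section C01_varifold.
Variables (R : realType) (n d : nat) (le_dn : (d <= n)%N).

Definition ambient : normedModType R := ('rV[R]_n * ext_power R n d)%type.

Definition to_ambient (p : position R n le_dn) : ambient := (p.1, val p.2).

Definition is_C1_on (O : set ambient) (g : ambient -> R) : Prop :=
  forall w p, O p -> derivable g p w /\ {for p, continuous ('D_w g)}.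

(* C^1 functions on the submanifold R^n x grass of the ambient space:
   restrictions, locally, of C^1 functions of the ambient space *)
Definition is_C1_position (f : position R n le_dn -> R) : Prop :=
  forall p, exists (O : set ambient) (g : ambient -> R),
    [/\ open O, O (to_ambient p), is_C1_on O g &
        forall q, O (to_ambient q) -> f q = g (to_ambient q)].

(* operator norm of the differential of f at p on the tangent space, whose
   vectors are the velocities w of the curves through p *)
Definition diff_norm (f : position R n le_dn -> R) (p : position R n le_dn) :
    \bar R :=
  ereal_sup [set `|'D_1 (f \o c) (0 : R)|%:E |
    c in [set c : R -> position R n le_dn | c 0 = p /\
      exists2 w, is_derive (0 : R) 1 (to_ambient \o c) w & `|w| <= 1]].

Definition is_C01_position (f : position R n le_dn -> R) : Prop :=
  [/\ is_C1_position f, vanishes_at_infinity (fun p => `|f p|%:E) &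
      vanishes_at_infinity (diff_norm f)].

Definition C01_position_norm (f : position R n le_dn -> R) : \bar R :=
  (ereal_sup (range (fun p => `|f p|%:E)) + ereal_sup (range (diff_norm f)))%E.

Definition embedded_in_C01 (H : rkhs (position R n le_dn) R) : Prop :=
  (forall u : H, is_C01_position (rk_fun u)) /\
  exists C : R, forall u : H,
    (C01_position_norm (rk_fun u) <= (C * `|u|)%:E)%E.

End C01_varifold.

Section functional.
Variables (R : realType) (n d : nat) (le_dn : (d <= n)%N).
Variables (V : rkhs 'rV[R]_n 'rV[R]_n) (W : rkhs (position R n le_dn) R).

(* For v in L^2([0,1], V). Spaces V embedded in C_0^2 are separable, so Borel
   measurability is Bochner measurability. *)
Definition is_L2 (v : R -> V) : Prop :=
  measurable_fun (`[0, 1] : set (measurableTypeR R)) (v : _ -> borel V) /\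
  (\int[lebesgue_measure]_(t in `[0%R, 1%R]) (`|v t| ^+ 2)%:E < +oo)%E.

(* phi_0 = id and d/dt phi_t = v_t \o phi_t, in the Caratheodory (integrated)
   sense since v is only square-integrable in time *)
Definition is_flow (v : R -> V) (phi : R -> 'rV[R]_n -> 'rV[R]_n) : Prop :=
  (forall x, phi 0 x = x) /\
  forall x t, 0 <= t <= 1 -> forall i,
    lebesgue_measure.-integrable `[0, t]
      (fun s => (rk_fun (v s) (phi s x) 0 i)%:E) /\
    phi t x 0 i = x 0 i +
      \int[lebesgue_measure]_(s in `[0, t]) rk_fun (v s) (phi s x) 0 i.

Definition flow (v : R -> V) : R -> 'rV[R]_n -> 'rV[R]_n :=
  xget ((fun=> id) : R -> 'rV[R]_n -> 'rV[R]_n) (is_flow v).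

Definition energy (lambda : R) (mu0 mutar : varifold R le_dn) (v : R -> V) :
    \bar R :=
  ((2^-1)%:E * \int[lebesgue_measure]_(t in `[0%R, 1%R]) (`|v t| ^+ 2)%:E +
   lambda%:E * rk_dual_norm W (fun omega =>
     (pushforward_pair (flow v 1) mu0 omega - varifold_pair mutar omega)%R)
     ^+ 2)%E.

End functional.

(* Main.v *)
(* Let v_k be a minimizing sequence with flows phi_k. The bound on the kinetic
   energies makes the flows equi-Lipschitz in space and equicontinuous in time,
   so that a subsequence converges pointwise to some psi. The flow equation
   along psi, up to an error tending to 0, is a convex constraint satisfied by
   the tails of (v_k); near-minimizers of the kinetic energy under such
   decreasing constraints form a Cauchy sequence, by the parallelogram identity,
   and their strong limit u is a field with flow psi and kinetic energy at most
   the limit of those of the v_k. No weak compactness is used.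

   The maps phi_k(1) are uniformly bi-Lipschitz and have uniformly bounded
   second differences. These bounds pass to the limit and force the
   Jacobians to converge; by the Cauchy-Binet formula the action on oriented
   planes and the change of volume are continuous functions of the Jacobian and
   of the Pluecker coordinates, so that (phi_k(1)_# mu_0 | omega) converges to
   (psi(1)_# mu_0 | omega) for each omega in W, by dominated convergence. Hence
   the dual norm, and the energy, are lower semicontinuous along the sequence. *)
From HB Require Import structures.
Require Import Defs.
From mathcomp Require Import all_boot all_order all_algebra.
From mathcomp Require Import fingroup perm.
From mathcomp Require Import all_classical all_reals all_analysis.
From mathcomp Require Import measurable_realfun.
From mathcomp Require Import ring lra.
Set Implicit Arguments.
Unset Strict Implicit.
Unset Printing Implicit Defensive.
Import Order.TTheory GRing.Theory Num.Theory.
Import numFieldNormedType.Exports.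
Local Open Scope classical_set_scope.
Local Open Scope ring_scope.

(** * The Cauchy-Binet formula and oriented planes *)

(** The flow equation is nonlinear in the field, but with the curves [psi] frozen, the condition
    that the integral of u_s(psi_s x) over [0, t] equals psi_t x - x is affine in u; this is why
    midpoints remain admissible. Midpoints must also be Borel, which for maps into V is secured by
    separability; it is derived from the countably many evaluations at rational points, by the same
    near-minimizer argument. Spatial derivatives of flows are never computed from the equation:
    bounded second differences, a condition on values only, produce the Jacobian as a limit of
    dyadic difference quotients with a quadratic remainder, and the same remainder lets pointwise
    convergence of the maps carry over to their Jacobians. The frames behind [grass_act] and
    [grass_jac] are arbitrary choices, with no continuity in the plane, so both are first rewritten
    as functions of Pluecker coordinates. Finally, the energy bound controls only the sum of the
    kinetic and data terms, so both are made to converge along the same subsequence as the flows. *)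

Lemma det_mulmx_sum (R : comNzRingType) (n d : nat)
    (U : 'M[R]_(d, n)) (B : 'M[R]_(n, d)) :
  \det (U *m B) =
  \sum_(f : {ffun 'I_d -> 'I_n}) (\prod_i U i (f i)) * \det (rowsub f B).
Proof.
rewrite /determinant.
under eq_bigr => s _.
  under eq_bigr => i _ do rewrite mxE.
  rewrite bigA_distr_bigA big_distrr /=.
  over.
rewrite exchange_big; apply: eq_bigr => f _ /=.
rewrite big_distrr /=; apply: eq_bigr => s _.
rewrite big_split /= mulrCA; congr (_ * (_ * _)).
by apply: eq_bigr => i _; rewrite mxE.
Qed.

Lemma det_rowsub_perm (R : comNzRingType) (n d : nat) (B : 'M[R]_(n, d))
    (f : 'I_d -> 'I_n) (s : 'S_d) :
  \det (rowsub (f \o s) B) = (-1) ^+ s * \det (rowsub f B).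
Proof.
rewrite -det_perm -det_mulmx -row_permE; congr determinant.
by apply/matrixP => i j; rewrite !mxE.
Qed.

Lemma det_colsub_perm (R : comNzRingType) (n d : nat) (U : 'M[R]_(d, n))
    (f : 'I_d -> 'I_n) (s : 'S_d) :
  \det (colsub (f \o s) U) = (-1) ^+ s * \det (colsub f U).
Proof.
rewrite -det_tr -[X in _ = _ * X]det_tr.
have E (g : 'I_d -> 'I_n) : (colsub g U)^T = rowsub g U^T.
  by apply/matrixP => i j; rewrite !mxE.
by rewrite !E det_rowsub_perm.
Qed.

(** Reindexing the expansion of [det_mulmx_sum] by a permutation brings out its sign on the minor of
    B; summing over the d! permutations rebuilds the minor of U. Keeping all maps f avoids singling
    out the increasing ones. *)
Lemma Cauchy_Binet (R : comNzRingType) (n d : nat)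
    (U : 'M[R]_(d, n)) (B : 'M[R]_(n, d)) :
  \det (U *m B) *+ d`! =
  \sum_(f : {ffun 'I_d -> 'I_n}) \det (colsub f U) * \det (rowsub f B).
Proof.
pose h (s : 'S_d) (f : {ffun 'I_d -> 'I_n}) := [ffun i => f (s i)].
have hK (s : 'S_d) : cancel (h s) (h s^-1%g).
  by move=> f; apply/ffunP => i; rewrite !ffunE permKV.
have detE (s : 'S_d) : \det (U *m B) =
    \sum_(f : {ffun 'I_d -> 'I_n}) (-1) ^+ s * (\prod_i U i (f (s i))) *
      \det (rowsub f B).
  rewrite det_mulmx_sum (reindex_inj (can_inj (hK s))); apply: eq_bigr => f _.
  rewrite -mulrA mulrCA -det_rowsub_perm; congr (_ * _).
    by apply: eq_bigr => i _; rewrite ffunE.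
  by congr determinant; apply/matrixP => i j; rewrite !mxE ffunE.
rewrite -card_Sn -sumr_const (eq_bigr _ (fun s _ => detE s)).
rewrite exchange_big /=; apply: eq_bigr => f _; rewrite -big_distrl /=.
congr (_ * _); apply: eq_bigr => s _; congr (_ * _).
by apply: eq_bigr => i _; rewrite mxE.
Qed.

(** A non-injective f repeats a column, so its minor vanishes; an injective one is an increasing
    index up to a permutation, so its minor is a Pluecker coordinate up to sign. Minors thus extend
    from decomposable vectors to linear forms on the whole exterior power. *)
Lemma minor_coord (R : realType) (n d : nat) (f : {ffun 'I_d -> 'I_n}) :
  {l : {linear ext_power R n d -> R} |
    forall U : 'M[R]_(d, n), l (wedge U) = \det (colsub f U)}.
Proof.
apply: cid; have [/injectiveP f_inj|f_ninj] := boolP (injectiveb f); last first.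
  exists \0 => U; have /injectivePn[i [j ij fij]] := f_ninj.
  rewrite -det_tr (determinant_alternate ij)// => k.
  by rewrite !mxE fij.
have [s] : exists s : 'S_d, exists t : ext_index n d, f =1 tnth (val t) \o s.
  (* Sorting the values of f yields the increasing index t, and [tuple_permP] the permutation s. *)
  pose r := relpre (val : 'I_n -> nat) leq.
  have st : size (sort r (codom f)) == d by rewrite size_sort size_codom card_ord.
  pose t := Tuple st.
  have sorted_t : sorted ltn (map val t).
    rewrite ltn_sorted_uniq_leq map_inj_uniq; last exact: val_inj.
    rewrite sort_uniq; apply/andP; split; first exact/injectiveP.
    rewrite sorted_map; apply: sort_sorted.
    by move=> x y; rewrite /r /=; exact: leq_total.
  have sf : size (codom f) == d by rewrite size_codom card_ord.
  have /tuple_permP[s Es] : perm_eq (Tuple sf) t by rewrite perm_sym /= perm_sort.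
  exists s, (Sub t sorted_t) => i.
  have -> : f i = tnth (Tuple sf) i.
    by rewrite (tnth_nth (f i)) /= codomE (nth_map i) ?size_enum_ord// nth_ord_enum.
  rewrite (tnth_nth (tnth t (s i))) {1}Es /=.
  by rewrite (nth_map i) ?size_enum_ord// nth_ord_enum.
case=> t ft; pose k := enum_rank t.
suff: {l : {linear ext_power R n d -> R} | forall w, l w = (-1) ^+ s * w 0 k}.
  case=> l lE; exists l => U; rewrite lE mxE enum_rankK -det_colsub_perm.
  by congr determinant; apply/matrixP => i j; rewrite !mxE ft.
pose l (w : ext_power R n d) := (-1) ^+ s * w 0 k.
have l_lin : linear l.
  by move=> a u w; rewrite /l !mxE mulrDr mulrCA.
pose L := GRing.isLinear.Build _ _ _ _ l l_lin.
pose LL : {linear ext_power R n d -> R} := HB.pack l L.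
by exists LL.
Qed.

Definition minor (R : realType) (n d : nat) (f : {ffun 'I_d -> 'I_n}) :
  {linear ext_power R n d -> R} := sval (minor_coord R f).

Lemma minorE (R : realType) (n d : nat) (f : {ffun 'I_d -> 'I_n})
  (U : 'M[R]_(d, n)) : minor R f (wedge U) = \det (colsub f U).
Proof. exact: (svalP (minor_coord R f)). Qed.

(* Summing over all maps f instead of the increasing ones counts each Pluecker
   coordinate d! times. *)
Definition ext_norm (R : realType) (n d : nat) (w : ext_power R n d) : R :=
  Num.sqrt ((\sum_(f : {ffun 'I_d -> 'I_n}) minor R f w ^+ 2) / d`!%:R).

(** The induced map on the exterior power, i.e. the compound matrix of A, by Cauchy-Binet and with
    the same factor d! as in [ext_norm]. *)
Definition ext_act (R : realType) (n d : nat) (A : 'M[R]_n)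
    (w : ext_power R n d) : ext_power R n d :=
  \row_k ((\sum_(f : {ffun 'I_d -> 'I_n}) minor R f w *
    \det (rowsub f (colsub (tnth (val (enum_val k))) A))) / d`!%:R).

Section wedge_theory.
Context {R : realType} {n d : nat}.
Implicit Types (U : 'M[R]_(d, n)) (A : 'M[R]_n) (w : ext_power R n d).

Let fact_neq0 : (d`!%:R : R) != 0.
Proof. by rewrite pnatr_eq0 -lt0n fact_gt0. Qed.

Lemma wedge_normE U : wedge_norm U = ext_norm (wedge U).
Proof.
congr Num.sqrt; apply: (mulIf fact_neq0); rewrite divfK// mulr_natr.
rewrite Cauchy_Binet; apply: eq_bigr => f _.
rewrite minorE expr2; congr (_ * _); rewrite -det_tr; congr determinant.
by apply/matrixP => i j; rewrite !mxE.
Qed.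

Lemma wedge_mulmxr U A : wedge (U *m A) = ext_act A (wedge U).
Proof.
apply/rowP => k; rewrite !mxE.
set t := tnth _.
have -> : colsub t (U *m A) = U *m colsub t A.
  apply/matrixP => i j; rewrite !mxE; apply: eq_bigr => l _.
  by rewrite !mxE.
apply: (mulIf fact_neq0); rewrite divfK// mulr_natr Cauchy_Binet.
by apply: eq_bigr => f _; rewrite minorE.
Qed.

Lemma ext_actZ A (a : R) w : ext_act A (a *: w) = a *: ext_act A w.
Proof.
apply/rowP => k; rewrite !mxE mulrA; congr (_ / _).
by rewrite big_distrr; apply: eq_bigr => f _; rewrite linearZ /= mulrA.
Qed.

Lemma ext_normZ (a : R) w : ext_norm (a *: w) = `|a| * ext_norm w.
Proof.
rewrite /ext_norm -sqrtr_sqr -sqrtrM ?sqr_ge0//; congr Num.sqrt.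
rewrite mulrA; congr (_ / _).
by rewrite big_distrr; apply: eq_bigr => f _; rewrite linearZ /= exprMn.
Qed.

Lemma wedge_mulmxl (G : 'M[R]_d) U : wedge (G *m U) = \det G *: wedge U.
Proof.
apply/rowP => k; rewrite !mxE -det_mulmx; congr determinant.
by apply/matrixP => i j; rewrite !mxE; apply: eq_bigr => l _; rewrite !mxE.
Qed.

Lemma unit_wedge_mulmxl (G : 'M[R]_d) U : 0 < \det G ->
  unit_wedge (G *m U) = unit_wedge U.
Proof.
move=> G0; rewrite /unit_wedge !wedge_normE wedge_mulmxl ext_normZ gtr0_norm//.
by rewrite scalerA invfM mulrAC mulVf ?mul1r// gt_eqF.
Qed.

End wedge_theory.

(** Gram-Schmidt, with the first row orthogonalized against the remaining ones. G is block
    triangular with diagonal blocks of positive determinant, so the orientation is preserved. *)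
Lemma orthonormalize (R : realType) (n d : nat) (U : 'M[R]_(d, n)) :
  row_free U ->
  exists2 G : 'M[R]_d, 0 < \det G & (G *m U) *m (G *m U)^T = 1%:M.
Proof.
elim: d U => [|d IH] U Ufree.
  by exists 1%:M; rewrite ?det1// !flatmx0.
have [B UB] := row_freeP Ufree.
rewrite -[U](@vsubmxK _ 1 d) in UB *.
move: (@usubmx _ 1 d _ U) (@dsubmx _ 1 d _ U) UB => {Ufree}u {}U UB.
have [|G G0 GU] := IH U.
  apply/row_freeP; exists (B *m @col_mx _ 1 d d 0 1%:M); rewrite mulmxA.
  have -> : U *m B = @row_mx _ d 1 d 0 1%:M.
    move: UB; rewrite (@mul_col_mx _ 1 d) (scalar_mx_block 1 d) block_mxEv.
    by move=> /(congr1 (@dsubmx _ 1 d _)); rewrite !col_mxKd.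
  by rewrite (@mul_row_col _ d 1 d d) mul0mx add0r mulmx1.
move EO : (G *m U) GU => O GU.
(* v is the component of the first row orthogonal to the orthonormal rows O. *)
have [v vdef] : exists v, v = u - u *m O^T *m O by exists (u - u *m O^T *m O).
have vO : v *m O^T = 0 by rewrite vdef mulmxBl -!mulmxA GU mulmx1 subrr.
have Ov : O *m v^T = 0 by apply: trmx_inj; rewrite trmx_mul trmxK vO trmx0.
have vE : v = @row_mx _ 1 1 d 1%:M (- (u *m O^T *m G)) *m col_mx u U.
  by rewrite vdef (@mul_row_col _ 1 1 d n) mul1mx mulNmx -(mulmxA (u *m O^T)) EO.
(* Otherwise a combination of the rows with first coefficient 1 would vanish, against the right
   inverse B. *)
have v0 : v != 0.
  apply/eqP => v0.
  have : @row_mx _ 1 1 d 1%:M (- (u *m O^T *m G)) *m (col_mx u U *m B) = 0.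
    by rewrite mulmxA -vE v0 mul0mx.
  rewrite UB mulmx1 => /eqP.
  rewrite (@row_mx_eq0 _ 1 1 d) => /andP[+ _]; apply/negP/eqP => /matrixP/(_ 0 0)/eqP.
  by rewrite !mxE oner_eq0.
pose r := (v *m v^T) 0 0.
have r_gt0 : 0 < r.
  have rE : r = \sum_j v 0 j ^+ 2.
    by rewrite /r mxE; apply: eq_bigr => j _; rewrite mxE expr2.
  have r_ge0 : 0 <= r by rewrite rE sumr_ge0// => j _; exact: sqr_ge0.
  rewrite lt_neqAle r_ge0 andbT; apply: contra v0; rewrite eq_sym rE
    psumr_eq0 => [|j _]; last exact: sqr_ge0.
  move=> /allP vj; apply/eqP/rowP => j; rewrite mxE; apply/eqP.
  by rewrite -sqrf_eq0; apply: vj; rewrite mem_index_enum.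
pose c := (Num.sqrt r)^-1.
have c0 : 0 < c by rewrite invr_gt0 sqrtr_gt0.
exists (@block_mx _ 1 d 1 d c%:M (- c *: (u *m O^T *m G)) 0 G).
  by rewrite (@det_ublock _ 1 d) det_scalar expr1 mulr_gt0.
have -> : block_mx c%:M (- c *: (u *m O^T *m G)) 0 G *m col_mx u U =
    col_mx (c *: v) O.
  rewrite (@mul_block_col _ 1 d 1 d n) mul0mx add0r mul_scalar_mx scaleNr mulNmx -scalemxAl.
  by rewrite vdef -scalerBr -(mulmxA (u *m O^T)) EO.
rewrite (@tr_col_mx _ 1 d) (@mul_col_row _ 1 d n 1 d) GU !linearZ /= -!scalemxAl vO Ov !scaler0.
rewrite (scalar_mx_block 1 d); congr (@block_mx _ 1 d 1 d).
rewrite -?scalemxAr scalerA; apply/matrixP => i j; rewrite !ord1 mxE -/r mxE/=.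
by rewrite -expr2 exprVn sqr_sqrtr ?ltW// mulVf ?gt_eqF.
Qed.

Section oriented_planes.
Context {R : realType} {n d : nat} {le_dn : (d <= n)%N}.
Implicit Types (U : 'M[R]_(d, n)) (A : 'M[R]_n) (T : grass R le_dn).

Lemma wedge_norm_gt0 U : row_free U -> 0 < wedge_norm U.
Proof.
case/orthonormalize => G G0 GU.
have := congr1 (fun M : 'M[R]_d => Num.sqrt (\det M)) GU.
rewrite -/(wedge_norm _) wedge_normE wedge_mulmxl ext_normZ -wedge_normE.
rewrite det1 sqrtr1 => E; rewrite lt_neqAle sqrtr_ge0 andbT.
by apply/eqP => W0; move: E; rewrite -W0 mulr0 => /esym/eqP; rewrite oner_eq0.
Qed.

Lemma oriented_basisP T :
  row_free (oriented_basis T) /\ unit_wedge (oriented_basis T) = val T.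
Proof.
have [U Ufree UT] : grassmannian R n d (val T) by exact/set_mem/(valP T).
by apply: (@xgetPex _ 0 [set U | row_free U /\ unit_wedge U = val T]); exists U.
Qed.

Lemma oriented_onbP T :
  oriented_onb T *m (oriented_onb T)^T = 1%:M /\
  unit_wedge (oriented_onb T) = val T.
Proof.
apply: (@xgetPex _ 0 [set U | U *m U^T = 1%:M /\ unit_wedge U = val T]).
have [Ufree UT] := oriented_basisP T.
have [G G0 GU] := orthonormalize Ufree.
by exists (G *m oriented_basis T); split=> //; rewrite unit_wedge_mulmxl.
Qed.

(** The right-hand side no longer involves the chosen frame [oriented_onb], which need not depend
    continuously on T. *)
Lemma grass_jacE A T : grass_jac A T = ext_norm (ext_act A (val T)).
Proof.
have [onb OT] := oriented_onbP T.
rewrite /grass_jac wedge_normE wedge_mulmxr -OT /unit_wedge.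
by rewrite /wedge_norm onb det1 sqrtr1 invr1 scale1r.
Qed.

Lemma grass_jac_gt0 A T : A \in unitmx -> 0 < grass_jac A T.
Proof.
move=> Au; have [Ufree UT] := oriented_basisP T.
rewrite grass_jacE -UT /unit_wedge ext_actZ -wedge_mulmxr ext_normZ -wedge_normE.
rewrite mulr_gt0 ?normr_gt0 ?invr_neq0// ?gt_eqF ?wedge_norm_gt0//.
by rewrite /row_free mxrankMfree// row_free_unit.
Qed.

Lemma grass_actE A T : A \in unitmx ->
  val (grass_act A T) = (grass_jac A T)^-1 *: ext_act A (val T).
Proof.
move=> Au; have [Ufree UT] := oriented_basisP T.
have UAfree : row_free (oriented_basis T *m A).
  by rewrite /row_free mxrankMfree// row_free_unit.
(* Invertibility of A keeps the frame free, so [insubd] does not return its default value. *)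
rewrite /grass_act insubdK; last by apply/mem_set; exists (oriented_basis T *m A).
rewrite /unit_wedge wedge_normE wedge_mulmxr grass_jacE -UT /unit_wedge.
rewrite ext_actZ ext_normZ scalerA ger0_norm ?invr_ge0 ?sqrtr_ge0//.
by rewrite invfM mulrAC invrK mulfV ?mul1r// gt_eqF ?wedge_norm_gt0.
Qed.

End oriented_planes.

(** * Continuity in the Jacobian and in the Pluecker coordinates *)

Lemma cvg_mxP (T : Type) (F : set_system T) {FF : Filter F}
    (U : topologicalType) (m n : nat) (f : T -> 'M[U]_(m, n)) (M : 'M[U]_(m, n)) :
  (forall i j, f x i j @[x --> F] --> M i j) -> f x @[x --> F] --> M.
Proof.
move=> fM A [P PM PA]; near_simpl.
have : \forall x \near F, forall i, forall j, P i j (f x i j).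
  by apply: filter_forall => i; apply: filter_forall => j; exact: fM (PM i j).
by apply: filterS => x Px; exact: PA.
Qed.

Section finite_cvg.
Context {R : realType} {T : Type} {F : set_system T} {FF : Filter F}.

Lemma cvg_sum_fin (I : Type) (r : seq I) (P : pred I) (f : I -> T -> R)
    (a : I -> R) : (forall i, P i -> f i x @[x --> F] --> a i) ->
  \sum_(i <- r | P i) f i x @[x --> F] --> \sum_(i <- r | P i) a i.
Proof. by apply: cvg_big; exact: add_continuous. Qed.

Lemma cvg_prod_fin (I : Type) (r : seq I) (P : pred I) (f : I -> T -> R)
    (a : I -> R) : (forall i, P i -> f i x @[x --> F] --> a i) ->
  \prod_(i <- r | P i) f i x @[x --> F] --> \prod_(i <- r | P i) a i.
Proof. by apply: cvg_big; exact: mul_continuous. Qed.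

Lemma cvg_coord m n (f : T -> 'M[R]_(m, n)) (M : 'M[R]_(m, n)) i j :
  f x @[x --> F] --> M -> f x i j @[x --> F] --> M i j.
Proof.
move=> fM.
exact: (cvg_comp _ (fun N : 'M[R]_(m, n) => N i j) fM (@coord_continuous _ _ _ i j M)).
Qed.

Lemma cvg_det n (f : T -> 'M[R]_n) (M : 'M[R]_n) :
  f x @[x --> F] --> M -> \det (f x) @[x --> F] --> \det M.
Proof.
move=> fM; apply: cvg_sum_fin => s _; apply: cvgM; first exact: cvg_cst.
by apply: cvg_prod_fin => i _; exact: cvg_coord.
Qed.

Variables (n d : nat).

Lemma cvg_minor (f : {ffun 'I_d -> 'I_n}) (w : T -> ext_power R n d)
    (a : ext_power R n d) :
  w x @[x --> F] --> a -> minor R f (w x) @[x --> F] --> minor R f a.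
Proof.
move=> wa.
have E (u : ext_power R n d) :
    minor R f u = \sum_k u 0 k * minor R f (delta_mx 0 k).
  rewrite {1}[u]row_sum_delta linear_sum; apply: eq_bigr => k _.
  by rewrite linearZ.
rewrite E; under eq_cvg do rewrite E.
by apply: cvg_sum_fin => k _; apply: cvgM; [exact: cvg_coord|exact: cvg_cst].
Qed.

Lemma cvg_ext_norm (w : T -> ext_power R n d) (a : ext_power R n d) :
  w x @[x --> F] --> a -> ext_norm (w x) @[x --> F] --> ext_norm a.
Proof.
move=> wa; apply: (cvg_comp _ Num.sqrt _ (@sqrt_continuous _ _)).
apply: cvgM; last exact: cvg_cst.
apply: cvg_sum_fin => f _; under eq_cvg do rewrite expr2.
by rewrite expr2; apply: cvgM; exact: cvg_minor.
Qed.

Lemma cvg_ext_act (A : T -> 'M[R]_n) (B : 'M[R]_n)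
    (w : T -> ext_power R n d) (a : ext_power R n d) :
  A x @[x --> F] --> B -> w x @[x --> F] --> a ->
  ext_act (A x) (w x) @[x --> F] --> ext_act B a.
Proof.
move=> AB wa; apply: cvg_mxP => i k; rewrite mxE; under eq_cvg do rewrite mxE.
apply: cvgM; last exact: cvg_cst.
apply: cvg_sum_fin => f _; apply: cvgM; first exact: cvg_minor.
apply: cvg_det; apply: cvg_mxP => p q; rewrite !mxE.
by under eq_cvg do rewrite !mxE; exact: cvg_coord.
Qed.

Context {le_dn : (d <= n)%N}.

Lemma cvg_grassP (G : T -> grass R le_dn) (g : grass R le_dn) :
  val (G x) @[x --> F] --> val g <-> G x @[x --> F] --> g.
Proof. by split=> Gg; apply/cvg_ballP => e e0; have /cvg_ballP/(_ e e0) := Gg. Qed.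

Lemma cvg_grass_jac (A : T -> 'M[R]_n) (B : 'M[R]_n)
    (G : T -> grass R le_dn) (g : grass R le_dn) :
  A x @[x --> F] --> B -> G x @[x --> F] --> g ->
  grass_jac (A x) (G x) @[x --> F] --> grass_jac B g.
Proof.
move=> AB /cvg_grassP Gg; rewrite grass_jacE; under eq_cvg do rewrite grass_jacE.
by apply: cvg_ext_norm; exact: cvg_ext_act.
Qed.

Lemma cvg_grass_act (A : T -> 'M[R]_n) (B : 'M[R]_n)
    (G : T -> grass R le_dn) (g : grass R le_dn) :
  (forall x, A x \in unitmx) -> B \in unitmx ->
  A x @[x --> F] --> B -> G x @[x --> F] --> g ->
  grass_act (A x) (G x) @[x --> F] --> grass_act B g.
Proof.
move=> Au Bu AB Gg; apply/cvg_grassP; rewrite grass_actE//.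
under eq_cvg do rewrite grass_actE//.
apply: cvgZ; last by apply: cvg_ext_act => //; exact/cvg_grassP.
apply: cvgV; first by rewrite gt_eqF// grass_jac_gt0.
exact: cvg_grass_jac.
Qed.

End finite_cvg.

(** * Norms, geometric convergence and additive maps *)

Lemma mx_coord_le (R : realType) m n (v : 'M[R]_(m, n)) i j : `|v i j| <= `|v|.
Proof.
by rewrite [leRHS]/Num.norm/= mx_normrE; exact: (@le_bigmax _ _ _ _ _ (i, j)).
Qed.

Lemma rV_norm_le (R : realType) n (v : 'rV[R]_n) (c : R) : 0 <= c ->
  (forall j, `|v 0 j| <= c) -> `|v| <= c.
Proof.
move=> c0 vc; rewrite [leLHS]/Num.norm/= mx_normrE.
by apply: bigmax_le => // -[i j] _ /=; rewrite ord1.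
Qed.

(** Telescoping against a geometric series, whose sum accounts for the factor 2. *)
Lemma geometric_cvg (R : realType) (V : completeNormedModType R) (a : nat -> V)
    (c : R) : (forall k, `|a k.+1 - a k| <= c / 2 ^+ k) ->
  exists2 l, a k @[k --> \oo] --> l & forall k, `|l - a k| <= 2 * c / 2 ^+ k.
Proof.
move=> ac.
have c0 : 0 <= c by have := le_trans (normr_ge0 _) (ac 0); rewrite expr0 divr1.
(* The subtracted term is the remaining tail of the series; with it the induction closes exactly. *)
have inc k p : `|a (k + p)%N - a k| <= 2 * c / 2 ^+ k - 2 * c / 2 ^+ (k + p).
  elim: p => [|p IH]; first by rewrite addn0 !subrr normr0.
  rewrite addnS -[a _.+1](subrK (a (k + p)%N)) -addrA.
  apply: le_trans (ler_normD _ _) (le_trans (lerD (ac _) IH) _).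
  rewrite exprS invfM; set z := (2 ^+ (k + p))^-1.
  by rewrite le_eqVlt; apply/orP; left; apply/eqP; field.
have inc' k p : (k <= p)%N -> `|a p - a k| <= 2 * c / 2 ^+ k.
  move=> kp; rewrite -(subnKC kp); apply: le_trans (inc _ _) _.
  by rewrite gerBl divr_ge0 ?exprn_ge0// mulr_ge0.
have to0 : (fun k => 2 * c / 2 ^+ k) @ \oo --> (0 : R).
  have := @cvg_geometric R (2 * c) 2^-1; rewrite gtr0_norm// invf_lt1// ltr1n.
  move=> /(_ isT); apply: cvg_trans; apply: near_eq_cvg; near=> k.
  by rewrite /geometric /= exprVn.
have /cauchy_cvg acvg : cauchy (a k @[k --> \oo]).
  apply: cauchy_exP => e e0.
  have /cvgrPdist_lt/(_ e e0)[N _ Ne] := to0.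
  exists (a N), N => // p /= Np; rewrite -ball_normE /ball_ /= distrC.
  apply: le_lt_trans (inc' _ _ Np) _; have := Ne N (leqnn N).
  by rewrite /= sub0r normrN ger0_norm// divr_ge0 ?exprn_ge0// mulr_ge0.
exists (lim (a k @[k --> \oo])) => // k.
have h : `|a p - a k| @[p --> \oo] --> `|lim (a k @[k --> \oo]) - a k|.
  by apply: cvg_norm; apply: cvgB => //; exact: cvg_cst.
apply: (cvgr_to_le h); exists k => // p /= kp; exact: inc'.
Unshelve. all: by end_near. Qed.

(** Cauchy's functional equation: the defect g(c) = J(c h) - c J(h) is additive and vanishes at 1,
    hence on the integers; it is then 1-periodic, hence bounded, and k g(c) = g(k c) for all k
    forces g = 0. *)
Lemma additive_bounded_scale (R : realType) (V W : normedModType R)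
    (J : {additive V -> W}) (M : R) : (forall h, `|J h| <= M * `|h|) ->
  forall c h, J (c *: h) = c *: J h.
Proof.
move=> JM c h.
pose g (c : R) := J (c *: h) - c *: J h.
have gD b e : g (b + e) = g b + g e.
  by rewrite /g !scalerDl raddfD opprD addrACA.
have g0 : g 0 = 0 by rewrite /g !scale0r raddf0 subr0.
have gMn k b : g (k%:R * b) = k%:R *: g b.
  elim: k => [|k IH]; first by rewrite mul0r scale0r.
  by rewrite -natr1 mulrDl mul1r gD IH scalerDl scale1r.
have g1 : g 1 = 0 by rewrite /g !scale1r subrr.
have gN b : g (- b) = - g b.
  by apply/eqP; rewrite -addr_eq0 -gD addNr g0.
have gnat (k : nat) : g k%:R = 0.
  by have := gMn k 1; rewrite mulr1 g1 scaler0.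
have gint (k : int) : g k%:~R = 0.
  by case: k => k; [exact: gnat|rewrite NegzE mulrNz gN -pmulrn gnat oppr0].
have gb b : `|g b| <= 2 * M * `|h|.
  have -> : g b = g (b - (Num.floor b)%:~R).
    by rewrite gD gN gint subr0.
  set r := b - _.
  have r01 : `|r| <= 1.
    have /andP[fl fr] := floor_itv b; rewrite /r ger0_norm ?subr_ge0//.
    by rewrite lerBlDl -(intrD _ _ 1) ltW.
  have Mh : 0 <= M * `|h| by apply: le_trans (JM h).
  rewrite /g; apply: le_trans (ler_normB _ _) _.
  apply: le_trans (lerD (JM _) (lexx _)) _; rewrite !normrZ.
  have := ler_wpM2l (normr_ge0 r) (JM h).
  have := ler_wpM2r Mh r01; rewrite mul1r.
  move=> h1 h2; rewrite mulrCA; lra.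
have : `|g c| <= 0.
  apply/ler_addgt0Pr => e e0; rewrite add0r.
  pose k := (Num.truncn (2 * M * `|h| / e)).+1.
  have := gb (k%:R * c); rewrite gMn normrZ normr_nat.
  have : 2 * M * `|h| <= k%:R * e.
    by rewrite -ler_pdivrMr// ltW// /k truncnS_gt.
  move=> h1 h2; have := le_trans h2 h1.
  by rewrite ler_pM2l// ltr0n.
by rewrite normr_le0 subr_eq0 => /eqP.
Qed.

(** * Diffeomorphisms with bounded second differences *)

HB.instance Definition _ (R : realType) m n := Complete.on 'M[R]_(m, n).

(** Divide by s and let s tend to 0. This extracts first-order inequalities from expansions with a
    quadratic remainder. *)
Lemma le_of_quadratic (R : realType) (a b c : R) :
  (forall s, 0 < s -> s * a <= s * b + s ^+ 2 * c) -> a <= b.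
Proof.
move=> H; apply/ler_addgt0Pr => e e0.
pose s := e / (`|c| + 1).
have s0 : 0 < s by rewrite divr_gt0.
have := H _ s0; rewrite expr2 -mulrA -mulrDr ler_pM2l// => /le_trans; apply.
rewrite lerD2l; apply: le_trans (ler_norm _) _; rewrite normrM (gtr0_norm s0).
by rewrite /s mulrAC ler_pdivrMr// ler_pM2l// lerDl.
Qed.

Lemma jacobian_quadratic (R : realType) m n (f : 'rV[R]_m -> 'rV[R]_n)
    (x : 'rV[R]_m) (J : 'M[R]_(m, n)) (L : R) :
  (forall h, `|f (x + h) - f x - h *m J| <= L * `|h| ^+ 2) ->
  jacobian f x = J.
Proof.
move=> fJ.
have Jc : continuous (mulmxr J : 'rV[R]_m -> 'rV[R]_n).
  move=> h; apply: (@cvg_mxP _ (nbhs h)) => i j; rewrite mxE; under eq_cvg do rewrite mxE.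
  apply: (@cvg_sum_fin _ _ (nbhs h)) => k _; apply: cvgM; last exact: cvg_cst.
  exact: coord_continuous.
have E : f \o shift x = cst (f x) + (mulmxr J : {linear _ -> _}) +o_ 0 id.
  apply/eqaddoP => e e0.
  have hb : \forall h \near (0 : 'rV[R]_m), `|h| <= (`|L| + 1)^-1 * e.
    by apply: nbhs0_le; rewrite mulr_gt0// invr_gt0 ltr_wpDl.
  apply: filterS hb => h hb.
  have -> : (f \o shift x - (cst (f x) + mulmxr J)) h =
            f (x + h) - f x - h *m J.
    by rewrite /= !fctE/= opprD addrA [h + x]addrC.
  apply: le_trans (fJ h) _; rewrite expr2 mulrA ler_wpM2r//.
  have [->|h0] := eqVneq `|h| 0; first by rewrite mulr0 ltW.
  apply: (@le_trans _ _ (`|L| * `|h|)); first by rewrite ler_wpM2r// ler_norm.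
  apply: (@le_trans _ _ ((`|L| + 1) * `|h|)); first by rewrite ler_wpM2r// lerDl.
  rewrite -ler_pdivlMl ?ltr_wpDl//.
rewrite /jacobian (diff_unique Jc E).
by apply/row_matrixP => i; rewrite !rowE mul_rV_lin1.
Qed.

(* The last inequality bounds the second differences; it replaces a Lipschitz
   bound on the derivative and is stable under pointwise limits. *)
Definition C11_diffeo (R : realType) n (m M L : R) (f : 'rV[R]_n -> 'rV[R]_n) :=
  [/\ forall x y, m * `|x - y| <= `|f x - f y|,
      forall x y, `|f x - f y| <= M * `|x - y| &
      forall x h k, `|f (x + h + k) - f (x + h) - f (x + k) + f x| <=
        L * (`|h| * `|k|)].

Section C11_theory.
Context {R : realType} {n : nat} {m M L : R}.
Implicit Types (f : 'rV[R]_n -> 'rV[R]_n) (x y h : 'rV[R]_n).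

(** When the step is halved, the quotients 2^k (f(x + 2^-k h) - f x) change by a multiple of a
    second difference with equal increments, so they converge geometrically. Their limit J is
    additive because f(x + h) - f x is so up to L |h| |k|, and homogeneous by the Lipschitz
    bound. *)
Lemma C11_expansion f x : C11_diffeo m M L f ->
  forall h, `|f (x + h) - f x - h *m jacobian f x| <= L * `|h| ^+ 2.
Proof.
case=> _ fM fL.
suff [J JE] : exists J : 'M[R]_n,
    forall h, `|f (x + h) - f x - h *m J| <= L * `|h| ^+ 2.
  by rewrite (jacobian_quadratic JE).
have two_gt0 k : 0 < 2 ^+ k :> R by rewrite exprn_gt0.
pose F h := f (x + h) - f x.
pose a h k := 2 ^+ k *: F ((2 ^+ k)^-1 *: h).
have F_quad h k : `|F (h + k) - F h - F k| <= L * (`|h| * `|k|).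
  apply: le_trans (fL x h k); rewrite le_eqVlt; apply/orP; left; apply/eqP.
  congr `|_|; rewrite /F addrA (opprB (f (x + h))) addrA subrK opprB.
  by rewrite [f x - _]addrC addrA.
(* One halving costs 2^k L (|h| / 2^(k+1))^2 = (L |h|^2 / 4) / 2^k. *)
have cvg_a h : exists2 l, a h k @[k --> \oo] --> l &
    forall k, `|l - a h k| <= 2 * (L * `|h| ^+ 2 / 4) / 2 ^+ k.
  apply: geometric_cvg => k.
  pose w := (2 ^+ k.+1)^-1 *: h.
  have wh : (2 ^+ k)^-1 *: h = w + w.
    rewrite /w -scalerDl; congr (_ *: _); rewrite exprS.
    by field.
  have -> : a h k.+1 - a h k = - (2 ^+ k *: (F (w + w) - F w - F w)).
    rewrite /a wh -/w exprSr -scalerA -scalerBr -scalerN; congr (_ *: _).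
    by rewrite scaler_nat mulr2n !opprB -addrA.
  rewrite normrN normrZ (gtr0_norm (two_gt0 k)).
  apply: (@le_trans _ _ (2 ^+ k * (L * (`|w| * `|w|)))).
    by rewrite ler_pM2l.
  rewrite /w normrZ gtr0_norm ?invr_gt0// exprS le_eqVlt; apply/orP; left.
  by apply/eqP; field.
pose J h := lim (a h k @[k --> \oo]).
have aJ h : a h k @[k --> \oo] --> J h.
  by have [l al _] := cvg_a h; rewrite /J (cvg_lim _ al).
have JF h : `|F h - J h| <= L * `|h| ^+ 2.
  have [l al lb] := cvg_a h; rewrite /J (cvg_lim _ al)//.
  have := lb 0%N; rewrite /a expr0 invr1 !scale1r distrC mulr1 => /le_trans; apply.
  have Lh : 0 <= L * `|h| ^+ 2 by rewrite expr2; apply: le_trans (F_quad h h).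
  lra.
(* At scale 2^-i the defect of additivity is at most 2^i L |h| |k| / 4^i, which tends to 0. *)
have JD h k : J (h + k) = J h + J k.
  apply/eqP; rewrite -subr_eq0 -normr_le0.
  have cl : `|a (h + k) i - (a h i + a k i)| @[i --> \oo] -->
      `|J (h + k) - (J h + J k)|.
    by apply: cvg_norm; apply: cvgB => //; apply: cvgD.
  have c0 : L * (`|h| * `|k|) / 2 ^+ i @[i --> \oo] --> (0 : R).
    have := @cvg_geometric R (L * (`|h| * `|k|)) 2^-1.
    rewrite gtr0_norm// invf_lt1// ltr1n => /(_ isT); apply: cvg_trans.
    by apply: near_eq_cvg; near=> i; rewrite /geometric /= exprVn.
  apply: (ler_cvg_to cl c0); apply: nearW => i.
  rewrite /a -scalerDr -scalerBr [2 ^- i *: (h + k)]scalerDr normrZ (gtr0_norm (two_gt0 i)).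
  rewrite opprD addrA; apply: le_trans (ler_wpM2l (ltW (two_gt0 i)) (F_quad _ _)) _.
  rewrite !normrZ gtr0_norm ?invr_gt0// le_eqVlt; apply/orP; left.
  by apply/eqP; field.
have JM h : `|J h| <= M * `|h|.
  have cl : `|a h i| @[i --> \oo] --> `|J h| by apply: cvg_norm.
  apply: (cvgr_to_le cl); apply: nearW => i.
  rewrite /a normrZ (gtr0_norm (two_gt0 i)).
  apply: le_trans (ler_wpM2l (ltW (two_gt0 i)) (fM _ _)) _.
  by rewrite addrC addKr normrZ gtr0_norm ?invr_gt0// mulrCA mulVKf.
pose JA : {additive 'rV[R]_n -> 'rV[R]_n} :=
  HB.pack J (GRing.isNmodMorphism.Build _ _ J
   (conj (addIr (J 0) (etrans (esym (JD 0 0)) (etrans (congr1 J (addr0 0)) (esym (add0r _))))) JD)).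
have JZ c h : J (c *: h) = c *: J h by exact: (@additive_bounded_scale _ _ _ JA M JM).
have Jlin : linear J by move=> c u v; rewrite JD JZ.
pose JL : {linear 'rV[R]_n -> 'rV[R]_n} :=
  HB.pack J (GRing.isLinear.Build _ _ _ _ J Jlin).
exists (lin1_mx JL) => h.
by rewrite mul_rV_lin1 /=; exact: JF.
Unshelve. all: by end_near. Qed.

End C11_theory.

Lemma delta_norm_le1 (R : realType) n (i : 'I_n) :
  `|delta_mx 0 i : 'rV[R]_n| <= 1.
Proof.
by apply: rV_norm_le => // j; rewrite mxE /=; case: eqP; rewrite ?normr1 ?normr0.
Qed.

Lemma mx_entry_row_le (R : realType) n (A : 'M[R]_n) i j :
  `|A i j| <= `|(delta_mx 0 i : 'rV[R]_n) *m A|.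
Proof. by rewrite -rowE; have := mx_coord_le (row i A) 0 j; rewrite mxE. Qed.

Lemma mx_entry_rowB_le (R : realType) n (A B : 'M[R]_n) i j :
  `|A i j - B i j| <= `|(delta_mx 0 i : 'rV[R]_n) *m A - delta_mx 0 i *m B|.
Proof. by have := mx_entry_row_le (A - B) i j; rewrite !mxE mulmxBr. Qed.

Section C11_jacobian.
Context {R : realType} {n : nat} {m M L : R}.
Implicit Types (f g : 'rV[R]_n -> 'rV[R]_n) (x y h : 'rV[R]_n).

(** On s h, the difference of the two linear parts is a second difference of f, with increments y -
    x and s h, up to two remainders of order s^2, which [le_of_quadratic] discards. *)
Lemma expansions_lip f x y (J J' : 'M[R]_n) : C11_diffeo m M L f ->
  (forall h, `|f (x + h) - f x - h *m J| <= L * `|h| ^+ 2) ->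
  (forall h, `|f (y + h) - f y - h *m J'| <= L * `|h| ^+ 2) ->
  forall h, `|h *m J - h *m J'| <= L * (`|h| * `|x - y|).
Proof.
case=> _ _ fL ex ey h.
apply: (@le_of_quadratic _ _ _ (L * `|h| ^+ 2 + L * `|h| ^+ 2)) => s s0.
rewrite -[s in leLHS]gtr0_norm// -normrZ.
set X := h *m J; set Y := h *m J'.
have := ex (s *: h); rewrite -scalemxAl -/X distrC => {}ex.
have := ey (s *: h); rewrite -scalemxAl -/Y => {}ey.
have := fL x (y - x) (s *: h); rewrite subrKC => fq.
have -> : s *: (X - Y) = (s *: X - (f (x + s *: h) - f x)) +
    ((f (y + s *: h) - f y) - s *: Y) -
    (f (y + s *: h) - f y - f (x + s *: h) + f x).
  rewrite scalerBr.
  have E (a b c d p q : 'rV[R]_n) :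
      a - b = (a - (c - d)) + ((p - q) - b) - (p - q - c + d).
    by apply/rowP => i; rewrite !mxE; ring.
  exact: E.
apply: le_trans (ler_normB _ _) _.
apply: le_trans (lerD (ler_normD _ _) (lexx _)) _.
apply: le_trans (lerD (lerD ex ey) fq) _.
rewrite normrZ gtr0_norm// (distrC x y) le_eqVlt; apply/orP; left; apply/eqP.
by ring.
Qed.

Lemma C11_jacobian_lip f x y h : C11_diffeo m M L f ->
  `|h *m jacobian f x - h *m jacobian f y| <= L * (`|h| * `|x - y|).
Proof.
move=> fC.
exact: (expansions_lip fC (C11_expansion x fC) (C11_expansion y fC)).
Qed.

Lemma C11_jacobian_ge f x h : C11_diffeo m M L f ->
  m * `|h| <= `|h *m jacobian f x|.
Proof.
move=> fC; have ex := C11_expansion x fC; have [fm _ _] := fC.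
apply: (@le_of_quadratic _ _ _ (L * `|h| ^+ 2)) => s s0.
have := ex (s *: h); have := fm (x + s *: h) x.
have -> : x + s *: h - x = s *: h by rewrite addrC addKr.
rewrite -scalemxAl !normrZ gtr0_norm//.
have := ler_normD (s *: (h *m jacobian f x))
  (f (x + s *: h) - f x - s *: (h *m jacobian f x)).
rewrite subrKC normrZ gtr0_norm// => h1 h2 h3.
rewrite mulrCA; apply: le_trans h2 (le_trans h1 _).
by rewrite lerD2l; apply: le_trans h3 _; rewrite exprMn mulrCA.
Qed.

Lemma C11_jacobian_le f x h : C11_diffeo m M L f ->
  `|h *m jacobian f x| <= M * `|h|.
Proof.
move=> fC; have ex := C11_expansion x fC; have [_ fM _] := fC.
apply: (@le_of_quadratic _ _ _ (L * `|h| ^+ 2)) => s s0.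
have := ex (s *: h); have := fM (x + s *: h) x.
have -> : x + s *: h - x = s *: h by rewrite addrC addKr.
rewrite -scalemxAl !normrZ gtr0_norm//.
have := ler_normB (f (x + s *: h) - f x)
  (f (x + s *: h) - f x - s *: (h *m jacobian f x)).
rewrite opprB subrKC normrZ gtr0_norm// => h1 h2 h3.
apply: le_trans h1 (le_trans (lerD h2 h3) _).
by rewrite exprMn mulrCA lerD2l mulrCA.
Qed.

(** The lower Lipschitz bound passes to the differential and leaves it no kernel; [grass_actE] then
    applies. *)
Lemma C11_jacobian_unit f x : 0 < m -> C11_diffeo m M L f ->
  jacobian f x \in unitmx.
Proof.
move=> m0 fC; rewrite -row_free_unit -kermx_eq0; apply/eqP/row_matrixP => i.
rewrite row0; set h := row i _.
have hJ : h *m jacobian f x = 0 by rewrite /h -row_mul mulmx_ker row0.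
have := C11_jacobian_ge x h fC; rewrite hJ normr0 pmulr_rle0//.
by rewrite normr_le0 => /eqP.
Qed.

Lemma C11_jacobian_entry f x i j : C11_diffeo m M L f ->
  `|jacobian f x i j| <= M.
Proof.
move=> fC; apply: le_trans (mx_entry_row_le _ _ _) _.
apply: le_trans (C11_jacobian_le x _ fC) _.
have M0 : 0 <= M.
  have := le_trans (normr_ge0 _) (C11_jacobian_le x (const_mx 1) fC).
  rewrite pmulr_lge0// normr_gt0; apply/eqP => /rowP/(_ i).
  by rewrite !mxE => /eqP; rewrite oner_eq0.
by rewrite -[leRHS]mulr1 ler_wpM2l// delta_norm_le1.
Qed.

Lemma C11_jacobian_continuous f : C11_diffeo m M L f ->
  continuous (jacobian f).
Proof.
move=> fC x; apply: (@cvg_mxP _ (nbhs x)) => i j.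
apply/cvgrPdist_le => e e0.
have hb : \forall y \near x, `|x - y| <= (`|L| + 1)^-1 * e.
  by apply: (@cvgr_dist_le _ _ _ (nbhs x) _ id); rewrite // mulr_gt0// invr_gt0 ltr_wpDl.
apply: filterS hb => y hb.
apply: le_trans (mx_entry_rowB_le _ _ _ _) _; apply: le_trans (C11_jacobian_lip x y _ fC) _.
rewrite mulrA; apply: (@le_trans _ _ ((`|L| + 1) * `|x - y|)).
  rewrite ler_wpM2r//; apply: (@le_trans _ _ (`|L| * `|delta_mx 0 i : 'rV[R]_n|)).
    by rewrite ler_wpM2r// ler_norm.
  by apply: (@le_trans _ _ (`|L| * 1)); rewrite ?ler_wpM2l ?delta_norm_le1// mulr1 lerDl.
by rewrite -ler_pdivlMl// ltr_wpDl.
Qed.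

Variables (F : nat -> 'rV[R]_n -> 'rV[R]_n) (f : 'rV[R]_n -> 'rV[R]_n).
Hypotheses (FC : forall k, C11_diffeo m M L (F k))
  (Ff : forall x, F k x @[k --> \oo] --> f x).

Lemma C11_diffeo_lim : C11_diffeo m M L f.
Proof.
split=> [x y|x y|x h k].
- have cl : `|F k x - F k y| @[k --> \oo] --> `|f x - f y|.
    by apply: cvg_norm; exact: cvgB.
  by apply: (cvgr_to_ge cl); apply: nearW => k; have [] := FC k.
- have cl : `|F k x - F k y| @[k --> \oo] --> `|f x - f y|.
    by apply: cvg_norm; exact: cvgB.
  by apply: (cvgr_to_le cl); apply: nearW => k; have [] := FC k.
- have cl : `|F i (x + h + k) - F i (x + h) - F i (x + k) + F i x|
      @[i --> \oo] --> `|f (x + h + k) - f (x + h) - f (x + k) + f x|.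
    by apply: cvg_norm; apply: cvgD => //; apply: cvgB => //; exact: cvgB.
  by apply: (cvgr_to_le cl); apply: nearW => i; have [] := FC i.
Qed.

(** At a fixed scale s, the vector s h J_k is known from two values of [F k] up to L |s h|^2,
    uniformly in k. So the scale is fixed first, and k then tends to infinity. *)
Lemma expansions_cvg x (J : nat -> 'M[R]_n) (J' : 'M[R]_n) :
  (forall k h, `|F k (x + h) - F k x - h *m J k| <= L * `|h| ^+ 2) ->
  (forall h, `|f (x + h) - f x - h *m J'| <= L * `|h| ^+ 2) ->
  J k @[k --> \oo] --> J'.
Proof.
move=> eF ef.
apply: cvg_mxP => i j; apply/cvgrPdist_le => e e0.
set h : 'rV[R]_n := delta_mx 0 i.
(* This scale brings each of the two remainders below s e / 4; the two differences of values take as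
   much. *)
pose s := e / (4 * (`|L| + 1)).
have s0 : 0 < s by rewrite divr_gt0// mulr_gt0.
have se0 : 0 < s * e / 4 by rewrite divr_gt0// mulr_gt0.
have /cvgrPdist_le/(_ _ se0) c1 := @Ff (x + s *: h).
have /cvgrPdist_le/(_ _ se0) c2 := @Ff x.
near=> k.
have h1 : `|f (x + s *: h) - F k (x + s *: h)| <= s * e / 4 by near: k.
have h2 : `|f x - F k x| <= s * e / 4 by near: k.
apply: le_trans (mx_entry_rowB_le _ _ _ _) _; rewrite -/h.
rewrite -(ler_pM2l s0) -[s in leLHS]gtr0_norm// -normrZ scalerBr !scalemxAl.
have := ef (s *: h).
have := eF k (s *: h).
set X := s *: h *m J k; set Y := s *: h *m J'.
rewrite (distrC _ Y) => ey ex.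
have -> : Y - X = (Y - (f (x + s *: h) - f x)) + (F k (x + s *: h) - F k x - X)
    + (f (x + s *: h) - F k (x + s *: h)) - (f x - F k x).
  have E (a b c d p q : 'rV[R]_n) :
      a - b = (a - (c - d)) + ((p - q) - b) + (c - p) - (d - q).
    by apply/rowP => l; rewrite !mxE; ring.
  exact: E.
apply: le_trans (ler_normB _ _) _.
apply: le_trans (lerD (ler_normD _ _) (lexx _)) _.
apply: le_trans (lerD (lerD (ler_normD _ _) (lexx _)) (lexx _)) _.
have q : L * `|s *: h| ^+ 2 <= s * e / 4.
  rewrite normrZ (gtr0_norm s0) exprMn.
  have hh : `|h| ^+ 2 <= 1 by rewrite expr_le1// delta_norm_le1.
  apply: (@le_trans _ _ ((`|L| + 1) * (s ^+ 2 * `|h| ^+ 2))).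
    apply: ler_wpM2r; first by rewrite mulr_ge0 ?sqr_ge0.
    by apply: le_trans (ler_norm _) _; rewrite lerDl.
  apply: (@le_trans _ _ ((`|L| + 1) * (s ^+ 2 * 1))).
    by rewrite ler_pM2l// ler_wpM2l ?sqr_ge0.
  rewrite mulr1 expr2 mulrCA -mulrA ler_pM2l// /s le_eqVlt; apply/orP; left.
  by apply/eqP; field; rewrite gt_eqF.
have := le_trans ey q; have := le_trans ex q; lra.
Unshelve. all: by end_near. Qed.

Lemma C11_jacobian_lim x : jacobian (F k) x @[k --> \oo] --> jacobian f x.
Proof.
apply: (expansions_cvg (fun k => C11_expansion x (FC k))).
exact: (C11_expansion x C11_diffeo_lim).
Qed.

End C11_jacobian.

(** * The spaces of vector fields *)

Lemma det_norm_le (R : realType) n (A : 'M[R]_n) (c : R) :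
  (forall i j, `|A i j| <= c) -> `|\det A| <= n`!%:R * c ^+ n.
Proof.
move=> Ac; apply: le_trans (ler_norm_sum _ _ _) _.
have -> : n`!%:R * c ^+ n = \sum_(s : 'S_n) c ^+ n.
  by rewrite sumr_const card_Sn mulr_natl.
apply: ler_sum => s _; rewrite normrM normrX normrN1 expr1n mul1r normr_prod.
rewrite -[n in X in _ <= X]card_ord -prodr_const.
by apply: ler_prod => i _; rewrite normr_ge0 Ac.
Qed.

Lemma mulmx_entry_le (R : realType) m n p (A : 'M[R]_(m, n)) (B : 'M[R]_(n, p))
    (a b : R) : (forall i j, `|A i j| <= a) -> (forall i j, `|B i j| <= b) ->
  forall i j, `|(A *m B) i j| <= n%:R * (a * b).
Proof.
move=> Aa Bb i j; rewrite mxE; apply: le_trans (ler_norm_sum _ _ _) _.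
rewrite mulr_natl -[n in _ *+ n]card_ord -sumr_const; apply: ler_sum => k _.
by rewrite normrM ler_pM.
Qed.

(** Orthonormal rows have entries at most 1 in absolute value; this bounds the entries of the
    transported frame, then of its Gram matrix, then the determinant by the Leibniz formula. The
    constant is crude but independent of T. *)
Lemma grass_jac_le (R : realType) n d (le_dn : (d <= n)%N) (A : 'M[R]_n)
    (M : R) (T : grass R le_dn) : (forall i j, `|A i j| <= M) ->
  grass_jac A T <=
    Num.sqrt (d`!%:R * (n%:R * ((n%:R * (1 * M)) * (n%:R * (1 * M)))) ^+ d).
Proof.
move=> AM; have [onb _] := oriented_onbP T.
have ob i j : `|oriented_onb T i j| <= 1.
  rewrite -(@expr_le1 _ 2)// -normrX ger0_norm ?sqr_ge0//.
  have := congr1 (fun B : 'M[R]_d => B i i) onb; rewrite !mxE eqxx /= => E.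
  rewrite -[leRHS]E.
  rewrite (bigD1 j)//= mxE -expr2 lerDl; apply: sumr_ge0 => k _.
  by rewrite mxE -expr2 sqr_ge0.
apply: ler_wsqrtr; apply: le_trans (ler_norm _) _; apply: det_norm_le.
apply: mulmx_entry_le; first exact: mulmx_entry_le.
by move=> i j; rewrite mxE; exact: mulmx_entry_le.
Qed.

Lemma MVT_le (R : realType) (f df : R -> R) (c s : R) : 0 <= s ->
  (forall t, is_derive t (1 : R) f (df t)) -> (forall t, `|df t| <= c) ->
  `|f s - f 0| <= c * s.
Proof.
move=> s0 fdf dfc.
have fc : {within `[0, s], continuous f}.
  by apply: derivable_within_continuous => t _; have := fdf t => -[].
have [t _ ->] := MVT_segment s0 (fun t _ => fdf t) fc.
by rewrite subr0 normrM (ger0_norm s0) ler_wpM2r.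
Qed.

Section line_derivative.
Context {R : realType} {n : nat}.
Implicit Types (h : 'rV[R]_n -> 'rV[R]_n) (x e w : 'rV[R]_n).

Lemma is_derive_line h x e (t : R) j : derivable h (x + t *: e) e ->
  is_derive t (1 : R) (fun t => h (x + t *: e) 0 j) ('D_e h (x + t *: e) 0 j).
Proof.
move=> dh.
have cl : (fun s : R => s^-1 *: ((fun t => h (x + t *: e) 0 j) (s *: (1 : R) + t) -
    h (x + t *: e) 0 j)) @ 0^' --> 'D_e h (x + t *: e) 0 j.
  have := @cvg_coord _ _ _ _ _ _ _ 0 j dh; apply: cvg_trans.
  apply: near_eq_cvg; near=> s; rewrite /= !mxE; congr (_ * (h _ 0 j - _)).
  by rewrite scalerDl [s *: 1 : R]mulr1 addrCA.
by apply: DeriveDef; [exact: cvgP cl|exact: cvg_lim cl].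
Unshelve. all: by end_near. Qed.

Lemma unit_direction w : exists2 e, `|e| <= 1 & w = `|w| *: e.
Proof.
have [->|w0] := eqVneq w 0.
  by exists 0; rewrite ?normr0 ?scaler0.
exists (`|w|^-1 *: w); last by rewrite scalerA mulfV ?scale1r// normr_eq0.
by rewrite normrZ normfV normr_id mulVf// normr_eq0.
Qed.

Lemma lipschitz_of_derive h (c : R) : 0 <= c ->
  (forall x e, derivable h x e) ->
  (forall x e, `|e| <= 1 -> `|'D_e h x| <= c) ->
  forall x w, `|h (x + w) - h x| <= c * `|w|.
Proof.
move=> c0 dh hc x w; have [e e1 we] := unit_direction w.
apply: rV_norm_le => [|j]; first by rewrite mulr_ge0.
have := @MVT_le R (fun t => h (x + t *: e) 0 j)
  (fun t => 'D_e h (x + t *: e) 0 j) c `|w| (normr_ge0 _)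
  (fun t => is_derive_line j (dh _ _)).
rewrite -we scale0r addr0 !mxE; apply => t.
exact: le_trans (mx_coord_le _ _ _) (hc _ _ e1).
Qed.

(** The increment of h by w is itself differentiated along the direction of k, and the mean value
    theorem is applied in each coordinate. *)
Lemma second_difference_le h (c : R) : 0 <= c ->
  (forall x e, derivable h x e) ->
  (forall x w e, `|e| <= 1 -> `|'D_e h (x + w) - 'D_e h x| <= c * `|w|) ->
  forall x w k,
    `|(h (x + k + w) - h (x + k)) - (h (x + w) - h x)| <= c * (`|w| * `|k|).
Proof.
move=> c0 dh hc x w k; have [e e1 ke] := unit_direction k.
apply: rV_norm_le => [|j]; first by rewrite !mulr_ge0.
pose df (t : R) := 'D_e h (x + w + t *: e) 0 j - 'D_e h (x + t *: e) 0 j.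
have := @MVT_le R (fun t => h (x + w + t *: e) 0 j - h (x + t *: e) 0 j) df
  (c * `|w|) `|k| (normr_ge0 _).
rewrite -ke !scale0r !addr0 !mxE -mulrA (addrAC x k w); apply.
  by move=> t; apply: is_deriveB; apply: is_derive_line.
move=> t; have := mx_coord_le ('D_e h (x + t *: e + w) - 'D_e h (x + t *: e)) 0 j.
rewrite !mxE /df (addrAC x w) => /le_trans; apply; exact: hc.
Qed.

End line_derivative.

Section C0p_estimates.
Context {R : realType} {n : nat} {V : rkhs 'rV[R]_n 'rV[R]_n}.

Lemma embedded_iter_derive_le p : embedded_in_C0p p V ->
  exists2 C : R, 0 <= C & forall (u : V) ws x, (size ws <= p)%N ->
    (forall w, w \in ws -> `|w| <= 1) ->
    `|iter_derive ws (rk_fun u) x| <= C * `|u|.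
Proof.
case=> _ [C VC]; exists `|C| => // u ws x wsp ws1.
(* Every order contributes a nonnegative supremum, so a single order is at most the whole norm. *)
have sup_ge0 k : (0 <= ereal_sup (range (deriv_norm k (rk_fun u))))%E.
  apply: (@le_trans _ _ (deriv_norm k (rk_fun u) 0)); last first.
    by apply: ereal_sup_ubound; exists 0.
  apply: (@le_trans _ _ `|iter_derive (nseq k 0) (rk_fun u) 0|%:E).
    by rewrite lee_fin.
  apply: ereal_sup_ubound; exists (nseq k 0) => //; split; first by rewrite size_nseq.
  by move=> w /nseqP[-> _]; rewrite normr0.
rewrite -lee_fin; apply: (@le_trans _ _ (C * `|u|)%:E); last first.
  by rewrite lee_fin ler_wpM2r// ler_norm.
apply: le_trans (VC u); rewrite /C0p_norm.
rewrite (bigD1 (Ordinal (wsp : (size ws < p.+1)%N)))//=.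
apply: (@le_trans _ _ (ereal_sup (range (deriv_norm (size ws) (rk_fun u))))).
  apply: (@le_trans _ _ (deriv_norm (size ws) (rk_fun u) x)).
    by apply: ereal_sup_ubound; exists ws.
  by apply: ereal_sup_ubound; exists x.
by rewrite leeDl// sume_ge0.
Qed.

(** The last bound allows four arbitrary points: their parallelogram defect enters linearly, the
    sides through their product. It is the growth condition that Gronwall's estimate needs for
    second differences of flows. *)
Lemma embedded_C02_estimates : embedded_in_C0p 2 V ->
  exists2 C : R, 0 <= C & forall u : V,
  [/\ forall x, `|rk_fun u x| <= C * `|u|,
      forall x y, `|rk_fun u x - rk_fun u y| <= C * `|u| * `|x - y| &
      forall a b c e, `|rk_fun u a - rk_fun u b - rk_fun u c + rk_fun u e| <=
        C * `|u| * (`|a - b - c + e| + `|a - c| * `|c - e|)].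
Proof.
move=> V2; have [C C0 VC] := embedded_iter_derive_le V2.
exists C => // u; have [/(_ u)[ucp _] _] := V2.
have Cu : 0 <= C * `|u| by rewrite mulr_ge0.
have d1 x e : derivable (rk_fun u) x e by have [_] := ucp [::] isT; exact.
have d2 x w e : derivable ('D_w (rk_fun u)) x e by have [_] := ucp [:: w] isT; exact.
have lip1 x w : `|rk_fun u (x + w) - rk_fun u x| <= C * `|u| * `|w|.
  apply: lipschitz_of_derive => // y e e1.
  by apply: (VC u [:: e] y isT) => z; rewrite inE => /eqP ->.
have lip x y : `|rk_fun u x - rk_fun u y| <= C * `|u| * `|x - y|.
  by rewrite -{1}(subrKC y x).
split=> // [x|a b c e]; first exact: (VC u [::] x isT).
have quad x w k : `|(rk_fun u (x + k + w) - rk_fun u (x + k)) -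
    (rk_fun u (x + w) - rk_fun u x)| <= C * `|u| * (`|w| * `|k|).
  apply: second_difference_le => // y z e1 e11.
  apply: (@lipschitz_of_derive _ _ ('D_e1 (rk_fun u))) => [//|y' e2|y' e2 e21].
    exact: d2.
  apply: (VC u [:: e2; e1] y' isT) => v; rewrite !inE => /orP[]/eqP -> //.
(* The point e + (a - c) completes the parallelogram on a, c, e; the Lipschitz bound then compares b
   with it. *)
have := quad e (a - c) (c - e); rewrite subrKC subrKC => h1.
have h2 := lip (e + (a - c)) b.
have -> : rk_fun u a - rk_fun u b - rk_fun u c + rk_fun u e =
  (rk_fun u a - rk_fun u c - (rk_fun u (e + (a - c)) - rk_fun u e)) +
  (rk_fun u (e + (a - c)) - rk_fun u b).
  have E (p q r s t : 'rV[R]_n) : p - q - r + s = (p - r - (t - s)) + (t - q).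
    by apply/rowP => l; rewrite !mxE; ring.
  exact: E.
apply: le_trans (ler_normD _ _) (le_trans (lerD h1 h2) _).
rewrite -mulrDr addrC; apply: ler_wpM2l => //; rewrite lerD2r.
have -> // : e + (a - c) - b = a - b - c + e.
by apply/rowP => l; rewrite !mxE; ring.
Qed.

End C0p_estimates.

(** * Near-minimizers and separability *)

Lemma near_minimizer (R : realType) (H : Type) (q : H -> R) (A : set H) (e : R) :
  0 < e -> A !=set0 -> (forall v, A v -> 0 <= q v) ->
  exists2 w, A w & forall v, A v -> q w <= q v + e.
Proof.
move=> e0 [a Aa] q0.
have hi : has_inf (q @` A).
  by split; [exists (q a), a|exists 0 => _ [v Av <-]; exact: q0].
have [_ [w Aw <-] qw] := inf_adherent e0 hi.
exists w => // v Av; rewrite ltW//; apply: lt_le_trans qw _.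
by rewrite lerD2r; apply: ge_inf; [exact: hi.2|exists v].
Qed.

(* By the parallelogram identity, as the midpoint of two near-minimizers is
   again admissible. *)
Lemma near_minimizers_cauchy (R : realType) (H : lmodType R) (q : H -> R)
    (S : nat -> set H) (B : R) :
  (forall k l, (k <= l)%N -> S l `<=` S k) ->
  (forall k a b, S k a -> S k b -> S k (2^-1 *: (a + b))) ->
  (forall v, S 0%N v -> 0 <= q v) ->
  (forall a b, S 0%N a -> S 0%N b ->
    q (a - b) = 2 * q a + 2 * q b - 4 * q (2^-1 *: (a + b))) ->
  (forall k, exists2 v, S k v & q v <= B) ->
  exists w : nat -> H, [/\ forall k, S k (w k),
    forall k v, S k v -> q (w k) <= q v + k.+1%:R^-1 &
    forall e, 0 < e -> exists N, forall i j, (N <= i)%N -> (N <= j)%N ->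
      q (w i - w j) <= e].
Proof.
move=> Sdec Smid q0 qpar SB.
have S0 k : S k `<=` S 0%N by exact: Sdec.
have wP k : exists w, S k w /\ forall v, S k v -> q w <= q v + k.+1%:R^-1.
  have [||v Sv|w Sw qw] := @near_minimizer R H q (S k) k.+1%:R^-1.
  - by rewrite invr_gt0.
  - by have [v Sv _] := SB k; exists v.
  - by apply: q0; exact: S0 Sv.
  - by exists w.
have [w wS] := choice wP; exists w; split=> [k|k|]; first exact: (wS k).1.
  exact: (wS k).2.
(* These values increase up to errors 1/(i+1) and are bounded, so from some index on they all lie
   near their supremum. *)
pose c k := q (w k).
have c_incr i j : (i <= j)%N -> c i <= c j + i.+1%:R^-1.
  by move=> ij; apply: (wS i).2; apply: Sdec ij _ _; exact: (wS j).1.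
have c_bd k : c k <= B + 1.
  have [v Sv vB] := SB k; apply: le_trans ((wS k).2 _ Sv) _.
  by rewrite lerD// invf_le1// ler1n.
have inc i j : (i <= j)%N -> q (w i - w j) <= 2 * (c j - c i) + 4 * i.+1%:R^-1.
  move=> ij.
  have Si : S i (w i) by exact: (wS i).1.
  have Sj : S i (w j) by apply: Sdec ij _ _; exact: (wS j).1.
  have := (wS i).2 _ (Smid _ _ _ Si Sj).
  rewrite (qpar _ _ (S0 _ _ Si) (S0 _ _ Sj)) -/(c i) -/(c j) => h.
  by move: (i.+1%:R^-1) h => x h; lra.
move=> e e0.
(* The gap c j - c i is at most 2 d and counts twice, and the error term costs 4 d. *)
pose d := e / 8; have d0 : 0 < d by rewrite divr_gt0.
pose N0 := Num.truncn (d^-1).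
have Nd i : (N0 <= i)%N -> i.+1%:R^-1 <= d.
  move=> Ni; rewrite -[leRHS]invrK lef_pV2 ?posrE ?invr_gt0//.
  apply: le_trans (ltW (truncnS_gt _)) _.
  by rewrite ler_nat ltnS.
pose E := [set c k | k in [set k | (N0 <= k)%N]].
have hs : has_sup E.
  by split; [exists (c N0), N0 => //=|exists (B + 1) => _ [k _ <-]].
have [_ [N /= N0N <-] cN] := sup_adherent d0 hs.
have key i j : (N <= i)%N -> (i <= j)%N -> q (w i - w j) <= e.
  move=> Ni ij; apply: le_trans (inc _ _ ij) _.
  have N0i := leq_trans N0N Ni.
  have cj : c j <= sup E.
    by apply: ub_le_sup; [exact: hs.2|exists j => //=; exact: leq_trans ij].
  have := c_incr _ _ Ni; have := Nd _ N0N; have := Nd _ N0i.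
  rewrite /d in cN *; move: (i.+1%:R^-1) (N.+1%:R^-1) => x y; lra.
exists N => i j Ni Nj; have [ij|/ltnW ji] := leqP i j; first exact: key.
have Sij a : (N <= a)%N -> S 0%N (w a) by move=> _; exact: S0 ((wS a).1).
have -> : q (w i - w j) = q (w j - w i); last exact: key.
by rewrite !qpar ?(addrC (w i)); [lra|exact: Sij..].
Qed.

Lemma rat_approx (R : realType) (x e : R) : 0 < e ->
  exists q : rat, `|x - ratr q| <= e.
Proof.
move=> e0; have [|q] := @rat_in_itvoo R (x - e) (x + e); first by lra.
rewrite in_itv/= => /andP[h1 h2]; exists q; rewrite ler_norml; apply/andP; split; lra.
Qed.

Section separability.
Context {R : realType} {V : completeNormedModType R}.
Hypothesis parallelogram : forall u w : V,
  `|u - w| ^+ 2 + `|u + w| ^+ 2 = 2 * `|u| ^+ 2 + 2 * `|w| ^+ 2.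

Lemma parallelogram_mid (u w : V) : `|u - w| ^+ 2 =
  2 * `|u| ^+ 2 + 2 * `|w| ^+ 2 - 4 * `|2^-1 *: (u + w)| ^+ 2.
Proof.
rewrite normrZ exprMn gtr0_norm ?invr_gt0//; have := parallelogram u w.
lra.
Qed.

Variables (I : countType) (l : I -> {linear V -> R}).
Hypotheses (l_cont : forall i, continuous (l i))
  (l_sep : forall u w, (forall i, l i u = l i w) -> u = w).

Let slab (m : nat) (q : nat -> R) (e : R) : set V :=
  [set w | forall i, (pickle i < m)%N -> `|l i w - q (pickle i)| <= e].

Let slab_mid m q e u w : slab m q e u -> slab m q e w ->
  slab m q e (2^-1 *: (u + w)).
Proof.
move=> hu hw i im; have := hu i im; have := hw i im.
rewrite linearZ linearD /= !ler_norml => /andP[h1 h2] /andP[h3 h4].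
rewrite /GRing.scale /=; apply/andP; split; lra.
Qed.

(* The dense sequence collects near-minimizers of the norm on the slabs with
   rational data. *)
Lemma separable_of_functionals :
  exists D : nat -> V, forall u e, 0 < e -> exists k, `|u - D k| < e.
Proof.
pose A m (s : seq rat) := slab m (fun i => ratr (nth 0 s i)) m.+1%:R^-1.
pose good m s := [set w | A m s w /\
  forall v, A m s v -> `|w| ^+ 2 <= `|v| ^+ 2 + m.+1%:R^-1].
pose D k := if @unpickle (nat * seq rat)%type k is Some p
  then xget 0 (good p.1 p.2) else 0.
exists D => u.
have sP m : exists s, A m s u.
  have m0 : 0 < m.+1%:R^-1 :> R by rewrite invr_gt0.
  pose q k := if @unpickle I k is Some i then
    sval (cid (rat_approx (l i u) m0)) else 0.
  exists (mkseq q m) => i im; rewrite nth_mkseq// /q pickleK.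
  by case: cid.
have [s us] := choice sP.
pose w m := D (pickle (m, s m)).
have wP m : good m (s m) (w m).
  rewrite /w /D pickleK; apply: xgetPex.
  have [||v _|v Av vmin] := @near_minimizer R V (fun v => `|v| ^+ 2) (A m (s m))
    m.+1%:R^-1; rewrite ?invr_gt0//.
  - by exists u; exact: us.
  - by exists v.
(* Slabs around the exact values of u, twice as wide, contain both u and the chosen near-minimizers
   [w k]. *)
pose S k := slab k (fun i => if @unpickle I i is Some j then l j u else 0)
  (2 * k.+1%:R^-1).
have SE k v : S k v <-> forall i, (pickle i < k)%N ->
    `|l i v - l i u| <= 2 * k.+1%:R^-1.
  by split=> h i ik; have := h i ik; rewrite pickleK.
have wS m : S m (w m).
  apply/SE => i im; have := (wP m).1 i im; have := us m i im.
  rewrite !ler_norml; move: (m.+1%:R^-1) => x.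
  by move=> /andP[h1 h2] /andP[h3 h4]; apply/andP; split; lra.
have uS m : S m u by apply/SE => i _; rewrite subrr normr0 mulr_ge0.
have Sdec k m : (k <= m)%N -> S m `<=` S k.
  move=> km v /SE vm; apply/SE => i ik; apply: le_trans (vm i (leq_trans ik km)) _.
  by rewrite ler_pM2l// lef_pV2 ?posrE// ler_nat.
(* Auxiliary near-minimizers on the wider slabs: their strong limit has the same functionals as u,
   hence is u, so the minimal norms tend to |u|. *)
have [||||z [zS zmin zcauchy]] := @near_minimizers_cauchy R V
  (fun v => `|v| ^+ 2) S (`|u| ^+ 2) Sdec.
- by move=> k a b; exact: slab_mid.
- by move=> v _; rewrite sqr_ge0.
- by move=> a b _ _; exact: parallelogram_mid.
- by move=> k; exists u.
have zu : z k @[k --> \oo] --> u.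
  have /cauchy_cvg/cvg_ex[z' zz'] : cauchy (z k @[k --> \oo]).
    apply: cauchy_exP => e e0.
    have [N zN] := zcauchy (e ^+ 2 / 4) (divr_gt0 (exprn_gt0 2 e0) (ltr0n _ 4)).
    exists (z N), N => // j /= Nj; rewrite -ball_normE /ball_ /=.
    rewrite -(@ltr_pXn2r _ 2)// ?nnegrE ?(ltW e0)//.
    apply: le_lt_trans (zN _ _ (leqnn N) Nj) _.
    have := exprn_gt0 2 e0; lra.
  suff <- : z' = u by [].
  apply: l_sep => i; apply/eqP; rewrite -subr_eq0 -normr_le0.
  have c1 : `|l i (z k) - l i u| @[k --> \oo] --> `|l i z' - l i u|.
    apply: cvg_norm; apply: cvgB; last exact: cvg_cst.
    by apply: continuous_cvg; [exact: l_cont|exact: zz'].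
  have c2 : 2 * k.+1%:R^-1 @[k --> \oo] --> (0 : R).
    have := cvgM (cvg_cst (2 : R)) (@cvg_harmonic R); rewrite mulr0.
    exact.
  apply: (ler_cvg_to c1 c2); exists (pickle i).+1 => // k /= ik.
  by have /SE := zS k; apply.
have wu : `|w k - u| ^+ 2 @[k --> \oo] --> (0 : R).
  have zn : `|z k| ^+ 2 @[k --> \oo] --> `|u| ^+ 2.
    under eq_cvg do rewrite expr2; rewrite expr2.
    by apply: cvgM; exact: cvg_norm.
  (* The parallelogram identity for [w k] and u: the 6 is 2 from the near-minimality of [w k] plus 4
     from that of [z k] against the midpoint. *)
  pose b k : R := 4 * (`|u| ^+ 2 - `|z k| ^+ 2) + 6 * k.+1%:R^-1.
  have b0 : b k @[k --> \oo] --> (0 : R).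
    have -> : (0 : R) = 4 * (`|u| ^+ 2 - `|u| ^+ 2) + 6 * 0 by ring.
    apply: cvgD; apply: cvgM; [exact: cvg_cst| |exact: cvg_cst|exact: cvg_harmonic].
    by apply: cvgB => //; exact: cvg_cst.
  apply: (squeeze_cvgr _ (cvg_cst 0) b0); apply: nearW => k; rewrite sqr_ge0/=.
  rewrite parallelogram_mid.
  have h1 := (wP k).2 _ (us k).
  have h2 := zmin k _ (slab_mid (wS k) (uS k)).
  by rewrite /b; move: (k.+1%:R^-1) h1 h2 => x h1 h2; lra.
move=> e e0; have /cvgrPdist_lt/(_ (e ^+ 2) (exprn_gt0 2 e0)) := wu.
move=> [k _ /(_ k (leqnn k))] /=.
rewrite sub0r normrN ger0_norm ?sqr_ge0// distrC => h.
exists (pickle (k, s k)); rewrite -(@ltr_pXn2r _ 2)// ?nnegrE ?(ltW e0)//.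
Qed.

End separability.

(** * Inner products and separability of the space of fields *)

Section rk_dot_theory.
Context {R : realType} {X : Type} {F : normedModType R} {H : rkhs X F}.
Implicit Types (u w : H) (s : R).

Lemma rk_dotC u w : rk_dot H u w = rk_dot H w u.
Proof. by rewrite hermC /= expr0 mul1r. Qed.

Lemma rk_dotDD u w : rk_dot H (u + w) (u + w) =
  rk_dot H u u + rk_dot H u w + (rk_dot H w u + rk_dot H w w).
Proof. by rewrite linearDl !linearDr. Qed.

Lemma rk_dotBB u w : rk_dot H (u - w) (u - w) =
  rk_dot H u u - rk_dot H u w - (rk_dot H w u - rk_dot H w w).
Proof. by rewrite linearBl !linearBr. Qed.

Lemma rk_dotBl u w z : rk_dot H (u - w) z = rk_dot H u z - rk_dot H w z.
Proof. by rewrite linearBl. Qed.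

Lemma rk_dotZl s u w : rk_dot H (s *: u) w = s * rk_dot H u w.
Proof. by rewrite linearZl_LR. Qed.

Lemma rk_dotZr s u w : rk_dot H u (s *: w) = s * rk_dot H u w.
Proof. by rewrite linearZr_LR. Qed.

Lemma rk_parallelogram u w :
  `|u - w| ^+ 2 + `|u + w| ^+ 2 = 2 * `|u| ^+ 2 + 2 * `|w| ^+ 2.
Proof.
rewrite !rk_norm rk_dotBB rk_dotDD (rk_dotC w).
have E (a b c : R) : a - b - (b - c) + (a + b + (b + c)) = 2 * a + 2 * c by ring.
exact: E.
Qed.

(** A weighted Cauchy-Schwarz inequality, from the squared norms of [t *: u + w] and
    [(- t) *: u + w]; the free weight replaces square roots. *)
Lemma rk_dot_le u w t : 0 < t ->
  `|rk_dot H u w| <= t * `|u| ^+ 2 + `|w| ^+ 2 / t.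
Proof.
move=> t0.
have E s : rk_dot H (s *: u + w) (s *: u + w) =
    s ^+ 2 * rk_dot H u u + 2 * (s * rk_dot H u w) + rk_dot H w w.
  rewrite rk_dotDD !rk_dotZl !rk_dotZr (rk_dotC w).
  have e (x y z : R) : s * (s * x) + s * y + (s * y + z) =
    s ^+ 2 * x + 2 * (s * y) + z by ring.
  exact: e.
have h1 := sqr_ge0 `|t *: u + w|; have h2 := sqr_ge0 `|(- t) *: u + w|.
rewrite rk_norm E -!rk_norm in h1; rewrite rk_norm E -!rk_norm sqrrN in h2.
rewrite -(ler_pM2l t0) mulrDr [t * (_ / t)]mulrCA mulfV ?gt_eqF// mulr1 mulrA -expr2.
rewrite -[t in leLHS]gtr0_norm// -normrM ler_norml.
have hb := sqr_ge0 `|w|; have ha : 0 <= t ^+ 2 * `|u| ^+ 2.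
  by rewrite mulr_ge0 ?sqr_ge0.
by apply/andP; split; lra.
Qed.

End rk_dot_theory.

Lemma rV_rat_approx (R : realType) n (x : 'rV[R]_n) (e : R) : 0 < e ->
  exists q : 'rV[rat]_n, `|x - map_mx ratr q| <= e.
Proof.
move=> e0; exists (\row_i sval (cid (rat_approx (x 0 i) e0))).
apply: rV_norm_le => [|j]; first exact: ltW.
by rewrite !mxE; case: cid.
Qed.

(** The coordinates of the evaluations at rational points are countably many, and by the Lipschitz
    bound they determine the field. *)
Lemma rk_separable (R : realType) n (V : rkhs 'rV[R]_n 'rV[R]_n) :
  embedded_in_C0p 2 V ->
  exists D : nat -> V, forall u e, 0 < e -> exists k, `|u - D k| < e.
Proof.
move=> /embedded_C02_estimates[C C0 VC].
have lin (p : 'rV[rat]_n * 'I_n) :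
    {l : {linear V -> R} | forall u, l u = rk_fun u (map_mx ratr p.1) 0 p.2}.
  pose l (u : V) : R := rk_fun u (map_mx ratr p.1) 0 p.2.
  have l_lin : linear l by move=> a u w; rewrite /l /rk_fun linearP !mxE.
  pose L : {linear V -> R} := HB.pack l (GRing.isLinear.Build _ _ _ _ l l_lin).
  by exists L.
apply: (@separable_of_functionals _ _ (@rk_parallelogram _ _ _ V)
  ('rV[rat]_n * 'I_n)%type (fun p => sval (lin p))).
  move=> p u; have -> : (sval (lin p) : V -> R) =
      (fun A : 'rV[R]_n => A 0 p.2) \o rk_eval V (map_mx ratr p.1).
    by apply/funext => w; rewrite (svalP (lin p)).
  by apply: continuous_comp; [exact: rk_eval_continuous|exact: coord_continuous].
move=> u w uw; apply: rk_inj => x; rewrite -!/(rk_fun _ _).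
have [_ lu _] := VC u; have [_ lw _] := VC w.
apply/eqP; rewrite -subr_eq0 -normr_le0; apply/ler_addgt0Pr => e e0.
rewrite add0r; set c := C * `|u| + C * `|w| + 1.
have c0 : 0 < c by rewrite ltr_wpDl// addr_ge0// mulr_ge0.
have [q qx] := rV_rat_approx x (divr_gt0 e0 c0).
have E : rk_fun u (map_mx ratr q) = rk_fun w (map_mx ratr q).
  by apply/rowP => i; have := uw (q, i); rewrite !(svalP (lin (q, i))).
rewrite -(subrK (rk_fun u (map_mx ratr q)) (rk_fun u x)) {2}E -addrA.
apply: le_trans (ler_normD _ _) _; rewrite [X in _ + X]distrC.
apply: le_trans (lerD (lu _ _) (lw _ _)) _.
rewrite -mulrDl; apply: (@le_trans _ _ (c * (e / c))).
  by apply: ler_pM => //; rewrite ?addr_ge0 ?mulr_ge0// lerDl.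
by rewrite mulrCA mulfV ?mulr1// gt_eqF.
Qed.

(** * Borel maps into separable normed spaces *)

Section borel_functions.
Context {d : measure_display} {T : measurableType d} {D : set T}.
Hypothesis mD : measurable D.

Lemma borel_measurable_fun (X : ptopologicalType) (f : T -> borel X) :
  (forall O : set X, open O -> measurable (D `&` f @^-1` O)) ->
  measurable_fun D f.
Proof.
move=> h; apply: (@measurability _ _ _ _ D f (@open X)) => //.
by move=> _ [U oU <-]; exact: h.
Qed.

Lemma measurable_preimage_open (X : ptopologicalType) (f : T -> borel X)
    (O : set X) : measurable_fun D f -> open O -> measurable (D `&` f @^-1` O).
Proof. by move=> mf oO; apply: mf => //; exact: sub_sigma_algebra. Qed.

Lemma measurable_fun_continuous_comp (R : realType) (X : ptopologicalType)
    (g : X -> R) (f : T -> borel X) : continuous g -> measurable_fun D f ->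
  measurable_fun D (g \o f : T -> measurableTypeR R).
Proof.
move=> cg mf; apply: (measurability _ (measurable_realfun.RGenOpens.measurableE R)) => //.
move=> _ [_ [a [b ->]] <-].
apply: (@measurable_preimage_open X f (g @^-1` `]a, b[%classic)) => //.
by apply: open_comp => [x _|]; [exact: cg|exact: interval_open].
Qed.

(** The Borel sets of a product need not be generated by boxes; with dense sequences, the preimage
    of an open set is a countable union of products of balls centred on them. *)
Lemma measurable_fun_borel2 (R : realType) (X Y : normedModType R)
    (Z : ptopologicalType) (p : nat -> X) (q : nat -> Y) (g : X * Y -> Z)
    (f : T -> borel X) (h : T -> borel Y) :
  (forall x e, 0 < e -> exists k, `|x - p k| < e) ->
  (forall y e, 0 < e -> exists k, `|y - q k| < e) ->
  continuous g -> measurable_fun D f -> measurable_fun D h ->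
  measurable_fun D (fun t => g (f t, h t) : borel Z).
Proof.
move=> pd qd cg mf mh; apply: borel_measurable_fun => O oO.
pose B (k : nat) : R := k.+1%:R^-1.
pose P (i : (nat * nat) * nat) := D `&` ([set t | ball (p i.1.1) (B i.2) (f t)]
   `&` [set t | ball (q i.1.2) (B i.2) (h t)]).
pose G (i : (nat * nat) * nat) := forall x y, ball (p i.1.1) (B i.2) x ->
  ball (q i.1.2) (B i.2) y -> O (g (x, y)).
have -> : D `&` (fun t => g (f t, h t)) @^-1` O =
    \bigcup_(k in [set k | if unpickle k is Some i then G i else False])
      (if unpickle k is Some i then P i else set0).
  apply/seteqP; split=> [t [Dt Ot]|t [k /=]]; last first.
    by case: unpickle => // i Gi [Dt [ft ht]]; split=> //; exact: Gi.
  have : nbhs (f t : X, h t : Y) (g @^-1` O).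
    by apply: cg; exact: open_nbhs_nbhs.
  case=> -[A1 A2] /= [/nbhs_ballP[e1 /= e10 A1e] /nbhs_ballP[e2 /= e20 A2e]] AO.
  pose e := Num.min e1 e2; have e0 : 0 < e by rewrite lt_min e10.
  (* The radius 1/(k+1) is below e/2, so a ball of that radius that contains the point lies in the
     ball of radius e around the point. *)
  pose k := Num.truncn (2 / e).
  have Bk : B k < e / 2.
    rewrite -[e / 2]invrK invf_div ltf_pV2 ?posrE ?divr_gt0//.
    exact: truncnS_gt.
  have Bk0 : 0 < B k by rewrite invr_gt0.
  have [i1 pi1] := pd (f t) _ Bk0; have [i2 qi2] := qd (h t) _ Bk0.
  exists (pickle ((i1, i2), k)); rewrite /= pickleK.
    move=> x y /= px qy; apply: (AO (x, y)); split=> /=.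
      apply: A1e; apply: (@le_ball _ _ _ (B k + B k)).
        by have := ge_min e1 e1 e2; rewrite lexx /= -/e; lra.
      by apply: ball_triangle px; rewrite -ball_normE.
    apply: A2e; apply: (@le_ball _ _ _ (B k + B k)).
      by have := ge_min e2 e1 e2; rewrite lexx orbT -/e; lra.
    by apply: ball_triangle qy; rewrite -ball_normE.
  by split=> //; split; rewrite /= -ball_normE /ball_ /= distrC.
apply: bigcup_measurable => k _; case: unpickle => // i.
rewrite /P -{1}[D]setIid setIACA; apply: measurableI.
  by apply: measurable_preimage_open => //; exact: ball_open.
by apply: measurable_preimage_open => //; exact: ball_open.
Qed.

(** The limit lies in O exactly when, for some i, the terms eventually keep the distance 1/(i+1)
    from the complement of O; [A i] is the open neighbourhood of the complement that they avoid. *)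
Lemma borel_measurable_fun_cvg (R : realType) (X : normedModType R)
    (f : nat -> T -> borel X) (g : T -> borel X) :
  (forall k, measurable_fun D (f k)) ->
  (forall t, D t -> (f k t : X) @[k --> \oo] --> (g t : X)) ->
  measurable_fun D g.
Proof.
move=> mf fg; apply: borel_measurable_fun => O oO.
pose B (k : nat) : R := k.+1%:R^-1.
have B0 k : 0 < B k by rewrite invr_gt0.
pose A (j : nat) : set X := [set x | exists2 y, ~ O y & ball y (B j) x].
have oA j : open (A j).
  have -> : A j = \bigcup_(y in ~` O) ball y (B j) by [].
  by apply: bigcup_open => y _; exact: ball_open.
have -> : D `&` g @^-1` O = \bigcup_(i in [set: nat]) \bigcup_(N in [set: nat])
    \bigcap_(k in [set k | (N <= k)%N]) (D `&` f k @^-1` (~` A i)).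
  apply/seteqP; split=> [t [Dt Ot]|t [i _ [N _ ht]]]; last first.
    have Dt : D t by have [] := ht N (leqnn N).
    split=> //; have /cvg_ballP/(_ _ (B0 i))[M _ hM] := fg _ Dt.
    have /= := hM (maxn N M) (leq_maxr _ _).
    have [_] := ht (maxn N M) (leq_maxl _ _).
    move=> /= nA gf; apply: contrapT => nO; apply: nA.
    by exists (g t).
  have /nbhs_ballP[e /= e0 eO] : nbhs (g t : X) O by exact: open_nbhs_nbhs.
  pose k := Num.truncn (2 / e).
  have Bk : B k < e / 2.
    rewrite -[e / 2]invrK invf_div ltf_pV2 ?posrE ?divr_gt0//.
    exact: truncnS_gt.
  have /cvg_ballP/(_ _ (B0 k))[N _ hN] := fg _ Dt.
  exists k => //; exists N => // m /= Nm; split=> //= -[y nOy yf].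
  apply: nOy; apply: eO; apply: (@le_ball _ _ _ (B k + B k)); first lra.
  apply: ball_triangle (ball_sym yf); exact: hN.
apply: bigcup_measurable => i _; apply: bigcup_measurable => N _.
apply: bigcap_measurable => [|k _]; first by exists N => /=.
have -> : D `&` f k @^-1` (~` A i) = D `\` (D `&` f k @^-1` A i).
  apply/seteqP; split=> [t [Dt nA]|t [Dt nA]]; split=> //; first by case.
  by move=> At; apply: nA.
by apply: measurableD => //; exact: measurable_preimage_open.
Qed.

End borel_functions.

(** * Square-integrable velocity fields *)

Section velocity_fields.
Context {R : realType} {n : nat} {V : rkhs 'rV[R]_n 'rV[R]_n}.
Hypothesis V2 : embedded_in_C0p 2 V.
Local Notation mu := (@lebesgue_measure R).
Implicit Types (v w : R -> V).

Definition kinetic v : R := \int[mu]_(t in `[0, 1]) (`|v t| ^+ 2).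

Lemma measurable_itv01 : measurable (`[0, 1]%classic : set (measurableTypeR R)).
Proof. exact: measurable_itv. Qed.
Hint Resolve measurable_itv01 : core.

Lemma L2_measurable_norm v : is_L2 v ->
  measurable_fun (`[0, 1]%classic : set (measurableTypeR R)) (fun t => `|v t|).
Proof.
case=> mv _.
apply: (@measurable_fun_continuous_comp _ _ _ _ R V (fun u => `|u|)) => //.
exact: norm_continuous.
Qed.

Lemma L2_integrable_sqr v : is_L2 v ->
  mu.-integrable `[0, 1] (fun t => (`|v t| ^+ 2)%:E).
Proof.
move=> vL; apply/integrableP; split.
  by apply/measurable_EFinP; apply: measurable_funX; exact: L2_measurable_norm.
under eq_integral => t _ do rewrite gee0_abs ?lee_fin ?sqr_ge0//.
exact: vL.2.
Qed.

Lemma kineticE v : is_L2 v ->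
  (\int[mu]_(t in `[0%R, 1%R]) (`|v t| ^+ 2)%:E = (kinetic v)%:E)%E.
Proof.
move=> vL; rewrite /kinetic /Rintegral fineK//.
by apply: integrable_fin_num => //; exact: L2_integrable_sqr.
Qed.

Lemma kinetic_ge0 v : 0 <= kinetic v.
Proof. by apply: Rintegral_ge0 => t _; exact: sqr_ge0. Qed.

Lemma integrable_cst_itv (s t c : R) : mu.-integrable `[s, t] (EFin \o cst c).
Proof.
apply/integrableP; split; first exact/measurable_EFinP/measurable_cst.
have -> : (fun x => `|(EFin \o cst c) x|)%E = cst `|c|%:E by [].
rewrite integral_cst//= lebesgue_measure_itv; case: ifP => _; last by rewrite mule0 ltry.
by rewrite -EFinD -EFinM ltry.
Qed.

Lemma Rintegral_cst_itv (s t c : R) : s <= t ->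
  \int[mu]_(x in `[s, t]) c = c * (t - s).
Proof.
rewrite Rintegral_cst; last exact: measurable_itv.
rewrite /= lebesgue_measure_itv /= lte_fin le_eqVlt => /predU1P[->|->]//.
by rewrite ltxx subrr.
Qed.

Lemma Rintegral_subset_le (A B : set (measurableTypeR R)) (f : R -> R) :
  measurable A -> measurable B -> A `<=` B ->
  mu.-integrable B (EFin \o f) -> (forall x, 0 <= f x) ->
  \int[mu]_(x in A) f x <= \int[mu]_(x in B) f x.
Proof.
move=> mA mB AB fB f0.
have fA := integrableS mB mA AB fB.
rewrite /Rintegral; apply: fine_le; try exact: integrable_fin_num.
apply: ge0_subset_integral => //; first by case/integrableP: fB.
by move=> x _; rewrite lee_fin.
Qed.

Lemma L2_integrable_norm v : is_L2 v ->
  mu.-integrable `[0, 1] (EFin \o (fun t => `|v t|)).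
Proof.
move=> vL.
have i := integrableD measurable_itv01 (L2_integrable_sqr vL)
  (integrable_cst_itv 0 1 1).
apply: (le_integrable measurable_itv01 _ _ i).
  by apply/measurable_EFinP; exact: L2_measurable_norm.
move=> t _; rewrite /= lee_fin normr_id [leRHS]ger0_norm; last first.
  by rewrite addr_ge0// sqr_ge0.
by have := sqr_ge0 (`|v t| - 2^-1); rewrite sqrrB; lra.
Qed.

Lemma sub_itv01 (s t : R) : 0 <= s -> t <= 1 ->
  `[s, t]%classic `<=` (`[0, 1]%classic : set R).
Proof.
move=> s0 t1 x /=; rewrite !in_itv/= => /andP[sx xt].
by rewrite (le_trans s0 sx) (le_trans xt t1).
Qed.

(** Integrates |v| <= a |v|^2 + 1/a. The weight a, chosen at each use, stands in for
    Cauchy-Schwarz. *)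
Lemma Rintegral_norm_le v (s t a : R) : is_L2 v -> 0 <= s -> s <= t -> t <= 1 ->
  0 < a -> \int[mu]_(x in `[s, t]) `|v x| <= a * kinetic v + (t - s) / a.
Proof.
move=> vL s0 st t1 a0.
have ss := sub_itv01 s0 t1.
have m : measurable (`[s, t]%classic : set (measurableTypeR R)).
  exact: measurable_itv.
have i1 : mu.-integrable `[s, t] (EFin \o (fun x => `|v x|)).
  exact: integrableS measurable_itv01 m ss (L2_integrable_norm vL).
have i2 : mu.-integrable `[s, t] (EFin \o (fun x => `|v x| ^+ 2)).
  exact: integrableS measurable_itv01 m ss (L2_integrable_sqr vL).
have i3 : mu.-integrable `[s, t] (EFin \o (fun x => a * `|v x| ^+ 2)).
  by have := integrableZl m a i2; apply: eq_integrable => // x _; rewrite /= EFinM.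
have ic := integrable_cst_itv s t a^-1.
apply: (@le_trans _ _ (\int[mu]_(x in `[s, t]) (a * `|v x| ^+ 2 + a^-1))).
  apply: le_Rintegral => //.
    by have := integrableD m i3 ic; apply: eq_integrable => // x _; rewrite /= EFinD.
  move=> x _; rewrite -(ler_pM2l a0) mulrDr mulfV ?gt_eqF// mulrA -expr2 -exprMn.
  by have := sqr_ge0 (a * `|v x| - 2^-1); rewrite sqrrB; lra.
rewrite RintegralD// RintegralZl// Rintegral_cst_itv// [X in _ + X]mulrC.
rewrite lerD2r ler_pM2l//; apply: Rintegral_subset_le => //.
exact: L2_integrable_sqr.
Qed.

Lemma L2_comp2 (g : V * V -> V) v w (c : R) : is_L2 v -> is_L2 w ->
  continuous g -> (forall p, `|g p| <= c * (`|p.1| + `|p.2|)) ->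
  is_L2 (fun t => g (v t, w t)).
Proof.
move=> vL wL cg gc; have [D Dd] := rk_separable V2.
have mg : measurable_fun (`[0, 1]%classic : set (measurableTypeR R))
    ((fun t => g (v t, w t)) : _ -> borel V).
  apply: (measurable_fun_borel2 measurable_itv01 Dd Dd cg); [exact: vL.1|exact: wL.1].
split=> //.
(* The factor 2 c^2 comes from (|v| + |w|)^2 <= 2 |v|^2 + 2 |w|^2. *)
have i : mu.-integrable `[0, 1] (fun t => (2 * c ^+ 2)%:E *
    ((`|v t| ^+ 2)%:E + (`|w t| ^+ 2)%:E))%E.
  by apply: integrableZl => //; apply: integrableD => //; exact: L2_integrable_sqr.
have mn : measurable_fun (`[0, 1]%classic : set (measurableTypeR R))
    (fun t => (`|g (v t, w t)| ^+ 2)%:E).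
  apply/measurable_EFinP/measurable_funX.
  apply: (@measurable_fun_continuous_comp _ _ _ _ R V (fun u => `|u|)) => //.
  exact: norm_continuous.
have [|] := integrableP _ _ _ (le_integrable measurable_itv01 mn _ i).
  move=> t _; rewrite -EFinD -EFinM !abse_EFin lee_fin ger0_norm ?sqr_ge0//.
  rewrite ger0_norm; last first.
    apply: mulr_ge0; first by apply: mulr_ge0 => //; exact: sqr_ge0.
    by apply: addr_ge0; exact: sqr_ge0.
  have h := gc (v t, w t); have h0 := le_trans (normr_ge0 _) h.
  have := ler_pM (normr_ge0 _) (normr_ge0 _) h h; rewrite -!expr2 => /le_trans; apply.
  rewrite exprMn -[leRHS]mulrA [leRHS]mulrCA; apply: ler_wpM2l.
    exact: sqr_ge0.
  rewrite /=; by have := sqr_ge0 (`|v t| - `|w t|); rewrite sqrrB sqrrD; lra.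
move=> _; under eq_integral => t _ do rewrite gee0_abs ?lee_fin ?sqr_ge0//.
exact.
Qed.

Lemma L2_sub v w : is_L2 v -> is_L2 w -> is_L2 (v - w).
Proof.
move=> vL wL; apply: (@L2_comp2 (fun p => p.1 - p.2) _ _ 1) => //.
  move=> p; apply: (@cvgB _ _ _ (nbhs p)); [exact: cvg_fst|exact: cvg_snd].
by move=> p; rewrite mul1r ler_normB.
Qed.

Lemma L2_mid v w : is_L2 v -> is_L2 w -> is_L2 (2^-1 *: (v + w)).
Proof.
move=> vL wL; apply: (@L2_comp2 (fun p => 2^-1 *: (p.1 + p.2)) _ _ 1) => //.
  move=> p; apply: (@cvgZ _ _ _ (nbhs p)); first exact: cvg_cst.
  by apply: (@cvgD _ _ _ (nbhs p)); [exact: cvg_fst|exact: cvg_snd].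
move=> p; rewrite mul1r normrZ; apply: le_trans (ler_normD _ _).
by rewrite ler_piMl// gtr0_norm ?invr_gt0// invf_le1// ler1n.
Qed.

Lemma kinetic_parallelogram v w : is_L2 v -> is_L2 w ->
  kinetic (v - w) =
  2 * kinetic v + 2 * kinetic w - 4 * kinetic (2^-1 *: (v + w)).
Proof.
move=> vL wL.
have i1 := L2_integrable_sqr vL; have i2 := L2_integrable_sqr wL.
have i3 := L2_integrable_sqr (L2_mid vL wL).
rewrite /kinetic -!RintegralZl// -RintegralD//; last 2 first.
- have := integrableZl measurable_itv01 2 i1.
  by apply: eq_integrable => // x _; rewrite /= EFinM.
- have := integrableZl measurable_itv01 2 i2.
  by apply: eq_integrable => // x _; rewrite /= EFinM.
rewrite -RintegralB//; last 2 first.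
- have := integrableD measurable_itv01 (integrableZl measurable_itv01 2 i1)
    (integrableZl measurable_itv01 2 i2).
  by apply: eq_integrable => // x _; rewrite /= EFinD !EFinM.
- have := integrableZl measurable_itv01 4 i3.
  by apply: eq_integrable => // x _; rewrite /= EFinM.
apply: eq_Rintegral => t _; exact: (parallelogram_mid (@rk_parallelogram _ _ _ V)).
Qed.

(** Evaluation (u, x) -> u(x) is jointly continuous by the Lipschitz bound, and is composed with two
    Borel maps into separable spaces. *)
Lemma eval_measurable v (a : R -> 'rV[R]_n) i : is_L2 v -> continuous a ->
  measurable_fun (`[0, 1]%classic : set (measurableTypeR R))
    (fun s => rk_fun (v s) (a s) 0 i).
Proof.
move=> vL ca; have [D Dd] := rk_separable V2.
have [C C0 VC] := embedded_C02_estimates V2.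
pose Q k : 'rV[R]_n := if unpickle k is Some q then map_mx ratr (q : 'rV[rat]_n) else 0.
have Qd x e : 0 < e -> exists k, `|x - Q k| < e.
  move=> e0; have [q qx] := rV_rat_approx x (divr_gt0 e0 (ltr0n _ 2)).
  exists (pickle q); rewrite /Q pickleK; apply: le_lt_trans qx _.
  by rewrite ltr_pdivrMr// ltr_pMr// ltr1n.
have ma : measurable_fun (`[0, 1]%classic : set (measurableTypeR R))
    (a : _ -> borel 'rV[R]_n).
  apply: borel_measurable_fun => // U oU; apply: measurableI => //.
  by apply: open_measurable; apply: open_comp => // x _; exact: ca.
pose g (p : V * 'rV[R]_n) : 'rV[R]_n := rk_fun p.1 p.2.
have cg : continuous g.
  move=> [u x]; apply/cvgrPdist_le => e e0; rewrite /g /=.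
  have c0 : 0 < C * `|u| + C + 1 by rewrite ltr_wpDl// addr_ge0// mulr_ge0.
  have d0 := divr_gt0 e0 c0.
  have /cvgrPdist_le/(_ _ d0) n1 :
    (fun p : V * 'rV[R]_n => p.1) @ (u, x) --> u by exact: cvg_fst.
  have /cvgrPdist_le/(_ _ d0) n2 :
    (fun p : V * 'rV[R]_n => p.2) @ (u, x) --> x by exact: cvg_snd.
  near=> p.
  have h1 : `|u - p.1| <= e / (C * `|u| + C + 1).
    by near: p.
  have h2 : `|x - p.2| <= e / (C * `|u| + C + 1).
    by near: p.
  rewrite -(subrK (rk_fun u p.2) (rk_fun u x)) -addrA.
  have -> : rk_fun u p.2 - rk_fun p.1 p.2 = rk_fun (u - p.1) p.2.
    by rewrite /rk_fun linearB.
  apply: le_trans (ler_normD _ _) _.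
  have [_ l1 _] := VC u; have [l2 _ _] := VC (u - p.1).
  apply: le_trans (lerD (l1 _ _) (l2 _)) _.
  apply: (@le_trans _ _ ((C * `|u| + C) * (e / (C * `|u| + C + 1)))).
    by rewrite mulrDl; apply: lerD; apply: ler_wpM2l => //; rewrite mulr_ge0.
  rewrite mulrCA; apply: ler_piMr; first exact: ltW.
  by rewrite ler_pdivrMr// mul1r lerDl.
have mg := measurable_fun_borel2 measurable_itv01 Dd Qd cg vL.1 ma.
apply: (@measurable_fun_continuous_comp _ _ _ _ R 'rV[R]_n
  (fun A => A 0 i)) mg => //.
exact: coord_continuous.
Unshelve. all: by end_near. Qed.

End velocity_fields.

(** * Trajectories and flows *)

Section trajectories.
Context {R : realType} {n : nat} {V : rkhs 'rV[R]_n 'rV[R]_n}.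
Local Notation mu := (@lebesgue_measure R).
Implicit Types (v : R -> V) (X Y F G : R -> 'rV[R]_n).

(** The velocity F is a function of time alone, not a field along X, so that differences of
    trajectories are again trajectories. *)
Definition trajectory F X := forall i,
  mu.-integrable `[0, 1] (EFin \o (fun s => F s 0 i)) /\
  forall t, 0 <= t <= 1 ->
    X t 0 i = X 0 0 i + \int[mu]_(s in `[0, t]) F s 0 i.

Lemma integrable_sub01 (f : R -> R) (s t : R) : 0 <= s -> t <= 1 ->
  mu.-integrable `[0, 1] (EFin \o f) -> mu.-integrable `[s, t] (EFin \o f).
Proof.
move=> s0 t1; apply: integrableS; [exact: measurable_itv..|exact: sub_itv01].
Qed.

Lemma trajectory_sub F X G Y : trajectory F X -> trajectory G Y ->
  trajectory (fun t => F t - G t) (fun t => X t - Y t).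
Proof.
move=> FX GY i; have [iF eF] := FX i; have [iG eG] := GY i; split.
  have := integrableB measurable_itv01 iF iG; apply: eq_integrable.
    exact: measurable_itv01.
  by move=> s _; rewrite /= !mxE EFinB.
move=> t t01; rewrite !mxE eF// eG//.
under [in RHS]eq_Rintegral => s _ do rewrite !mxE.
have /andP[t0 t1] := t01.
rewrite RintegralB; [|exact: measurable_itv|exact: integrable_sub01..].
by ring.
Qed.

Lemma trajectory_diff F X s t i : trajectory F X -> 0 <= s -> s <= t -> t <= 1 ->
  X t 0 i - X s 0 i = \int[mu]_(r in `[s, t]) F r 0 i.
Proof.
move=> FX s0 st t1; have [iF eF] := FX i.
rewrite (eF t) ?(le_trans s0 st)// (eF s) ?s0 ?(le_trans st)//.
rewrite opprD addrACA subrr add0r Rintegral_itvB//.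
- rewrite Rintegral_itv_obnd_cbnd//; apply: integrableS iF => //.
  move=> x /=; rewrite !in_itv /= => /andP[sx xt].
  by rewrite (le_trans s0 (ltW sx)) (le_trans xt).
- exact: integrable_sub01.
Qed.

Lemma trajectory_incr v F X s t (c : R) : is_L2 v -> trajectory F X ->
  0 <= s -> s <= t -> t <= 1 -> 0 <= c ->
  (forall r, s <= r <= t -> `|F r| <= c * `|v r|) ->
  `|X t - X s| <= c * \int[mu]_(r in `[s, t]) `|v r|.
Proof.
move=> vL FX s0 st t1 c0 Fc.
have iv : mu.-integrable `[s, t] (EFin \o (fun r => `|v r|)).
  by apply: integrable_sub01 => //; exact: L2_integrable_norm.
have m : measurable (`[s, t]%classic : set (measurableTypeR R)).
  exact: measurable_itv.
apply: rV_norm_le => [|i]; first by rewrite mulr_ge0// Rintegral_ge0.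
rewrite !mxE (trajectory_diff _ FX)//.
have iF : mu.-integrable `[s, t] (EFin \o (fun r => F r 0 i)).
  by apply: integrable_sub01 => //; exact: (FX i).1.
apply: le_trans (le_normr_Rintegral m iF) _.
rewrite -RintegralZl//; apply: le_Rintegral => //.
- by have := integrable_norm iF; apply: eq_integrable.
- by have := integrableZl m c iv; apply: eq_integrable => // r _; rewrite /= EFinM.
- move=> r; rewrite /= in_itv /= => /Fc; apply: le_trans; exact: mx_coord_le.
Qed.

(** A qualitative bound, there to make the suprema in [gronwall] exist. *)
Lemma trajectory_bounded F X : trajectory F X ->
  exists B, forall t, 0 <= t <= 1 -> `|X t| <= B.
Proof.
move=> FX.
pose b i := `|X 0 0 i| + \int[mu]_(s in `[0, 1]) `|F s 0 i|.
have b0 i : 0 <= b i by rewrite addr_ge0// Rintegral_ge0.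
exists (\sum_i b i) => t t01; apply: rV_norm_le => [|i]; first exact: sumr_ge0.
apply: (@le_trans _ _ (b i)); last by rewrite (bigD1 i)//= lerDl sumr_ge0.
have [iF ->//] := FX i; apply: le_trans (ler_normD _ _) _; rewrite lerD2l.
have /andP[t0 t1] := t01.
have m s : measurable (`[0, s]%classic : set (measurableTypeR R)).
  exact: measurable_itv.
apply: le_trans (le_normr_Rintegral (m t) _) _; first exact: integrable_sub01.
apply: Rintegral_subset_le => //; first exact: sub_itv01.
by have := integrable_norm iF; apply: eq_integrable.
Qed.

(** Equi-integrability of the norms: d depends only on the energy bound, not on the field. The
    weight satisfies a (B + 1) = e/2, and t - s <= a e/2 bounds the other term by e/2. *)
Lemma uniformly_small_norm (B e : R) : 0 <= B -> 0 < e ->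
  exists2 d, 0 < d & forall v s t, is_L2 v -> kinetic v <= B ->
    0 <= s -> s <= t -> t <= 1 -> t - s <= d ->
    \int[mu]_(r in `[s, t]) `|v r| <= e.
Proof.
move=> B0 e0; pose a := e / (2 * (B + 1)).
have B1 : 0 < B + 1 by rewrite ltr_wpDl.
have a0 : 0 < a by rewrite divr_gt0// mulr_gt0.
exists (a * (e / 2)) => [|v s t vL vB s0 st t1 d]; first by rewrite mulr_gt0// divr_gt0.
apply: le_trans (Rintegral_norm_le vL s0 st t1 a0) _.
apply: (@le_trans _ _ (a * (B + 1) + e / 2)).
  apply: lerD; first by rewrite ler_pM2l// (le_trans vB)// lerDl.
  by rewrite ler_pdivrMr// mulrC.
rewrite /a invfM mulrA mulfVK ?gt_eqF//; lra.
Qed.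

(* On an interval where the integral of C * |v| is at most 1/2, the supremum
   of |X| is at most 2 |X s| + c for every s in the interval. *)
Lemma gronwall (B C : R) : 0 <= B -> 0 <= C ->
  exists2 M, 1 <= M & forall v F X c, is_L2 v -> kinetic v <= B ->
    trajectory F X -> 0 <= c ->
    (forall r, 0 <= r <= 1 -> `|F r| <= C * `|v r| * (`|X r| + c)) ->
    forall s t, 0 <= s <= 1 -> 0 <= t <= 1 -> `|X t| <= M * (`|X s| + c).
Proof.
move=> B0 C0; have C1 : 0 < C + 1 by rewrite ltr_wpDl.
have C2 : 0 < 2^-1 / (C + 1) by rewrite divr_gt0.
have [d d0 small] := uniformly_small_norm B0 C2.

(* N steps of length d cover [0, 1], and each at most doubles |X| + c, whence the constant 2^N. *)
pose N := (Num.truncn d^-1).+1.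
have Nd : 1 <= N%:R * d.
  by rewrite -ler_pdivrMr// mul1r ltW// truncnS_gt.
exists (2 ^+ N); first by rewrite exprn_ege1// ler1n.
move=> v F X c vL vB FX c0 Fv.
have [b Xb] := trajectory_bounded FX.
(* Stated in both directions, because trajectories are also followed backwards in time. *)
have step s t : 0 <= s -> s <= t -> t <= 1 -> t - s <= d ->
    `|X t| <= 2 * `|X s| + c /\ `|X s| <= 2 * `|X t| + c.
  move=> s0 st t1 std.
  pose E := [set `|X r| | r in [set r | s <= r <= t]].
  have E01 r : s <= r <= t -> 0 <= r <= 1.
    by move=> /andP[sr rt]; rewrite (le_trans s0 sr) (le_trans rt).
  have hE : has_sup E.
    split; first by exists `|X s|, s => //=; rewrite lexx.
    by exists b => _ [r /= /E01/Xb ? <-].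
  have XE r : s <= r <= t -> `|X r| <= sup E.
    by move=> rst; apply: ub_le_sup; [exact: hE.2|exists r].
  have E0 : 0 <= sup E by apply: le_trans (XE s _) => //; rewrite lexx.
  have inc p q : s <= p -> p <= q -> q <= t -> `|X q - X p| <= (sup E + c) / 2.
    move=> sp pq qt.
    apply: (@le_trans _ _ ((C + 1) * (sup E + c) * \int[mu]_(r in `[p, q]) `|v r|)).
      apply: (trajectory_incr vL FX (le_trans s0 sp) pq (le_trans qt t1)).
        by rewrite mulr_ge0 ?addr_ge0.
      move=> r /andP[pr rq].
      have rst : s <= r <= t by rewrite (le_trans sp pr) (le_trans rq).
      apply: le_trans (Fv r (E01 _ rst)) _; rewrite mulrAC.
      rewrite ler_wpM2r//; apply: ler_pM => //; rewrite ?addr_ge0 ?lerDl//.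
      by rewrite lerD2r XE.
    have h : \int[mu]_(r in `[p, q]) `|v r| <= 2^-1 / (C + 1).
      apply: (small _ _ _ vL vB (le_trans s0 sp) pq (le_trans qt t1)).
      by apply: le_trans std; lra.
    apply: le_trans (ler_wpM2l _ h) _; first by rewrite mulr_ge0 ?addr_ge0// ltW.
    rewrite le_eqVlt; apply/orP; left; apply/eqP; field.
    by rewrite gt_eqF.
  have sE a : (forall r, s <= r <= t -> `|X r - X a| <= (sup E + c) / 2) ->
      sup E <= 2 * `|X a| + c.
    (* Half of the supremum is absorbed into the left-hand side. *)
    move=> h; suff : sup E <= `|X a| + (sup E + c) / 2 by lra.
    apply: ge_sup; first exact: hE.1.
    move=> _ [r /= rst <-]; rewrite -(subrKC (X a) (X r)).
    by apply: le_trans (ler_normD _ _) _; rewrite lerD2l h.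
  split.
    apply: le_trans (XE t _) (sE s _); first by rewrite st lexx.
    by move=> r /andP[sr rt]; exact: inc.
  apply: le_trans (XE s _) (sE t _); first by rewrite st lexx.
  by move=> r /andP[sr rt]; rewrite distrC; exact: inc.
have step' s t : 0 <= s <= 1 -> 0 <= t <= 1 -> `|t - s| <= d ->
    `|X t| <= 2 * `|X s| + c.
  move=> /andP[s0 s1] /andP[t0 t1].
  have [st|/ltW ts] := leP s t.
    by rewrite ger0_norm ?subr_ge0// => h; exact: (step s t s0 st t1 h).1.
  by rewrite ler0_norm ?subr_le0// opprB => h; exact: (step t s t0 ts s1 h).2.
have iter k s t : 0 <= s <= 1 -> 0 <= t <= 1 -> `|t - s| <= k%:R * d ->
    `|X t| + c <= 2 ^+ k * (`|X s| + c).
  elim: k s t => [|k IH] s t s01 t01.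
    by rewrite mul0r normr_le0 subr_eq0 => /eqP ->; rewrite expr0 mul1r.
  (* The point at the fraction k/(k+1) of the way from s to t splits off one step of length at most
     d. *)
  move=> ts; pose z := k%:R / k.+1%:R : R.
  have z0 : 0 <= z by rewrite divr_ge0.
  have z1 : z <= 1 by rewrite ler_pdivrMr// mul1r ler_nat.
  pose r := s + (t - s) * z.
  have r01 : 0 <= r <= 1.
    have -> : r = s * (1 - z) + t * z by rewrite /r; ring.
    have /andP[s0 s1] := s01; have /andP[t0 t1] := t01.
    have z1' : 0 <= 1 - z by rewrite subr_ge0.
    rewrite addr_ge0 ?mulr_ge0//=.
    have := ler_wpM2r z1' s1; have := ler_wpM2r z0 t1; lra.
  have h1 : `|r - s| <= k%:R * d.
    have -> : r - s = (t - s) / k.+1%:R * k%:R by rewrite /r /z; ring.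
    rewrite normrM normr_nat mulrC ler_wpM2l// normrM normfV normr_nat.
    by rewrite ler_pdivrMr// mulrC.
  have h2 : `|t - r| <= d.
    have -> : t - r = (t - s) / k.+1%:R.
      by rewrite /r /z -natr1; field; rewrite natr1.
    by rewrite normrM normfV normr_nat ler_pdivrMr// mulrC.
  apply: (@le_trans _ _ (2 * (`|X r| + c))).
    by have := step' r t r01 t01 h2; lra.
  by rewrite exprS -mulrA ler_pM2l// IH.
move=> s t s01 t01; apply: le_trans (iter N s t s01 t01 _); first by rewrite lerDl.
apply: le_trans Nd; move: s01 t01 => /andP[s0 s1] /andP[t0 t1].
by rewrite ler_norml; apply/andP; split; lra.
Qed.

End trajectories.

(** * Uniform regularity and uniqueness of flows *)

Section flows.
Context {R : realType} {n : nat} {V : rkhs 'rV[R]_n 'rV[R]_n}.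
Hypothesis V2 : embedded_in_C0p 2 V.
Local Notation mu := (@lebesgue_measure R).
Implicit Types (v : R -> V) (phi psi : R -> 'rV[R]_n -> 'rV[R]_n).

Lemma flow_trajectory v phi x : is_flow v phi ->
  trajectory (fun s => rk_fun (v s) (phi s x)) (fun t => phi t x).
Proof.
case=> phi0 phiv i; split.
  by have [] := phiv x 1 _ i; rewrite ?ler01 ?lexx.
by move=> t t01; have [_ ->] := phiv x t t01 i; rewrite phi0.
Qed.

(** Gronwall for the difference of two trajectories, with c = 0; as s and t come in any order, this
    also bounds the inverse flow. *)
Lemma flow_lipschitz (B : R) : 0 <= B -> exists2 M, 1 <= M &
  forall v phi, is_L2 v -> kinetic v <= B -> is_flow v phi ->
  forall x y s t, 0 <= s <= 1 -> 0 <= t <= 1 ->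
    `|phi t x - phi t y| <= M * `|phi s x - phi s y|.
Proof.
move=> B0; have [C C0 VC] := embedded_C02_estimates V2.
have [M M1 gr] := @gronwall R n V B C B0 C0; exists M => //.
move=> v phi vL vB fl x y s t s01 t01.
have := gr v _ _ 0 vL vB (trajectory_sub (flow_trajectory x fl)
  (flow_trajectory y fl)) (lexx 0) _ s t s01 t01.
rewrite addr0; apply => r _; rewrite addr0.
by have [_ lip _] := VC (v r); exact: lip.
Qed.

Lemma flow_unique v phi psi x t : is_L2 v -> is_flow v phi -> is_flow v psi ->
  0 <= t <= 1 -> phi t x = psi t x.
Proof.
move=> vL f1 f2 t01; have [C C0 VC] := embedded_C02_estimates V2.
have [M M1 gr] := @gronwall R n V (kinetic v) C (kinetic_ge0 v) C0.
have z01 : 0 <= (0 : R) <= 1 by rewrite lexx ler01.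
have := gr v _ _ 0 vL (lexx _) (trajectory_sub (flow_trajectory x f1)
  (flow_trajectory x f2)) (lexx 0) _ 0 t z01 t01.
rewrite (f1.1 x) (f2.1 x) subrr normr0 addr0 mulr0 normr_le0 subr_eq0 => h.
apply/eqP; apply: h => r _; rewrite addr0.
by have [_ lip _] := VC (v r); exact: lip.
Qed.

(** The second difference of four trajectories starts at 0 and satisfies Gronwall's condition with c
    = M^2 |h| |k|, the bound on the product of the transported sides. The lower Lipschitz bound
    follows the flow from time 1 back to 0. *)
Lemma flow_C11 (B : R) : 0 <= B -> exists m M L : R, 0 < m /\
  forall v phi, is_L2 v -> kinetic v <= B -> is_flow v phi ->
    C11_diffeo m M L (phi 1).
Proof.
move=> B0; have [C C0 VC] := embedded_C02_estimates V2.
have [M M1 lipf] := flow_lipschitz B0.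
have [M' M1' gr] := @gronwall R n V B C B0 C0.
have M0 : 0 < M by exact: lt_le_trans M1.
have z01 : 0 <= (0 : R) <= 1 by rewrite lexx ler01.
have o01 : 0 <= (1 : R) <= 1 by rewrite lexx ler01.
exists M^-1, M, (M' * M ^+ 2); split; first by rewrite invr_gt0.
move=> v phi vL vB fl; have [phi0 _] := fl; split.
- move=> x y; have := lipf v phi vL vB fl x y 1 0 o01 z01.
  by rewrite !phi0 -ler_pdivrMl.
- by move=> x y; have := lipf v phi vL vB fl x y 0 1 z01 o01; rewrite !phi0.
move=> x h k.
have tr y := flow_trajectory y fl.
have trq := trajectory_sub (trajectory_sub (tr (x + h + k)) (tr (x + h)))
  (trajectory_sub (tr (x + k)) (tr x)).
pose c := M ^+ 2 * (`|h| * `|k|).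
have c0 : 0 <= c by rewrite !mulr_ge0// ?exprn_ge0 ?(ltW M0).
have := gr v _ _ c vL vB trq c0 _ 0 1 z01 o01.
rewrite !phi0 (addrC (x + h)) addrK (addrC x k) addrK subrr normr0 add0r.
rewrite (addrC k (x + h)) (addrC k x) opprB (addrC (phi 1 x)) addrA mulrA => H.
apply: le_trans (H _) _; last by rewrite mulrA.
move=> r r01; have [_ _ quad] := VC (v r).
have E (a b c' d : 'rV[R]_n) : a - b - (c' - d) = a - b - c' + d.
  by rewrite opprB addrA addrAC.
rewrite !E; apply: le_trans (quad _ _ _ _) _.
apply: ler_wpM2l; first by rewrite mulr_ge0.
rewrite lerD2l (_ : c = (M * `|h|) * (M * `|k|)); last by rewrite /c; ring.
apply: ler_pM => //.
  have := lipf v phi vL vB fl (x + h + k) (x + k) 0 r z01 r01.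
  by rewrite !phi0 (_ : x + h + k - (x + k) = h)//; apply/rowP => j; rewrite !mxE; ring.
have := lipf v phi vL vB fl (x + k) x 0 r z01 r01.
by rewrite !phi0 (_ : x + k - x = k)// addrC addKr.
Qed.

Lemma flow_velocity_le (C : R) v phi x s t : 0 <= C ->
  (forall u : V, forall y, `|rk_fun u y| <= C * `|u|) -> is_L2 v ->
  is_flow v phi -> 0 <= s -> s <= t -> t <= 1 ->
  `|phi t x - phi s x| <= C * \int[mu]_(r in `[s, t]) `|v r|.
Proof.
move=> C0 VC vL fl s0 st t1.
by apply: (trajectory_incr vL (flow_trajectory x fl)).
Qed.

Lemma flow_equicontinuous (B e : R) : 0 <= B -> 0 < e ->
  exists2 d, 0 < d & forall v phi x s t, is_L2 v -> kinetic v <= B ->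
    is_flow v phi -> 0 <= s <= 1 -> 0 <= t <= 1 -> `|t - s| <= d ->
    `|phi t x - phi s x| <= e.
Proof.
move=> B0 e0; have [C C0 VC] := embedded_C02_estimates V2.
have C1 : 0 < C + 1 by rewrite ltr_wpDl.
have VC0 (u : V) y : `|rk_fun u y| <= C * `|u| by have [] := VC u.
have [d d0 small] := @uniformly_small_norm R n V B (e / (C + 1)) B0 (divr_gt0 e0 C1).
exists d => // v phi x.
suff H s t : is_L2 v -> kinetic v <= B -> is_flow v phi -> 0 <= s -> s <= t ->
    t <= 1 -> t - s <= d -> `|phi t x - phi s x| <= e.
  move=> s t vL vB fl /andP[s0 s1] /andP[t0 t1].
  have [st|/ltW ts] := leP s t.
    by rewrite ger0_norm ?subr_ge0//; exact: H.
  by rewrite distrC ger0_norm ?subr_ge0// distrC; exact: H.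
move=> vL vB fl s0 st t1 td.
apply: le_trans (flow_velocity_le x C0 VC0 vL fl s0 st t1) _.
apply: le_trans (ler_wpM2l C0 (small v s t vL vB s0 st t1 td)) _.
by rewrite mulrCA ler_piMr ?(ltW e0)// ler_pdivrMr// mul1r lerDl.
Qed.

Lemma flow_displacement (B : R) : exists D, forall v phi x t,
  is_L2 v -> kinetic v <= B -> is_flow v phi -> 0 <= t <= 1 ->
  `|phi t x - x| <= D.
Proof.
have [C C0 VC] := embedded_C02_estimates V2.
have VC0 (u : V) y : `|rk_fun u y| <= C * `|u| by have [] := VC u.
exists (C * (B + 1)) => v phi x t vL vB fl /andP[t0 t1].
rewrite -[X in _ - X](fl.1 x).
apply: le_trans (flow_velocity_le x C0 VC0 vL fl (lexx 0) t0 t1) _.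
apply: ler_wpM2l => //.
apply: le_trans (Rintegral_norm_le vL (lexx 0) t0 t1 ltr01) _.
by rewrite mul1r subr0 divr1 lerD.
Qed.

Lemma L2_0 : is_L2 (0 : R -> V).
Proof.
split; first exact: measurable_cst.
rewrite (eq_integral (cst 0%E)) ?integral0//= => t _.
by rewrite normr0 expr0n.
Qed.

Lemma is_flow0 : is_flow (0 : R -> V) (fun=> id).
Proof.
split=> // x t t01 i.
have E s : rk_fun ((0 : R -> V) s) x 0 i = 0 by rewrite /rk_fun linear0 mxE.
have /andP[t0 _] := t01; split.
  have := integrable_cst_itv 0 t (0 : R); apply: eq_integrable.
    exact: measurable_itv.
  by move=> s _; rewrite /= E.
under eq_Rintegral => s _ do rewrite E.
by rewrite Rintegral_cst_itv// mul0r addr0.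
Qed.

Lemma flow_at1 v phi : is_L2 v -> is_flow v phi -> flow v 1 = phi 1.
Proof.
move=> vL fl; apply/funext => x; apply: (@flow_unique v) => //.
  by rewrite /flow; apply: xgetPex; exists phi.
by rewrite ler01 lexx.
Qed.

Lemma flow_default v : ~ (exists phi, is_flow v phi) -> flow v 1 = id.
Proof.
by move=> nf; rewrite /flow xgetPN// => phi h; apply: nf; exists phi.
Qed.

End flows.

(** * Limits of flows *)

Lemma limn_einf_le (R : realType) (u : (\bar R)^nat) (b : \bar R) (N : nat) :
  (forall k, (N <= k)%N -> (u k <= b)%E) -> (limn_einf u <= b)%E.
Proof.
move=> ub; rewrite limn_einf_lim; apply: lime_le.
  exact: ereal_nondecreasing_is_cvgn (nondecreasing_einfs u).
apply: nearW => k; apply: (@le_trans _ _ (u (maxn k N))).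
  by apply: ereal_inf_lbound; exists (maxn k N) => //=; exact: leq_maxl.
by apply: ub; exact: leq_maxr.
Qed.

Lemma subsequence_choice (P : nat -> nat -> Prop) :
  (forall k, exists N, forall i, (N <= i)%N -> P k i) ->
  exists s : nat -> nat, forall k, [/\ (k <= s k)%N, (s k <= s k.+1)%N & P k (s k)].
Proof.
move=> /choice[N NP].
pose s := fix s k := if k is k'.+1 then maxn (s k') (maxn k (N k)) else N 0%N.
exists s => k; split; last by case: k => [|k] /=; apply: NP => //; rewrite !leq_max leqnn !orbT.
  by case: k => // k /=; rewrite !leq_max leqnn orbT.
by rewrite /= leq_maxl.
Qed.

Section L2_limits.
Context {R : realType} {n : nat} {V : rkhs 'rV[R]_n 'rV[R]_n}.
Hypothesis V2 : embedded_in_C0p 2 V.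
Local Notation mu := (@lebesgue_measure R).
Local Notation I01 := (`[0, 1]%classic : set (measurableTypeR R)).

(** Riesz-Fischer for V-valued fields: along a fast subsequence the norms of successive differences
    have an integrable sum G, which gives convergence almost everywhere and the dominating function.
    The energy bound is Fatou's lemma. *)
Lemma L2_complete (w : nat -> R -> V) (B : R) :
  (forall k, is_L2 (w k)) -> (forall k, kinetic (w k) <= B) ->
  (forall e, 0 < e -> exists N, forall i j, (N <= i)%N -> (N <= j)%N ->
    kinetic (w i - w j) <= e) ->
  exists (s : nat -> nat) (v : R -> V) (g : R -> \bar R),
  [/\ forall k, (k <= s k)%N, is_L2 v,
      {ae mu, forall t, I01 t -> w (s k) t @[k --> \oo] --> v t},
      mu.-integrable I01 g /\ (forall k t, I01 t -> (`|w (s k) t|%:E <= g t)%E) &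
      forall b N, (forall k, (N <= k)%N -> kinetic (w k) <= b) -> kinetic v <= b].
Proof.
move=> wL wB wC.
have [s sP] : exists s : nat -> nat, forall k, [/\ (k <= s k)%N, (s k <= s k.+1)%N &
    forall j, (s k <= j)%N -> kinetic (w j - w (s k)) <= (4^-1) ^+ k].
  apply: (@subsequence_choice (fun k i => forall j, (i <= j)%N ->
    kinetic (w j - w i) <= (4^-1) ^+ k)) => k.
  have [|N NP] := wC ((4^-1) ^+ k); first by rewrite exprn_gt0// invr_gt0.
  by exists N => i Ni j ij; apply: NP => //; exact: leq_trans ij.
pose y k := w (s k).
have yL k : is_L2 (y k) by exact: wL.
have dL k : is_L2 (y k.+1 - y k) by exact: L2_sub.
pose D k (t : R) : \bar R := `|y k.+1 t - y k t|%:E.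
have D0 k t : (0 <= D k t)%E by rewrite lee_fin.
have mDk k : measurable_fun I01 (D k).
  apply/measurable_EFinP; exact: L2_measurable_norm (dL k).
(* With weight 2^k, the energy 4^-k and the length 1 contribute 1/2^k each; the total is written
   4/2^(k+1) to match [epsilon_trick0]. *)
have intD k : (\int[mu]_(t in I01) D k t <= (4 / (2 ^ k.+1)%:R)%:E)%E.
  have iD : mu.-integrable I01 (D k) by exact: L2_integrable_norm (dL k).
  rewrite -[leLHS]fineK; last exact: integrable_fin_num.
  rewrite lee_fin -/(Rintegral _ _ _).
  have a0 : (0 : R) < 2 ^+ k by rewrite exprn_gt0.
  apply: le_trans (Rintegral_norm_le (dL k) (lexx 0) ler01 (lexx 1) a0) _.
  have [_ sk kin] := sP k; have := ler_wpM2l (ltW a0) (kin _ sk).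
  move=> /(@lerD _ _ _ ((1 - 0) / 2 ^+ k) _)/(_ (lexx _))/le_trans; apply.
  rewrite subr0 natrX exprS exprVn le_eqVlt; apply/orP; left; apply/eqP.
  rewrite (_ : 4 = 2 * 2 :> R); last by ring.
  by rewrite exprMn; field; rewrite gt_eqF.
pose G (t : R) : \bar R := (\sum_(0 <= k <oo) D k t)%E.
have G0 t : (0 <= G t)%E by apply: nneseries_ge0.
have mG : measurable_fun I01 G.
  exact: (@ge0_emeasurable_sum _ _ _ _ D xpredT (fun k x _ _ => D0 k x)
    (fun k _ => mDk k)).
have iG : mu.-integrable I01 G.
  apply/integrableP; split=> //.
  under eq_integral => t _ do rewrite gee0_abs//.
  rewrite integral_nneseries//.
  apply: (@le_lt_trans _ _ 4%:E); last exact: ltry.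
  apply: le_trans (@epsilon_trick0 R 4 xpredT _) => //.
  by apply: lee_nneseries => // k _ _; apply: integral_ge0.
have partial k t : (`|y k t|%:E <= `|y 0%N t|%:E + G t)%E.
  apply: (@le_trans _ _ (`|y 0%N t|%:E + \sum_(0 <= i < k) D i t)%E).
    elim: k => [|k IH]; first by rewrite big_geq// adde0.
    rewrite big_nat_recr//= addeA; apply: le_trans (leeD2r _ IH).
    rewrite -EFinD lee_fin -[X in `|X| <= _](subrKC (y k t)).
    exact: ler_normD.
  by rewrite leeD2l//; apply: nneseries_lim_ge.
(* Set to 0 where the series diverges, so that the limit exists at every t and is measurable as a
   pointwise limit. *)
pose y' k t : V := if (G t < +oo)%E then y k t else 0.
have y'_cvg t : cvg (y' k t @[k --> \oo]).
  rewrite /y'; case: (boolP (G t < +oo)%E) => [Gt|_]; last by apply: cvgP; exact: cvg_cst.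
  have : cvgn (series (fun k => y k.+1 t - y k t)).
    apply: normed_cvg; apply: (@nnseries_is_cvg _ (fun k => `|y k.+1 t - y k t|)).
      by move=> k; exact: normr_ge0.
    exact: Gt.
  move=> /cvg_ex[l sl]; apply/cvg_ex; exists (y 0%N t + l).
  have -> : (fun k => y k t) = (fun k => y 0%N t + series (fun k => y k.+1 t - y k t) k).
    apply/funext => k; elim: k => [|k IH]; first by rewrite seriesEnat/= big_geq// addr0.
    by move: IH; rewrite !seriesEnat/= big_nat_recr//= addrA => <-; rewrite subrKC.
  by apply: cvgD => //; exact: cvg_cst.
pose v t : V := lim (y' k t @[k --> \oo]).
have y'v t : y' k t @[k --> \oo] --> v t by exact: y'_cvg.
have mA := emeasurable_fun_infty_o measurable_itv01 mG +oo%E.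
have my' k : measurable_fun I01 (y' k : _ -> borel V).
  apply: borel_measurable_fun => U oU.
  have mU := measurable_preimage_open measurable_itv01 (yL k).1 oU.
  have [U0|nU0] := pselect (U 0).
    have -> : I01 `&` y' k @^-1` U = (I01 `&` y k @^-1` U) `&`
        (I01 `&` [set t | (G t < +oo)%E]) `|`
        (I01 `\` (I01 `&` [set t | (G t < +oo)%E])).
      apply/seteqP; rewrite /y'; split=> t /=.
        case: (boolP (G t < +oo)%E) => Gt [It Ut]; first by left.
        by right; split=> // -[_ Gt']; move/negP: Gt; apply.
      case=> [[[It Ut] [_ Gt]]|[It nG]]; first by rewrite Gt.
      by split=> //; case: ifP => // Gt; exfalso; apply: nG.
    apply: measurableU; first exact: measurableI.
    by apply: measurableD => //; exact: measurable_itv01.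
  have -> : I01 `&` y' k @^-1` U = (I01 `&` y k @^-1` U) `&`
      (I01 `&` [set t | (G t < +oo)%E]).
    apply/seteqP; rewrite /y'; split=> t /=.
      by case: ifP => Gt [It Ut].
    by case=> [[It Ut] [_ Gt]]; rewrite Gt.
  exact: measurableI.
have mv : measurable_fun I01 (v : _ -> borel V).
  by apply: (borel_measurable_fun_cvg measurable_itv01 my') => t _; exact: y'v.
have y'sq_le k t : `|y' k t| ^+ 2 <= `|y k t| ^+ 2.
  by rewrite /y'; case: ifP => // _; rewrite normr0 expr0n sqr_ge0.
have my'2 k : measurable_fun I01 (fun t => (`|y' k t| ^+ 2)%:E).
  apply/measurable_EFinP/measurable_funX.
  apply: (@measurable_fun_continuous_comp _ _ _ _ R V (fun u => `|u|)) => //.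
  exact: norm_continuous.
have vsq t : ((`|v t| ^+ 2)%:E = limn_einf (fun k => (`|y' k t| ^+ 2)%:E))%E.
  have : (`|y' k t| ^+ 2)%:E @[k --> \oo] --> (`|v t| ^+ 2)%:E.
    apply: cvg_EFin; first by apply: nearW.
    rewrite /comp /=; under eq_cvg do rewrite expr2; rewrite expr2.
    by apply: cvgM; apply: cvg_norm; exact: y'v.
  by move=> /cvg_limn_einf_sup[-> _].
have kin_le b N : (forall k, (N <= k)%N -> kinetic (w k) <= b) ->
    (\int[mu]_(t in I01) (`|v t| ^+ 2)%:E <= b%:E)%E.
  move=> wb; under eq_integral => t _ do rewrite vsq.
  apply: le_trans (fatou _ measurable_itv01 my'2 _) _.
    by move=> k t _; rewrite lee_fin sqr_ge0.
  apply: (@limn_einf_le _ _ _ N) => k Nk.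
  apply: (@le_trans _ _ (\int[mu]_(t in I01) (`|y k t| ^+ 2)%:E)%E).
    have my2 : measurable_fun I01 (fun t => (`|y k t| ^+ 2)%:E).
      by apply/measurable_EFinP/measurable_funX; exact: L2_measurable_norm (yL k).
    apply: ge0_le_integral => //; by move=> t _; rewrite lee_fin ?sqr_ge0.
  rewrite kineticE// lee_fin; apply: wb.
  by have [ksk _ _] := sP k; exact: leq_trans ksk.
have vL : is_L2 v.
  split=> //; apply: le_lt_trans (kin_le B 0%N _) (ltry _) => k _; exact: wB.
exists s, v, (fun t => `|y 0%N t|%:E + G t)%E; split=> //.
- by move=> k; have [] := sP k.
- have := integrable_ae measurable_itv01 iG; apply: filterS => t Gfin It.
  have := y'v t; rewrite /y'.
  by rewrite -(ge0_fin_numE (G0 t)) Gfin.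
- split=> [|k t _]; last exact: partial.
  apply: integrableD => //.
  exact: L2_integrable_norm.
- move=> b N wb; rewrite -lee_fin -kineticE//; exact: kin_le wb.
Qed.

End L2_limits.

(** An ultrafilter finer than [\oo] yields all the limits at once by compactness. Countability then
    gives, for each m, an index beyond m that is close to the limits of the first m coordinates, so
    a sequence suffices. *)
Lemma bounded_extraction (R : realType) (I : countType) (f : nat -> I -> R)
    (B : I -> R) : (forall k i, `|f k i| <= B i) ->
  exists s : nat -> nat, exists l : I -> R, (forall k, (k <= s k)%N) /\
    forall i, f (s k) i @[k --> \oo] --> l i.
Proof.
move=> fB.
have [U [UU Uoo]] := ultraFilterLemma (F := \oo) _.
have lP i : exists l : R, f k i @[k --> U] --> l.
  have fBU : U [set k | `[- B i, B i]%classic (f k i)].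
    apply: (@filterS _ U _ setT); last exact: filterT.
    by move=> k _ /=; rewrite in_itv /= -ler_norml.
  have [l [_ fl]] := @segment_compact R _ _ (f k i @[k --> U]) _ fBU.
  exists l => A lA; have [//|nA] := in_ultra_setVsetC ((f^~ i) @^-1` A) UU.
  have [x [nAx Ax]] : ((~` A) `&` A) !=set0 by apply: fl lA.
  by [].
have [l fl] := choice lP.
pose P m k := (m <= k)%N /\ forall (j : 'I_m) i,
  unpickle j = Some i -> `|l i - f k i| <= m.+1%:R^-1.
have PP m : exists k, P m k.
  apply: (@filter_ex _ U); apply: filterI.
    by apply: Uoo; exists m.
  apply: filter_forall => j; case E : (unpickle j) => [i|]; last first.
    by apply: (@filterS _ U _ setT); last exact: filterT.
  have m0 : 0 < m.+1%:R^-1 :> R by rewrite invr_gt0.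
  by have /cvgrPdist_le/(_ _ m0) := fl i; apply: filterS => k h _ [<-].
have [s sP] := choice PP.
exists s, l; split=> [k|i]; first exact: (sP k).1.
apply/cvgrPdist_le => e e0.
exists (maxn (pickle i).+1 (Num.truncn e^-1)) => // m /=.
rewrite geq_max => /andP[im em]; apply: le_trans ((sP m).2 (Ordinal im) i (pickleK i)) _.
rewrite -[leRHS]invrK lef_pV2 ?posrE ?invr_gt0//.
by apply: le_trans (ltW (truncnS_gt _)) _; rewrite ler_nat ltnS.
Qed.

Lemma cvg_of_approx (R : realType) (V : completeNormedModType R) (a : nat -> V) :
  (forall e, 0 < e -> exists b : nat -> V, cvg (b k @[k --> \oo]) /\
    forall k, `|a k - b k| <= e) -> cvg (a k @[k --> \oo]).
Proof.
move=> ab; apply: cauchy_cvg; apply: cauchy_exP => e e0.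
(* Four errors of at most e/5 stay strictly below e. *)
have e4 : 0 < e / 5 by rewrite divr_gt0.
have [b [/cvg_ex[l bl] abe]] := ab _ e4.
have /cvgrPdist_le/(_ _ e4)[N _ Nb] := bl.
exists (a N), N => // k /= Nk; rewrite -ball_normE /ball_ /=.
have h1 := abe N; have h2 := abe k; have h3 := Nb N (leqnn N); have h4 := Nb k Nk.
have -> : a N - a k = (a N - b N) - (l - b N) + (l - b k) - (a k - b k).
  by rewrite !opprB !addrA !subrK.
apply: le_lt_trans (ler_normB _ _) _.
apply: le_lt_trans (lerD (ler_normD _ _) (lexx _)) _.
apply: le_lt_trans (lerD (lerD (ler_normB _ _) (lexx _)) (lexx _)) _.
by rewrite /= in h3 h4; lra.
Qed.

Section clamp.
Context {R : realType}.

(** The flow equation says nothing outside [0, 1]; this retraction lets the limit curves be defined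
    and continuous on all of R. *)
Definition clamp (t : R) : R := Num.max 0 (Num.min t 1).

Lemma clamp01 t : 0 <= clamp t <= 1.
Proof. by rewrite /clamp le_max lexx/= ge_max ler01 ge_min lexx orbT. Qed.

Lemma clamp_id t : 0 <= t <= 1 -> clamp t = t.
Proof. by case/andP=> t0 t1; rewrite /clamp min_l// max_r. Qed.

Lemma clamp_le s t : `|clamp s - clamp t| <= `|s - t|.
Proof.
rewrite /clamp; have h1 := ler_norm (s - t); have h2 := ler_norm (t - s).
rewrite distrC in h2; set r := `|s - t| in h1 h2 *.
rewrite ler_norml /Num.min /Num.max.
by do !case: ifPn; rewrite -?leNgt => *; apply/andP; split; lra.
Qed.

End clamp.

Section flow_limits.
Context {R : realType} {n : nat} {V : rkhs 'rV[R]_n 'rV[R]_n}.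
Hypothesis V2 : embedded_in_C0p 2 V.
Local Notation mu := (@lebesgue_measure R).
Local Notation I01 := (`[0, 1]%classic : set (measurableTypeR R)).
Variables (B : R) (v : nat -> R -> V) (phi : nat -> R -> 'rV[R]_n -> 'rV[R]_n).
Hypotheses (vL : forall k, is_L2 (v k)) (vB : forall k, kinetic (v k) <= B)
  (fl : forall k, is_flow (v k) (phi k)).

Let mseg (s t : R) : measurable (`[s, t]%classic : set (measurableTypeR R)).
Proof. exact: measurable_itv. Qed.

Let B0 : 0 <= B. Proof. exact: le_trans (kinetic_ge0 _) (vB 0%N). Qed.

(** Arzela-Ascoli: convergence at rational times and points extends by equicontinuity in time and
    the uniform Lipschitz bound in space. Two bounded real sequences are extracted along with the
    flows. *)
Lemma flow_extraction (a : nat -> bool -> R) (A : R) :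
  (forall k b, `|a k b| <= A) ->
  exists (s : nat -> nat) (psi : R -> 'rV[R]_n -> 'rV[R]_n) (l : bool -> R),
  [/\ forall k, (k <= s k)%N,
      forall t x, phi (s k) (clamp t) x @[k --> \oo] --> psi t x &
      forall b, a (s k) b @[k --> \oo] --> l b].
Proof.
move=> aA; have [D flD] := flow_displacement V2 B.
have [M M1 lipf] := flow_lipschitz V2 B0.
have M0 : 0 < M by exact: lt_le_trans M1.
pose xq (q : 'rV[rat]_n) : 'rV[R]_n := map_mx ratr q.
pose f k (i : (rat * 'rV[rat]_n * 'I_n) + bool) := match i with
  | inl p => phi k (clamp (ratr p.1.1)) (xq p.1.2) 0 p.2
  | inr b => a k b end.
pose Bd (i : (rat * 'rV[rat]_n * 'I_n) + bool) := match i with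
  | inl p => D + `|xq p.1.2| | inr b => A end.
have [|s [l [sk fs]]] := @bounded_extraction R _ f Bd.
  move=> k [p|b] /=; last exact: aA.
  apply: le_trans (mx_coord_le _ _ _) _.
  rewrite -[X in `|X|](subrK (xq p.1.2)); apply: le_trans (ler_normD _ _) _.
  by rewrite lerD2r; apply: flD => //; exact: clamp01.
have cvg_phi t x : cvg (phi (s k) (clamp t) x @[k --> \oo]).
  apply: cvg_of_approx => e e0.
  have e2 : 0 < e / 2 by rewrite divr_gt0.
  have [d d0 eq] := flow_equicontinuous V2 B0 e2.
  have [q tq] := rat_approx t d0.
  have [y xy] := rV_rat_approx x (divr_gt0 e2 M0).
  exists (fun k => phi (s k) (clamp (ratr q)) (xq y)); split.
    apply/cvg_ex; exists (\row_i l (inl (q, y, i))); apply: cvg_mxP => i j.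
    by rewrite mxE ord1; exact: fs (inl (q, y, j)).
  move=> k; rewrite -(subrK (phi (s k) (clamp (ratr q)) x) (phi _ (clamp t) x)) -addrA.
  apply: le_trans (ler_normD _ _) _; rewrite (splitr e); apply: lerD.
    apply: (eq (v (s k))) => //; try exact: clamp01.
    exact: le_trans (clamp_le _ _) tq.
  have z01 : 0 <= (0 : R) <= 1 by rewrite lexx ler01.
  have := lipf _ _ (vL (s k)) (vB _) (fl _) x (xq y) 0 (clamp (ratr q)) z01 (clamp01 _).
  rewrite !(fl _).1 => /le_trans; apply.
  by rewrite mulrC -ler_pdivlMr.
have [psi psiP] : exists psi : R -> 'rV[R]_n -> 'rV[R]_n,
    forall t x, phi (s k) (clamp t) x @[k --> \oo] --> psi t x.
  have H t : exists p : 'rV[R]_n -> 'rV[R]_n,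
      forall x, phi (s k) (clamp t) x @[k --> \oo] --> p x.
    have h x : exists l : 'rV[R]_n, phi (s k) (clamp t) x @[k --> \oo] --> l.
      by have /cvg_ex := cvg_phi t x.
    by have [p] := choice h; exists p.
  by have [psi] := choice H; exists psi.
exists s, psi, (fun b => l (inr b)); split=> //.
by move=> b; exact: fs (inr b).
Qed.

Variables (psi : R -> 'rV[R]_n -> 'rV[R]_n) (a : R).
Hypotheses (phi_psi : forall t x, phi k (clamp t) x @[k --> \oo] --> psi t x)
  (v_a : kinetic (v k) @[k --> \oo] --> a).

Let psi_equicontinuous e : 0 < e -> exists2 d, 0 < d &
  forall x s t, `|t - s| <= d -> `|psi t x - psi s x| <= e.
Proof.
move=> e0; have [d d0 eq] := flow_equicontinuous V2 B0 e0.
exists d => // x s t ts.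
have cl : `|phi k (clamp t) x - phi k (clamp s) x| @[k --> \oo] -->
    `|psi t x - psi s x|.
  by apply: cvg_norm; apply: cvgB; exact: phi_psi.
apply: (cvgr_to_le cl); apply: nearW => k.
apply: (eq (v k)) => //; try exact: clamp01.
exact: le_trans (clamp_le _ _) ts.
Qed.

Let psi_continuous x : continuous (fun t => psi t x).
Proof.
move=> t; apply/cvgrPdist_le => e e0.
have [d d0 eq] := psi_equicontinuous e0.
have /cvgrPdist_le/(_ _ d0) : (fun s : R => s) @ t --> t by exact: cvg_id.
by apply: filterS => s ts; exact: eq.
Qed.

(** Equicontinuity of the flows and of their limit reduces uniformity in time to finitely many grid
    points. *)
Let phi_uniform x e : 0 < e -> exists N, forall k, (N <= k)%N ->
  forall s, 0 <= s <= 1 -> `|phi k s x - psi s x| <= e.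
Proof.
move=> e0; have e3 : 0 < e / 3 by rewrite divr_gt0.
have [d1 d10 eq1] := flow_equicontinuous V2 B0 e3.
have [d2 d20 eq2] := psi_equicontinuous e3.
pose d := Num.min d1 d2; have d0 : 0 < d by rewrite lt_min d10.
pose N := (Num.truncn d^-1).+1.
have Nd : N%:R^-1 <= d.
  rewrite -[leRHS]invrK lef_pV2 ?posrE ?invr_gt0//.
  by rewrite ltW// truncnS_gt.
have [K _ KP] : \forall k \near \oo, forall j : 'I_N.+1,
    `|psi (j%:R / N%:R) x - phi k (clamp (j%:R / N%:R)) x| <= e / 3.
  apply: filter_forall => j.
  by have /cvgrPdist_le/(_ _ e3) := @phi_psi (j%:R / N%:R) x.
exists K => k Kk s s01; have /andP[s0 s1] := s01.
have N0 : (0 : R) < N%:R by rewrite ltr0n.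
have jN : (Num.truncn (s * N%:R) < N.+1)%N.
  rewrite ltnS truncn_le_nat; apply: (@le_lt_trans _ _ N%:R).
    by rewrite ger_pMl.
  by rewrite ltr_nat.
pose j := Ordinal jN; pose r : R := j%:R / N%:R.
have /andP[j1 j2] := truncn_itv (mulr_ge0 s0 (ltW N0)).
have rs : `|s - r| <= d.
  apply: le_trans Nd; rewrite ger0_norm.
    by rewrite /r lerBlDr -[X in X + _]mul1r -mulrDl ler_pdivlMr// ltW//= nat1r.
  by rewrite subr_ge0 /r ler_pdivrMr.
have r01 : 0 <= r <= 1.
  rewrite /r divr_ge0//= ler_pdivrMr// mul1r ler_nat -ltnS.
  exact: jN.
have h1 : `|phi k s x - phi k r x| <= e / 3.
  apply: (eq1 (v k)) => //; apply: le_trans rs _.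
  by rewrite ge_min lexx.
have h2 : `|psi r x - psi s x| <= e / 3.
  by apply: eq2; rewrite distrC; apply: le_trans rs _; rewrite ge_min lexx orbT.
have h3 : `|phi k r x - psi r x| <= e / 3.
  by have := KP k Kk j; rewrite /= clamp_id// distrC.
have -> : phi k s x - psi s x = (phi k s x - phi k r x) +
    ((phi k r x - psi r x) + (psi r x - psi s x)) by rewrite !addrA !subrK.
apply: le_trans (ler_normD _ _) _; apply: le_trans (lerD (lexx _) (ler_normD _ _)) _.
lra.
Qed.

Let J (u : R -> V) t x i := \int[mu]_(s in `[0, t]) rk_fun (u s) (psi s x) 0 i.

Let J_integrable (u : R -> V) x i t : is_L2 u -> 0 <= t <= 1 ->
  mu.-integrable `[0, t] (EFin \o (fun s => rk_fun (u s) (psi s x) 0 i)).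
Proof.
move=> uL /andP[t0 t1]; apply: integrable_sub01 => //.
have [C C0 VC] := embedded_C02_estimates V2.
have iC := integrableZl measurable_itv01 C (L2_integrable_norm uL).
apply: (le_integrable measurable_itv01 _ _ iC).
  by apply/measurable_EFinP; exact: (eval_measurable V2 _ uL (@psi_continuous x)).
move=> s _; rewrite /= lee_fin [leRHS]ger0_norm ?mulr_ge0//.
apply: le_trans (mx_coord_le _ _ _) _.
by have [] := VC (u s).
Qed.

Let J_mid (u w : R -> V) t x i : is_L2 u -> is_L2 w -> 0 <= t <= 1 ->
  J (2^-1 *: (u + w)) t x i = (J u t x i + J w t x i) / 2.
Proof.
move=> uL wL t01; rewrite /J mulrC -RintegralD//; [|exact: J_integrable..].
rewrite -RintegralZl//; last first.
  have := integrableD (mseg 0 t) (J_integrable x i uL t01) (J_integrable x i wL t01).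
  by apply: eq_integrable => //.
by apply: eq_Rintegral => s _; rewrite /rk_fun linearZ linearD !mxE.
Qed.

Let J_cvg t x i : 0 <= t <= 1 -> forall e, 0 < e -> exists N, forall k, (N <= k)%N ->
  `|J (v k) t x i - (psi t x - x) 0 i| <= e.
Proof.
move=> t01 e e0; have /andP[t0 t1] := t01.
have [C C0 VC] := embedded_C02_estimates V2.
(* C (B + 1) bounds C times the integral of |v k|, which multiplies the distance of the two curves
   in the integral; the 1 accounts for the end point. *)
have c0 : 0 < C * (B + 1) + 1 by rewrite ltr_wpDl// mulr_ge0// addr_ge0.
have [N NP] := phi_uniform x (divr_gt0 e0 c0); exists N => k Nk.
set d := e / _ in NP.
have d0 : 0 <= d by rewrite divr_ge0// ltW.
have fk := flow_trajectory x (fl k) i.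
have phiE : \int[mu]_(s in `[0, t]) rk_fun (v k s) (phi k s x) 0 i =
    (phi k t x - x) 0 i.
  rewrite !mxE (fk.2 t t01) (fl k).1; ring.
have iphi : mu.-integrable `[0, t] (EFin \o (fun s => rk_fun (v k s) (phi k s x) 0 i)).
  by apply: integrable_sub01 => //; exact: fk.1.
have iJ := J_integrable x i (vL k) t01.
have iv : mu.-integrable `[0, t] (EFin \o (fun r => `|v k r|)).
  by apply: integrable_sub01 => //; exact: L2_integrable_norm.
have -> : J (v k) t x i - (psi t x - x) 0 i =
    \int[mu]_(s in `[0, t]) (rk_fun (v k s) (psi s x) 0 i -
      rk_fun (v k s) (phi k s x) 0 i) + (phi k t x - psi t x) 0 i.
  by rewrite RintegralB// phiE /J !mxE; ring.
apply: le_trans (ler_normD _ _) _.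
have h1 : `|(phi k t x - psi t x) 0 i| <= d.
  exact: le_trans (mx_coord_le _ _ _) (NP k Nk t t01).
have iB : mu.-integrable `[0, t] (EFin \o (fun s => rk_fun (v k s) (psi s x) 0 i -
      rk_fun (v k s) (phi k s x) 0 i)).
  have := integrableB (mseg 0 t) iJ iphi.
  by apply: eq_integrable => //.
have h2 : `|\int[mu]_(s in `[0, t]) (rk_fun (v k s) (psi s x) 0 i -
      rk_fun (v k s) (phi k s x) 0 i)| <= C * d * (B + 1).
  apply: le_trans (le_normr_Rintegral _ iB) _ => //.
  apply: (@le_trans _ _ (\int[mu]_(s in `[0, t]) (C * d * `|v k s|))).
    apply: le_Rintegral => //.
    - by have := integrable_norm iB; apply: eq_integrable.
    - have := integrableZl (mseg 0 t) (C * d) iv.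
      by apply: eq_integrable => // s _; rewrite /= EFinM.
    move=> s /=; rewrite in_itv /= => /andP[s0 st].
    have := mx_coord_le (rk_fun (v k s) (psi s x) - rk_fun (v k s) (phi k s x)) 0 i.
    rewrite !mxE => /le_trans; apply.
    have [_ lip _] := VC (v k s); apply: le_trans (lip _ _) _.
    rewrite mulrAC ler_wpM2r// ler_wpM2l// distrC.
    by apply: NP => //; rewrite s0 (le_trans st).
  rewrite RintegralZl//; apply: ler_wpM2l; first exact: mulr_ge0.
  apply: le_trans (Rintegral_norm_le (vL k) (lexx 0) t0 t1 ltr01) _.
  by rewrite mul1r subr0 divr1 lerD.
apply: le_trans (lerD h2 h1) _.
have -> : C * d * (B + 1) + d = (C * (B + 1) + 1) * d by ring.
by rewrite /d mulrCA mulfV ?mulr1// gt_eqF.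
Qed.

(* All convex constraints that hold for a tail of the sequence (v k) are kept;
   a near-minimizing sequence for them converges strongly, so that no weak
   compactness is needed. *)
Lemma limit_velocity : exists u : R -> V, [/\ is_L2 u, is_flow u psi & kinetic u <= a].
Proof.
(* Quantifying over every bound c valid on the tail keeps the constraints convex without forming
   suprema, and makes [S] decreasing with [v k] in [S k]. *)
pose S k := [set u : R -> V | [/\ is_L2 u,
  forall c, (forall j, (k <= j)%N -> kinetic (v j) <= c) -> kinetic u <= c &
  forall t x i c, 0 <= t <= 1 ->
    (forall j, (k <= j)%N -> `|J (v j) t x i - (psi t x - x) 0 i| <= c) ->
    `|J u t x i - (psi t x - x) 0 i| <= c]].
have vS k : S k (v k).
  by split=> // [c h|t x i c t01 h]; exact: h.
have [|||||w [wS _ wC]] := @near_minimizers_cauchy R (R -> V) kinetic S B.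
- move=> k l kl u [uL u1 u2]; split=> // [c h|t x i c t01 h].
    by apply: u1 => j lj; apply: h; exact: leq_trans lj.
  by apply: u2 => // j lj; apply: h; exact: leq_trans lj.
- move=> k b c [bL b1 b2] [cL c1 c2]; split; first exact: L2_mid.
    move=> r h; have := kinetic_parallelogram V2 bL cL.
    by have := kinetic_ge0 (b - c); have := b1 r h; have := c1 r h; lra.
  move=> t x i r t01 h; rewrite J_mid//.
  have := b2 t x i r t01 h; have := c2 t x i r t01 h.
  by rewrite !ler_norml => /andP[h1 h2] /andP[h3 h4]; apply/andP; split; lra.
- by move=> u _; exact: kinetic_ge0.
- by move=> b c [bL _ _] [cL _ _]; exact: kinetic_parallelogram.
- by move=> k; exists (v k).
have wL k : is_L2 (w k) by have [] := wS k.
have wB k : kinetic (w k) <= B by have [_ h _] := wS k; exact: h.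
have [s [u [g [sk uL wu [ig wg] ulim]]]] := L2_complete V2 wL wB wC.
exists u; split=> //; last first.
  apply/ler_addgt0Pr => e e0.
  have /cvgrPdist_le/(_ _ e0)[N _ NP] := v_a.
  apply: (ulim _ N) => k Nk; have [_ h _] := wS k; apply: h => j kj.
  have := NP j (leq_trans Nk kj); rewrite /= ler_norml => /andP[h1 h2]; lra.
split=> [x|x t t01 i].
  have c0 : clamp 0 = 0 :> R by rewrite clamp_id// lexx ler01.
  have := @phi_psi 0 x; rewrite c0.
  under eq_cvg do rewrite (fl _).1.
  by move=> h; have := cvg_unique _ h (cvg_cst x); apply.
split; first exact: J_integrable.
have JE : J u t x i = (psi t x - x) 0 i; last first.
  by rewrite -/(J u t x i) JE !mxE; ring.
(* Dominated convergence: evaluation at psi_r x is continuous on V, and C g dominates the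
   velocities. *)
have Jcvg : J (w (s k)) t x i @[k --> \oo] --> J u t x i.
  have [C C0 VC] := embedded_C02_estimates V2.
  have /andP[t0 t1] := t01.
  have It : `[0, t]%classic `<=` (`[0, 1]%classic : set R).
    exact: sub_itv01.
  have mt := mseg 0 t.
  have igt : mu.-integrable `[0, t] (fun r => C%:E * g r)%E.
    by apply: integrableZl => //; exact: integrableS measurable_itv01 mt It ig.
  have ik k : mu.-integrable `[0, t] (EFin \o (fun r => rk_fun (w (s k) r) (psi r x) 0 i)).
    exact: J_integrable.
  have iu := J_integrable x i uL t01.
  have aec : {ae mu, forall r, `[0, t]%classic r ->
      (rk_fun (w (s k) r) (psi r x) 0 i)%:E @[k --> \oo] -->
      (rk_fun (u r) (psi r x) 0 i)%:E}.
    apply: filterS wu => r wr /It Ir; apply: cvg_EFin; first by apply: nearW.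
    apply: cvg_coord; rewrite /rk_fun; apply: continuous_cvg.
      exact: rk_eval_continuous.
    exact: wr.
  have aeb : {ae mu, forall r k, `[0, t]%classic r ->
      (`|(rk_fun (w (s k) r) (psi r x) 0 i)%:E| <= C%:E * g r)%E}.
    apply: aeW => r k /It Ir.
    apply: (@le_trans _ _ (C%:E * `|w (s k) r|%:E)%E).
      rewrite /= lee_fin; apply: le_trans (mx_coord_le _ _ _) _.
      by have [] := VC (w (s k) r).
    by apply: lee_wpmul2l; [rewrite lee_fin|exact: wg].
  have [_ _ dc] := dominated_convergence mt (fun k => measurable_int mu (ik k))
    (measurable_int mu iu) aec igt aeb.
  have fin k : (\int[mu]_(r in `[0%R, t]) (rk_fun (w (s k) r) (psi r x) 0 i)%:E)%E =
      (J (w (s k)) t x i)%:E.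
    by rewrite /J /Rintegral fineK//; exact: integrable_fin_num (ik k).
  have finu : (\int[mu]_(r in `[0%R, t]) (rk_fun (u r) (psi r x) 0 i)%:E)%E =
      (J u t x i)%:E.
    by rewrite /J /Rintegral fineK//; exact: integrable_fin_num iu.
  move: dc; rewrite /= finu; under eq_cvg do rewrite fin.
  by move/fine_cvg.
apply/eqP; rewrite -subr_eq0 -normr_le0; apply/ler_addgt0Pr => e e0; rewrite add0r.
have [N NP] := J_cvg x i t01 e0.
have cl : `|J (w (s k)) t x i - (psi t x - x) 0 i| @[k --> \oo] -->
    `|J u t x i - (psi t x - x) 0 i|.
  by apply: cvg_norm; apply: cvgB => //; exact: cvg_cst.
(* Since N <= k <= s k, the bound e holds on the tail defining [S (s k)], hence for its member
   [w (s k)]. *)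
apply: (cvgr_to_le cl); exists N => // k /= Nk.
have [_ _ h] := wS (s k); apply: h => // j kj; apply: NP.
by rewrite (leq_trans Nk)// (leq_trans _ kj)// sk.
Qed.

End flow_limits.

(** * Pushforward of varifolds *)

(** As u(x) - u(y) is the inner product of K x - K y with u, it suffices that |K x - K y|^2 = k(x,x)
    - k(y,x) - k(x,y) + k(y,y) tends to 0. *)
Lemma rkhs_continuous (R : realType) (X : topologicalType) (k : X -> X -> R)
    (H : rkhs X R) : is_rkhs_of k H ->
  continuous (fun p : X * X => k p.1 p.2) -> forall u : H, continuous (rk_fun u).
Proof.
move=> Hk kc u x; have [K KP] := choice Hk.
have KE p q : rk_dot H (K p) (K q) = k q p.
  by rewrite (KP p).2 (KP q).1.
apply/cvgrPdist_le => e e0.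
(* The weight for [rk_dot_le]: it makes |u|^2 / t at most e/2, and stays positive when u = 0. *)
pose t := 2 * (`|u| ^+ 2 + 1) / e.
have t0 : 0 < t by rewrite divr_gt0// mulr_gt0.
have d0 : 0 < e / 2 / t by rewrite !divr_gt0.
have cK : `|K x - K y| ^+ 2 @[y --> x] --> 0.
  have E y : `|K x - K y| ^+ 2 = k x x - k y x - k x y + k y y.
    rewrite rk_norm rk_dotBB !KE.
    have e' (a b c d : R) : a - b - (c - d) = a - b - c + d by ring.
    exact: e'.
  have c2 (f g : X -> X) : f y @[y --> x] --> x -> g y @[y --> x] --> x ->
      k (f y) (g y) @[y --> x] --> k x x.
    move=> fx gx.
    exact: (cvg_comp (fun y => (f y, g y)) (fun p => k p.1 p.2)
      (cvg_pair fx gx) (kc (x, x))).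
  have c_id : y @[y --> x] --> x by exact: cvg_id.
  have c_x : (fun=> x) @ x --> x by exact: cvg_cst.
  have : (k x x - k y x - k x y + k y y) @[y --> x] -->
      k x x - k x x - k x x + k x x.
    apply: cvgD; last exact: (c2 id id c_id c_id).
    apply: cvgB; last exact: (c2 (fun=> x) id c_x c_id).
    apply: cvgB; last exact: (c2 id (fun=> x) c_id c_x).
    exact: cvg_cst.
  rewrite subrr sub0r addNr; under eq_cvg do rewrite -E.
  exact.
have /cvgrPdist_le/(_ _ d0) := cK; apply: filterS => y.
rewrite sub0r normrN ger0_norm ?sqr_ge0// => h.
rewrite -!(KP _).2 -rk_dotBl; apply: le_trans (rk_dot_le _ _ t0) _.
rewrite (splitr e); apply: lerD.
  by rewrite -ler_pdivlMl// mulrC.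
have -> : `|u| ^+ 2 / t <= e / 2 = (`|u| ^+ 2 <= `|u| ^+ 2 + 1).
  rewrite ler_pdivrMr//; congr (_ <= _); rewrite /t; field.
  by rewrite gt_eqF.
by rewrite lerDl.
Qed.

Lemma embedded_C01_bounded (R : realType) n d (le_dn : (d <= n)%N)
    (H : rkhs ('rV[R]_n * grass R le_dn)%type R) : embedded_in_C01 H ->
  exists C : R, forall (u : H) p, `|rk_fun u p| <= C * `|u|.
Proof.
case=> _ [C HC]; exists C => u p; rewrite -lee_fin.
apply: le_trans (HC u); rewrite /C01_position_norm.
apply: (@le_trans _ _ (ereal_sup (range (fun p => `|rk_fun u p|%:E)))).
  by apply: ereal_sup_ubound; exists p.
(* A constant curve shows that the differential term of the norm is nonnegative. *)
rewrite leeDl//; apply: (@le_trans _ _ (diff_norm (rk_fun u) p)); last first.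
  by apply: ereal_sup_ubound; exists p.
apply: (@le_trans _ _ `|'D_1 (rk_fun u \o (fun=> p)) (0 : R)|%:E).
  by rewrite lee_fin.
apply: ereal_sup_ubound; exists (fun=> p) => //; split=> //.
exists 0; last by rewrite normr0.
exact: is_derive_cst.
Qed.

Lemma fin_cvg_eq (R : realType) (a : nat -> \bar R) (b : nat -> R) (x : \bar R)
    (y : R) : (forall k, a k = (b k)%:E) -> x = y%:E ->
  a k @[k --> \oo] --> x -> b k @[k --> \oo] --> y.
Proof.
by move=> ab ->; under eq_cvg do rewrite ab; move/fine_cvg.
Qed.

Section pushforward.
Context {R : realType} {n d : nat} {le_dn : (d <= n)%N}.
Variables (m M L : R) (m_gt0 : 0 < m).
Variables (omega : 'rV[R]_n * grass R le_dn -> R) (c : R).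
Hypotheses (omega_cont : continuous omega) (omega_le : forall p, `|omega p| <= c).

Let integrand (f : 'rV[R]_n -> 'rV[R]_n) (p : 'rV[R]_n * grass R le_dn) :=
  omega (f p.1, grass_act (jacobian f p.1) p.2) * grass_jac (jacobian f p.1) p.2.

Let omega_cvg (T : Type) (G : set_system T) {FG : Filter G}
    (g : T -> 'rV[R]_n) (h : T -> grass R le_dn) y z :
  g q @[q --> G] --> y -> h q @[q --> G] --> z ->
  omega (g q, h q) @[q --> G] --> omega (y, z).
Proof.
move=> gy hz.
have cp : (g q, h q) @[q --> G] --> (y, z) by exact: (cvg_pair gy hz).
by apply: continuous_cvg; [exact: omega_cont|exact: cp].
Qed.

Lemma integrand_continuous f : C11_diffeo m M L f -> continuous (integrand f).
Proof.
move=> fC p; have FP : Filter (nbhs p) by exact: nbhs_filter.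
have c1 : p'.1 @[p' --> p] --> p.1 by exact: cvg_fst.
have c2 : p'.2 @[p' --> p] --> p.2 by exact: cvg_snd.
have cf : f p'.1 @[p' --> p] --> f p.1.
  apply/cvgrPdist_le => e e0; have [_ fM _] := fC.
  have M1 : 0 < `|M| + 1 by rewrite ltr_wpDl.
  have /cvgrPdist_le/(_ _ (divr_gt0 e0 M1)) := c1; apply: filterS => q h.
  apply: le_trans (fM _ _) _; apply: (@le_trans _ _ ((`|M| + 1) * `|p.1 - q.1|)).
    by rewrite ler_wpM2r// (le_trans (ler_norm _))// lerDl.
  by rewrite -ler_pdivlMl// mulrC.
have cJ : jacobian f p'.1 @[p' --> p] --> jacobian f p.1.
  apply: continuous_cvg; [exact: (C11_jacobian_continuous fC)|exact: c1].
have cj := cvg_grass_jac (FF := FP) cJ c2.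
have ca := cvg_grass_act (FF := FP) (fun q => C11_jacobian_unit q.1 m_gt0 fC)
  (C11_jacobian_unit p.1 m_gt0 fC) cJ c2.
have h := cvgM (omega_cvg cf ca) cj.
exact: h.
Qed.

Variables (mu : varifold R le_dn) (F : nat -> 'rV[R]_n -> 'rV[R]_n)
  (f : 'rV[R]_n -> 'rV[R]_n).
Hypotheses (FC : forall k, C11_diffeo m M L (F k))
  (Ff : forall x, F k x @[k --> \oo] --> f x).

Lemma pushforward_pair_cvg :
  pushforward_pair (F k) mu omega @[k --> \oo] --> pushforward_pair f mu omega.
Proof.
have fC := C11_diffeo_lim FC Ff.
have mi g : C11_diffeo m M L g -> measurable_fun setT
    ((EFin \o integrand g) : borel ('rV[R]_n * grass R le_dn)%type -> \bar R).
  move=> gC; apply/measurable_EFinP.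
  apply: (measurability _ (measurable_realfun.RGenOpens.measurableE R)) => //.
  move=> _ [_ [x [y ->]] <-]; rewrite setTI; apply: sub_sigma_algebra.
  apply: open_comp => [p _|]; last exact: interval_open.
  exact: integrand_continuous.
(* The bound of [grass_jac_le] on the change of volume; the constant c b dominates all integrands
   and is integrable since [mu] is finite. *)
pose b := Num.sqrt (d`!%:R * (n%:R * ((n%:R * (1 * M)) * (n%:R * (1 * M)))) ^+ d).
have ib : mu.-integrable setT (EFin \o cst (c * b)).
  exact: finite_measure_integrable_cst.
have i_le g p : C11_diffeo m M L g -> `|integrand g p| <= c * b.
  move=> gC; rewrite /integrand normrM; apply: ler_pM => //.
  rewrite ger0_norm; last by apply: ltW; apply: grass_jac_gt0; exact: C11_jacobian_unit gC.
  by apply: grass_jac_le => i j; exact: C11_jacobian_entry gC.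
have cvg_i p : integrand (F k) p @[k --> \oo] --> integrand f p.
  have cJ := @C11_jacobian_lim _ _ _ _ _ _ _ FC Ff p.1.
  have c2 : (fun _ : nat => p.2) @ \oo --> p.2 by exact: cvg_cst.
  have FP : Filter \oo by exact: eventually_filter.
  have cj := cvg_grass_jac (FF := FP) cJ c2.
  have ca := cvg_grass_act (FF := FP) (fun k => C11_jacobian_unit p.1 m_gt0 (FC k))
    (C11_jacobian_unit p.1 m_gt0 fC) cJ c2.
  have h := cvgM (omega_cvg (@Ff p.1) ca) cj.
  exact: h.
have ii g : C11_diffeo m M L g -> mu.-integrable setT (EFin \o integrand g).
  move=> gC; apply: (le_integrable measurableT (mi g gC) _ ib) => p _.
  rewrite /= lee_fin; apply: le_trans (i_le g p gC) _; exact: ler_norm.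
have aec : {ae mu, forall p, setT p ->
    (EFin \o integrand (F k)) p @[k --> \oo] --> (EFin \o integrand f) p}.
  by apply: aeW => p _; apply: cvg_EFin; [exact: nearW|exact: cvg_i].
have aeb : {ae mu, forall p k, setT p ->
    (`|(EFin \o integrand (F k)) p| <= (EFin \o cst (c * b)%R) p)%E}.
  by apply: aeW => p k _; rewrite /= lee_fin; exact: i_le.
have [_ _ dc] := dominated_convergence measurableT (fun k => mi _ (FC k))
  (mi _ fC) aec ib aeb.
have fin g : C11_diffeo m M L g ->
    (\int[mu]_p (EFin \o integrand g) p)%E = (pushforward_pair g mu omega)%:E.
  move=> gC; have := integrable_fin_num measurableT (ii g gC).
  by move=> /fineK <-.
exact: (fin_cvg_eq (fun k => fin _ (FC k)) (fin f fC) dc).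
Qed.

End pushforward.

(** * The energy *)

Section dual_norm.
Context {R : realType} {X : Type} {F : normedModType R} {H : rkhs X F}.

Lemma rk_dual_norm_ge0 (l : (X -> F) -> R) : (0 <= rk_dual_norm H l)%E.
Proof.
apply: (@le_trans _ _ `|l (rk_fun (0 : H))|%:E); first by rewrite lee_fin.
by apply: ereal_sup_ubound; exists 0 => //=; rewrite normr0.
Qed.

Lemma rk_dual_norm_leP (l : (X -> F) -> R) (c : R) :
  (rk_dual_norm H l <= c%:E)%E <->
  forall u : H, `|u| <= 1 -> `|l (rk_fun u)| <= c.
Proof.
split=> [lc u u1|lc].
  by rewrite -lee_fin; apply: le_trans lc; apply: ereal_sup_ubound; exists u.
by apply: ge_ereal_sup => _ [u u1 <-]; rewrite lee_fin lc.
Qed.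

End dual_norm.

Section energy_theory.
Context {R : realType} {n d : nat} {le_dn : (d <= n)%N}.
Context {V : rkhs 'rV[R]_n 'rV[R]_n} {W : rkhs ('rV[R]_n * grass R le_dn)%type R}.
Hypothesis V2 : embedded_in_C0p 2 V.
Variables (mu0 mutar : varifold R le_dn) (lambda : R) (lambda_gt0 : 0 < lambda).

Definition mismatch (f : 'rV[R]_n -> 'rV[R]_n) : \bar R :=
  rk_dual_norm W (fun omega => pushforward_pair f mu0 omega - varifold_pair mutar omega).

Lemma mismatch_ge0 f : (0 <= mismatch f)%E.
Proof. exact: rk_dual_norm_ge0. Qed.

Lemma energyE (v : R -> V) : is_L2 v -> energy W lambda mu0 mutar v =
  ((2^-1 * kinetic v)%:E + lambda%:E * mismatch (flow v 1) ^+ 2)%E.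
Proof. by move=> vL; rewrite /energy kineticE// -EFinM. Qed.

Lemma energy_ge0 (v : R -> V) : is_L2 v ->
  (0 <= energy W lambda mu0 mutar v)%E.
Proof.
move=> vL; rewrite energyE//; apply: adde_ge0.
  by rewrite lee_fin mulr_ge0 ?invr_ge0// kinetic_ge0.
apply: mule_ge0; first by rewrite lee_fin ltW.
by apply: expe_ge0; exact: mismatch_ge0.
Qed.

Lemma kinetic0 : kinetic (0 : R -> V) = 0.
Proof.
rewrite /kinetic; under eq_Rintegral => t _ do rewrite normr0 expr0n.
by rewrite Rintegral_cst_itv// mul0r.
Qed.

(* A field without a flow has the default flow, for which the zero field is at
   least as good, so the existence of flows is not needed. *)
Lemma energy_with_flow (v : R -> V) : is_L2 v -> exists w : R -> V,
  [/\ is_L2 w, exists phi, is_flow w phi &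
      (energy W lambda mu0 mutar w <= energy W lambda mu0 mutar v)%E].
Proof.
move=> vL; have [fv|nf] := pselect (exists phi, is_flow v phi).
  by exists v.
exists 0; split; [exact: L2_0|by exists (fun=> id); exact: is_flow0|].
rewrite (energyE L2_0) (energyE vL) (flow_default nf).
rewrite (flow_at1 V2 L2_0 is_flow0) kinetic0 mulr0 add0e.
by apply: leeDr; rewrite lee_fin mulr_ge0 ?invr_ge0// kinetic_ge0.
Qed.

End energy_theory.

Lemma prod_kernel_continuous (R : realType) (X Y : topologicalType)
    (k : X -> X -> R) (l : Y -> Y -> R) :
  continuous (fun p : X * X => k p.1 p.2) ->
  continuous (fun p : Y * Y => l p.1 p.2) ->
  continuous (fun p : (X * Y) * (X * Y) => k p.1.1 p.2.1 * l p.1.2 p.2.2).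
Proof.
move=> kc lc p; have FP : Filter (nbhs p) by exact: nbhs_filter.
have c1 : q.1 @[q --> p] --> p.1 by exact: cvg_fst.
have c2 : q.2 @[q --> p] --> p.2 by exact: cvg_snd.
have f1 (q : X * Y) : r.1 @[r --> q] --> q.1 by exact: cvg_fst.
have f2 (q : X * Y) : r.2 @[r --> q] --> q.2 by exact: cvg_snd.
have c11 : q.1.1 @[q --> p] --> p.1.1 by apply: cvg_comp c1 (f1 _).
have c12 : q.1.2 @[q --> p] --> p.1.2 by apply: cvg_comp c1 (f2 _).
have c21 : q.2.1 @[q --> p] --> p.2.1 by apply: cvg_comp c2 (f1 _).
have c22 : q.2.2 @[q --> p] --> p.2.2 by apply: cvg_comp c2 (f2 _).
have ck := cvg_comp (fun q => (q.1.1, q.2.1)) (fun p => k p.1 p.2)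
  (cvg_pair c11 c21) (kc (p.1.1, p.2.1)).
have cl := cvg_comp (fun q => (q.1.2, q.2.2)) (fun p => l p.1 p.2)
  (cvg_pair c12 c22) (lc (p.1.2, p.2.2)).
have h := cvgM (ck _ _ _) (cl _ _ _).
exact: h.
Qed.

(** * Lower semicontinuity and existence of a minimizer *)

Section minimizer.
Context {R : realType} {n d : nat} {le_dn : (d <= n)%N}.
Context {V : rkhs 'rV[R]_n 'rV[R]_n} {W : rkhs ('rV[R]_n * grass R le_dn)%type R}.
Hypotheses (V2 : embedded_in_C0p 2 V) (W1 : embedded_in_C01 W).
Hypothesis W_continuous : forall u : W, continuous (rk_fun u).
Variables (mu0 mutar : varifold R le_dn) (lambda : R) (lambda_gt0 : 0 < lambda).
Local Notation mismatch := (mismatch (W := W) mu0 mutar).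
Local Notation energy := (energy W lambda mu0 mutar).

(** The bound is tested on one element of the unit ball at a time, where the pairings converge; no
    uniformity over the ball is required. *)
Lemma mismatch_lim (m M L : R) (F : nat -> 'rV[R]_n -> 'rV[R]_n) f
    (b : nat -> R) l : 0 < m ->
  (forall k, C11_diffeo m M L (F k)) ->
  (forall x, F k x @[k --> \oo] --> f x) ->
  (forall k, (mismatch (F k) <= (b k)%:E)%E) -> b k @[k --> \oo] --> l ->
  (mismatch f <= l%:E)%E.
Proof.
move=> m0 FC Ff Fb bl; apply/rk_dual_norm_leP => u u1.
have [C HC] := embedded_C01_bounded W1.
have cP := pushforward_pair_cvg m0 (@W_continuous u) (HC u) (mu := mu0) FC Ff.
have cN : `|pushforward_pair (F k) mu0 (rk_fun u) - varifold_pair mutar (rk_fun u)|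
    @[k --> \oo] -->
    `|pushforward_pair f mu0 (rk_fun u) - varifold_pair mutar (rk_fun u)|.
  by apply: cvg_norm; apply: cvgB cP _; exact: cvg_cst.
apply: (ler_cvg_to cN bl); apply: nearW => k.
by move/rk_dual_norm_leP: (Fb k); exact.
Qed.

(** As lambda > 0, an infinite mismatch would make the energy infinite; below a finite level the
    data term is a real number. *)
Lemma energy_le_split (v : R -> V) (c : R) : is_L2 v -> (energy v <= c%:E)%E ->
  exists b, [/\ 0 <= b, mismatch (flow v 1) = b%:E &
    2^-1 * kinetic v + lambda * b ^+ 2 <= c].
Proof.
move=> vL; rewrite (energyE mu0 mutar lambda vL).
have := mismatch_ge0 (W := W) mu0 mutar (flow v 1).
case: (mismatch (flow v 1)) => [b| |]//.
  by move=> b0; rewrite -EFin_expe -EFinM -EFinD lee_fin => h; exists b.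
by move=> _; rewrite expe2 mulyy gt0_muley ?lte_fin// addey// leye_eq.
Qed.

Lemma energy_compactness (c : R) (v : nat -> R -> V) :
  (forall k, is_L2 (v k)) -> (forall k, exists phi, is_flow (v k) phi) ->
  (forall k, (energy (v k) <= (c + k.+1%:R^-1)%:E)%E) ->
  exists2 u : R -> V, is_L2 u & (energy u <= c%:E)%E.
Proof.
move=> vL /choice[phi fl] vE.
have [b bP] := choice (fun k => energy_le_split (vL k) (vE k)).
have b0 k : 0 <= b k by have [] := bP k.
have bE k : 2^-1 * kinetic (v k) + lambda * b k ^+ 2 <= c + k.+1%:R^-1.
  by have [] := bP k.
have inv1 k : (k.+1%:R^-1 : R) <= 1 by rewrite invf_le1// ler1n.
have kc k : 2^-1 * kinetic (v k) + lambda * b k ^+ 2 <= c + 1.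
  by apply: le_trans (bE k) _; rewrite lerD2l.
have lb k : 0 <= lambda * b k ^+ 2 by rewrite mulr_ge0 ?sqr_ge0// ltW.
have kB k : kinetic (v k) <= 2 * (c + 1) by have := kc k; have := lb k; lra.
(* From b^2 <= (c + 1) / lambda and b <= b^2 + 1. *)
have bB k : b k <= (c + 1) / lambda + 1.
  have : b k ^+ 2 <= (c + 1) / lambda.
    rewrite ler_pdivlMr// mulrC; have := kc k; have := kinetic_ge0 (v k); lra.
  have := sqr_ge0 (b k - 1); rewrite sqrrB1 -mulr_natl; have := sqr_ge0 (b k).
  by move: (b k ^+ 2) (b k) => x y; lra.
pose a k (i : bool) := if i then kinetic (v k) else b k.
pose A := 2 * (c + 1) + ((c + 1) / lambda + 1).
have aA k i : `|a k i| <= A.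
  have k0 := kinetic_ge0 (v k); rewrite /a ger0_norm; last by case: (i).
  have := kB k; have := bB k; have := b0 k; rewrite /A.
  by case: i; move: ((c + 1) / lambda) => x; lra.
have [s [psi [l [sk sphi sa]]]] := flow_extraction V2 vL kB fl aA.
have [u [uL uf ul]] := limit_velocity V2 (fun k => vL (s k)) (fun k => kB (s k))
  (fun k => fl (s k)) sphi (sa true).
exists u => //; rewrite (energyE mu0 mutar lambda uL) (flow_at1 V2 uL uf).
have one : clamp 1 = 1 :> R by rewrite clamp_id// ler01 lexx.
have [m [M [L [m0 FC]]]] := flow_C11 V2 (le_trans (kinetic_ge0 _) (kB 0%N)).
have mis : (mismatch (psi 1%R) <= (l false)%:E)%E.
  apply: (mismatch_lim m0 (F := fun k => phi (s k) 1%R) (b := b \o s)) => [k|x|k|].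
  - exact: FC _ _ (vL (s k)) (kB (s k)) (fl (s k)).
  - by have := sphi 1%R x; rewrite one; apply.
  - by have [_ <- _] := bP (s k); rewrite (flow_at1 V2 (vL _) (fl _)).
  - exact: sa false.
have lim_le : 2^-1 * l true + lambda * l false ^+ 2 <= c.
  have cl : 2^-1 * kinetic (v (s k)) + lambda * b (s k) ^+ 2 @[k --> \oo] -->
      2^-1 * l true + lambda * l false ^+ 2.
    have ct : kinetic (v (s k)) @[k --> \oo] --> l true by exact: sa true.
    have cf : b (s k) @[k --> \oo] --> l false by exact: sa false.
    by apply: cvgD; apply: cvgMl_tmp => //; exact: (cvgM cf cf).
  have ch : c + k.+1%:R^-1 @[k --> \oo] --> c + 0.
    by apply: cvgD; [exact: cvg_cst|exact: cvg_harmonic].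
  rewrite -[leRHS]addr0; apply: (ler_cvg_to cl ch); apply: nearW => k.
  apply: le_trans (bE _) _; rewrite lerD2l lef_pV2 ?posrE// ler_nat ltnS.
  exact: sk.
have l0 := le_trans (mismatch_ge0 (W := W) mu0 mutar (psi 1)) mis.
move: mis; have := mismatch_ge0 (W := W) mu0 mutar (psi 1).
case: (mismatch (psi 1)) => [x| |]// x0 xl; rewrite !lee_fin in x0 xl l0.
rewrite -EFin_expe -EFinM -EFinD lee_fin; apply: le_trans lim_le.
apply: lerD; first by rewrite ler_pM2l ?invr_gt0.
by rewrite ler_pM2l// ler_sqr.
Qed.

Lemma energy_minimizer : exists2 v : R -> V, is_L2 v &
  forall w : R -> V, is_L2 w -> (energy v <= energy w)%E.
Proof.
pose I := ereal_inf [set energy w | w in [set w : R -> V | is_L2 w]].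
have Ile (w : R -> V) : is_L2 w -> (I <= energy w)%E.
  by move=> wL; apply: ereal_inf_lbound; exists w.
have I0 : (0 <= I)%E.
  by apply: le_ereal_inf_tmp => _ [w wL <-]; exact: (energy_ge0 mu0 mutar lambda_gt0 wL).
(* If the infimum is infinite, every field has infinite energy and the zero field will do. *)
have [Ifin|/negP] := boolP (I \is a fin_num); last first.
  move/negP; rewrite ge0_fin_numE// -leNgt leye_eq => /eqP Iy.
  exists 0; first exact: L2_0.
  by move=> w /Ile; rewrite Iy leye_eq => /eqP ->; exact: leey.
have step k : exists v : R -> V, [/\ is_L2 v, exists phi, is_flow v phi &
    (energy v <= (fine I + k.+1%:R^-1)%:E)%E].
  have k0 : 0 < k.+1%:R^-1 :> R by rewrite invr_gt0.
  have [_ [w wL <-] wI] := lb_ereal_inf_adherent k0 Ifin.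
  have [v [vL vf vE]] := energy_with_flow (W := W) V2 mu0 mutar lambda wL.
  by exists v; split=> //; apply: le_trans vE _; rewrite EFinD fineK// ltW.
have [v vP] := choice step.
have [u uL uE] := @energy_compactness (fine I) v
  (fun k => let: And3 h _ _ := vP k in h) (fun k => let: And3 _ h _ := vP k in h)
  (fun k => let: And3 _ _ h := vP k in h).
exists u => [|w wL]; first exact: uL.
by rewrite (fineK Ifin) in uE; exact: le_trans uE (Ile w wL).
Qed.

End minimizer.

Theorem theorem4p3 (R : realType) (n d : nat) (le_dn : (d <= n)%N)
  (V : rkhs 'rV[R]_n 'rV[R]_n)
  (kpos : 'rV[R]_n -> 'rV[R]_n -> R)
  (kG : grass R le_dn -> grass R le_dn -> R)
  (kpos_continuous : continuous (fun p : 'rV[R]_n * 'rV[R]_n => kpos p.1 p.2))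
  (kpos_pos_def : pos_def_kernel kpos)
  (kpos_C0 : forall x, vanishes_at_infinity (fun y => `|kpos x y|%:E))
  (kG_continuous :
    continuous (fun p : grass R le_dn * grass R le_dn => kG p.1 p.2))
  (kG_pos_def : pos_def_kernel kG)
  (W : rkhs ('rV[R]_n * grass R le_dn)%type R)
  (W_kernel : is_rkhs_of (fun p q => kpos p.1 q.1 * kG p.2 q.2) W)
  (mu0 mutar : varifold R le_dn) (lambda : R) (lambda_gt0 : 0 < lambda)
  (V_embedded : embedded_in_C0p 2 V)
  (W_embedded : embedded_in_C01 W)
  (K : set ('rV[R]_n * grass R le_dn)) (K_compact : compact K)
  (supp_mu0 : varifold_supp mu0 `<=` K) :
  exists2 v : R -> V, is_L2 v &
    forall w : R -> V, is_L2 w ->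
      (energy W lambda mu0 mutar v <= energy W lambda mu0 mutar w)%E.

Proof.
(* The continuity of the elements of [W] is drawn from the continuity of the product kernel. *)
apply: energy_minimizer => //; apply: rkhs_continuous W_kernel _.
exact: prod_kernel_continuous.
Qed.
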